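(* Let $s\in\mathbb N$, $\gamma_1\in\mathbb R$. For $u\in\mathcal W^{s,\gamma_1}_{\rm cone}(\mathbb R\times\mathbb R^q\times X^\wedge)$ put $v(t,r,x,y):=u(t,r[t]^{-1},x,y[t]^{-1})$. Then one has the equivalence of norms $$\|u\|_{\mathcal W^{s,\gamma_1}_{\rm cone}(\mathbb R\times\mathbb R^q\times X^\wedge)}\sim\Big\{\|v\|^2_{\mathcal W^0(\mathbb R\times\mathbb R^q,\mathcal K^{0,\gamma_1}(X^\wedge))}+\sum_{|\beta|=s}\|D_t^{\beta'}D_y^{\beta''}v\|^2_{\mathcal W^0(\mathbb R\times\mathbb R^q,\mathcal K^{0,\gamma_1}(X^\wedge))}$$ $$+\sum_{|\alpha|=s,\,1\le j\le N}\|D_j^\alpha v\|^2_{\mathcal W^0(\mathbb R\times\mathbb R^q,\mathcal K^{0,\gamma_1;-s}(X^\wedge))}+\sum_{|\alpha|=s,\,1\le j\le N,\,|\beta|=s}\|D_t^{\beta'}D_y^{\beta''}D_j^\alpha v\|^2_{\mathcal W^0(\mathbb R\times\mathbb R^q,\mathcal K^{0,\gamma_1;-s}(X^\wedge))}\Big\}^{1/2},$$ where $\beta=(\beta',\beta'')\in\mathbb N\times\mathbb N^q$.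
   Context: A cut-off function is a real-valued $\omega\in C_0^\infty(\overline{\mathbb R}_+)$ with $\omega=1$ near $0$. $t\mapsto[t]$ is a smooth strictly positive function on $\mathbb R$ with $[t]=|t|$ for large $|t|$. $\Gamma_\beta=\{z\in\mathbb C:\mathrm{Re}\,z=\beta\}$, $Mu(z)=\int_0^\infty r^{z-1}u(r)dr$. $X$ is a smooth compact manifold, $n=\dim X$, $X^\wedge=\mathbb R_+\times X\ni(r,x)$. $\mathcal H^{s,\gamma}(X^\wedge)$: completion of $C_0^\infty(X^\wedge)$ in the norm $\{\int_{\Gamma_{(n+1)/2-\gamma}}\|R^s(\mathrm{Im}\,z)Mu(z)\|^2_{L^2(X)}\frac{dz}{2\pi i}\}^{1/2}$, where $R^s(\lambda)\in L^s_{\rm cl}(X;\mathbb R)$ is a classical parameter-dependent pseudo-differential operator family of order $s$ inducing isomorphisms $H^r(X)\to H^{r-s}(X)$, $r\in\mathbb R$. $H^s_{\rm cone}(X^\asymp)$, $X^\asymp=\mathbb R\times X$: all $u\in H^s_{\rm loc}(\mathbb R\times X)$ such that for every diffeomorphism $\chi_1:U\to U_1$ of a coordinate neighbourhood $U\subset X$ to an open $U_1\subset S^n$, $\chi(r,x)=r\chi_1(x)$, $\Gamma=\chi(\mathbb R_+\times U)\subset\mathbb R^{n+1}$, and every $\varphi\in C_0^\infty(U)$, $(1-\omega(r))\varphi(x)u(\pm r,x)\in\chi^*(H^s(\mathbb R^{n+1})|_\Gamma)$. $H^s_{\rm cone}(X^\wedge)=H^s_{\rm cone}(X^\asymp)|_{X^\wedge}$.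 $\mathcal K^{s,\gamma}(X^\wedge)=\{\omega u_0+(1-\omega)u_\infty:u_0\in\mathcal H^{s,\gamma}(X^\wedge),\ u_\infty\in H^s_{\rm cone}(X^\wedge)\}$, $\mathcal K^{s,\gamma;e}(X^\wedge)=\langle r\rangle^{-e}\mathcal K^{s,\gamma}(X^\wedge)$, with group action $(\kappa_\delta u)(r,x)=\delta^{(n+1)/2}u(\delta r,x)$, $\delta\in\mathbb R_+$. For a Hilbert space $H$ with group action $\kappa$ (strongly continuous group of isomorphisms $\kappa_\delta$, $\kappa_\delta\kappa_{\delta'}=\kappa_{\delta\delta'}$), $\mathcal W^s(\mathbb R^p,H)$ is the completion of $\mathcal S(\mathbb R^p,H)$ in the norm $\{\int\langle\eta\rangle^{2s}\|\kappa_{\langle\eta\rangle}^{-1}\hat u(\eta)\|^2_Hd\eta\}^{1/2}$; here $\mathbb R\times\mathbb R^q=\mathbb R^{1+q}\ni(t,y)$. With $(\delta_{[t]}f)(t,r,x,y):=f(t,[t]r,x,[t]y)$, $\mathcal W^{s,\gamma_1}_{\rm cone}(\mathbb R\times\mathbb R^q\times X^\wedge):=\delta_{[t]}\mathcal W^s(\mathbb R\times\mathbb R^q,\mathcal K^{s,\gamma_1}(X^\wedge))$, with norm $\|u\|=\|\delta_{[t]}^{-1}u\|_{\mathcal W^s(\mathbb R^{1+q},\mathcal K^{s,\gamma_1}(X^\wedge))}$. The operators $D_j^\alpha\in\mathrm{Diff}^{|\alpha|}(X^\wedge)$, $\alpha\in\mathbb N^{1+n}$, $|\alpha|\le s$,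 $1\le j\le N$, form a finite system of differential operators such that for every $\gamma$: $\|u\|_{\mathcal K^{s,\gamma}}$ is equivalent to $\{\|u\|^2_{\mathcal K^{0,\gamma}}+\sum_{0<|\alpha|\le s,j}\|D_j^\alpha u\|^2_{\mathcal K^{0,\gamma;-|\alpha|}}\}^{1/2}$ and to $\{\|u\|^2_{\mathcal K^{0,\gamma}}+\sum_{|\alpha|=s,j}\|D_j^\alpha u\|^2_{\mathcal K^{0,\gamma;-s}}\}^{1/2}$, $u\in\mathcal K^{s,\gamma}$ iff $u\in\mathcal K^{0,\gamma}$ and all $D_j^\alpha u\in\mathcal K^{0,\gamma;-s}$, and $D_j^\alpha$ commutes with $u(r,x)\mapsto u(\lambda r,x)$, $\lambda\in\mathbb R_+$. Concretely: for an open covering $U_1,\dots,U_N$ of $X$ by coordinate neighbourhoods, a subordinate partition of unity $\phi_j$, diffeomorphisms $\chi_{j,1}:U_j\to V_j\subset S^n$ and $\chi_j(r,x)=r\chi_{j,1}(x)$, take $D_j^\alpha u=r^{|\alpha|}D_{\tilde x}^\alpha((\phi_ju)\circ\chi_j^{-1})$ (expressed again in $(r,x)$, $r=|\tilde x|$). *)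

(* Defs.v *)
From HB Require Import structures.
From mathcomp Require Import all_boot all_order all_algebra.
From mathcomp Require Import complex.
From mathcomp Require Import all_classical all_reals all_analysis.

Set Implicit Arguments.
Unset Strict Implicit.
Unset Printing Implicit Defensive.

Import Order.TTheory GRing.Theory Num.Theory.
Import numFieldNormedType.Exports.

Local Open Scope classical_set_scope.
Local Open Scope ring_scope.
Local Open Scope complex_scope.

Definition norm_equivalent {R : realType} {T : Type} (A : set T)
    (f g : T -> \bar R) :=
  exists c1 c2 : R, 0 < c1 /\ 0 < c2 /\
    forall u, A u -> (c1%:E * f u <= g u /\ g u <= c2%:E * f u)%E.

Definition esqrt {R : realType} (x : \bar R) : \bar R := poweR x (2^-1).

Section Euclidean.
Context {R : realType}.
Local Notation C := R[i].

Definition cabs2 (z : C) : R := complex.Re z ^+ 2 + complex.Im z ^+ 2.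
Definition cabs (z : C) : R := Num.sqrt (cabs2 z).
Definition cis (x : R) : C := cos x +i* sin x.

Definition dotp {m} (x y : 'rV[R]_m) : R := \sum_i x 0 i * y 0 i.
Definition enorm {m} (x : 'rV[R]_m) : R := Num.sqrt (dotp x x).
Definition jap {m} (x : 'rV[R]_m) : R := Num.sqrt (1 + dotp x x).
Definition jap1 (r : R) : R := Num.sqrt (1 + r ^+ 2).

(* The integral over R^m is the iterated one-dimensional Lebesgue integral
   (Tonelli, Fubini); it is only used for Borel measurable integrands. *)
Fixpoint iint {m} : ('rV[R]_m -> \bar R) -> \bar R :=
  match m with
  | 0 => fun f => f 0
  | m'.+1 => fun f =>
      (\int[lebesgue_measure]_x iint (fun z : 'rV[R]_m' =>
         f (row_mx (const_mx x : 'rV[R]_1) z)))%E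
  end.

Definition rint {m} (f : 'rV[R]_m -> R) : R :=
  fine (iint ((EFin \o f)^\+)%E) - fine (iint ((EFin \o f)^\-)%E).
Definition cint {m} (f : 'rV[R]_m -> C) : C :=
  rint (fun x => complex.Re (f x)) +i* rint (fun x => complex.Im (f x)).

Definition borel_rV {m} (f : 'rV[R]_m -> R) :=
  measurable_fun [set: m.-tuple (measurableTypeR R)]
    (fun t => f (\row_k tnth t k)).
Definition cborel_rV {m} (f : 'rV[R]_m -> C) :=
  borel_rV (fun x => complex.Re (f x)) /\ borel_rV (fun x => complex.Im (f x)).

Definition pd {m} (l : seq 'I_m) (f : 'rV[R]_m -> R) : 'rV[R]_m -> R :=
  foldr (fun i g x => 'D_(delta_mx 0 i : 'rV[R]_m) g x) f l.
Definition smooth_on {m} (A : set 'rV[R]_m) (f : 'rV[R]_m -> R) :=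
  forall (l : seq 'I_m) x, A x -> {for x, continuous (pd l f)} /\
    forall i, derivable (pd l f) x (delta_mx 0 i : 'rV[R]_m).

Definition cpd {m} (l : seq 'I_m) (f : 'rV[R]_m -> C) (x : 'rV[R]_m) : C :=
  pd l (fun x => complex.Re (f x)) x +i* pd l (fun x => complex.Im (f x)) x.
Definition csmooth_on {m} (A : set 'rV[R]_m) (f : 'rV[R]_m -> C) :=
  smooth_on A (fun x => complex.Re (f x)) /\
  smooth_on A (fun x => complex.Im (f x)).

(* Multi-indices with entries bounded by k. *)
Definition mlen {m k} (a : {ffun 'I_m -> 'I_k}) : nat := (\sum_i a i)%N.
Definition mseq {m k} (a : {ffun 'I_m -> 'I_k}) : seq 'I_m :=
  flatten [seq nseq (a i) i | i <- enum 'I_m].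
(* D^a with D_i = -i d/dx_i *)
Definition cD {m k} (a : {ffun 'I_m -> 'I_k}) (f : 'rV[R]_m -> C)
    (x : 'rV[R]_m) : C :=
  (0 -i* 1) ^+ mlen a * cpd (mseq a) f x.

Definition Ccinf {m} (w : 'rV[R]_m -> C) :=
  csmooth_on setT w /\ exists M : R, forall x, M < `|x| -> w x = 0.
Definition fourier {m} (w : 'rV[R]_m -> C) (xi : 'rV[R]_m) : C :=
  cint (fun x => cis (- dotp x xi) * w x).

Definition sob2 {m} (r : R) (w : 'rV[R]_m -> C) : \bar R :=
  iint (fun xi => (jap xi `^ (2 * r) * cabs2 (fourier w xi))%:E).

(* H^s(R^m), s >= 0: the completion of C_c^oo in the norm sob2, realized in
   L^2(R^m). *)
Definition sobolev {m} (s : nat) (w : 'rV[R]_m -> C) :=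
  cborel_rV w /\
  exists wk : nat -> 'rV[R]_m -> C,
    [/\ forall k, Ccinf (wk k),
        forall e : R, 0 < e -> exists K, forall k l, (K <= k)%N -> (K <= l)%N ->
          (sob2 s%:R (fun x => (wk k x - wk l x)%R) < e%:E)%E
      & (fun k => iint (fun x => (cabs2 (wk k x - w x))%:E)) @ \oo --> 0%E].

(* Symbols on R^n x R^(n+1) in the variables x and zeta = (xi, lambda). *)
Definition symbol {n} (mu : R) (a : 'rV[R]_(n + (n + 1)) -> C) :=
  csmooth_on setT a /\
  forall (l : seq 'I_(n + (n + 1))) (M : R), exists c : R, forall z,
    `|lsubmx z| <= M ->
    cabs (cpd l a z) <=
      c * jap (rsubmx z) `^ (mu - (count (fun i : 'I_(n + (n + 1)) => n <= i)%N l)%:R).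

Definition homogeneous {n} (mu : R) (a : 'rV[R]_(n + (n + 1)) -> C) :=
  csmooth_on [set z | rsubmx z != 0] a /\
  forall (tau : R) (x : 'rV[R]_n) (zeta : 'rV[R]_(n + 1)), 0 < tau ->
    zeta != 0 ->
    a (row_mx x (tau *: zeta)) = (tau `^ mu)%:C * a (row_mx x zeta).

Definition excision {m} (chi : 'rV[R]_m -> R) :=
  smooth_on setT chi /\
  exists a b : R, 0 < a /\ forall z, (`|z| <= a -> chi z = 0) /\
                                     (b <= `|z| -> chi z = 1).

Definition classical_symbol {n} (mu : R) (a : 'rV[R]_(n + (n + 1)) -> C) :=
  symbol mu a /\
  exists ak : nat -> 'rV[R]_(n + (n + 1)) -> C,
    (forall k, homogeneous (mu - k%:R) (ak k)) /\
    forall chi K, excision chi ->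
      symbol (mu - K%:R)
        (fun z => a z - \sum_(k < K) (chi (rsubmx z))%:C * ak k z).

Definition psido {n} (a : 'rV[R]_(n + (n + 1)) -> C) (lam : R)
    (w : 'rV[R]_n -> C) (x : 'rV[R]_n) : C :=
  ((2 * pi) ^- n)%:C *
  cint (fun xi => cis (dotp x xi) *
    a (row_mx x (row_mx xi (const_mx lam : 'rV[R]_1))) * fourier w xi).

End Euclidean.

(* A closed smooth manifold given by a finite atlas, together with a
   subordinate partition of unity; the latter fixes the smooth positive density
   sum_j pou_j chart_j^*(dx) with respect to which one integrates over X. *)
Record closed_manifold (R : realType) (n : nat) := ClosedManifold {
  mcarrier :> topologicalType;
  mcompact : compact [set: mcarrier];
  mhausdorff : hausdorff_space mcarrier;
  mJ : nat;
  mdom : 'I_mJ -> set mcarrier;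
  mchart : 'I_mJ -> mcarrier -> 'rV[R]_n;
  minv : 'I_mJ -> 'rV[R]_n -> mcarrier;
  mdom_open : forall j, open (mdom j);
  mdom_cover : forall x, exists j, mdom j x;
  mcod_open : forall j, open (mchart j @` mdom j);
  mchartK : forall j x, mdom j x -> minv j (mchart j x) = x;
  mchart_cont : forall j x, mdom j x -> {for x, continuous (mchart j)};
  minv_cont : forall j z, (mchart j @` mdom j) z ->
    {for z, continuous (minv j)};
  mtransition : forall i j k,
    smooth_on (mchart i @` (mdom i `&` mdom j))
      (fun z => mchart j (minv i z) 0 k);
  pou : 'I_mJ -> mcarrier -> R;
  pou_smooth : forall i j,
    smooth_on (mchart i @` mdom i) (fun z => pou j (minv i z));
  pou_ge0 : forall j x, 0 <= pou j x;
  pou_sum : forall x, \sum_j pou j x = 1;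
  pou_supp : forall j, closure [set x | pou j x != 0] `<=` mdom j
}.

Section Manifold.
Context {R : realType} {n : nat} (X : closed_manifold R n).
Local Notation C := R[i].
Local Notation J := 'I_(mJ X).

Definition mcod (j : J) : set 'rV[R]_n := mchart j @` mdom j.

(* the function on R^n equal to f in the j-th chart, extended by zero *)
Definition lift0 {V : nmodType} (j : J) (f : X -> V) (z : 'rV[R]_n) : V :=
  if z \in mcod j then f (minv j z) else 0.

Definition smoothX (f : X -> C) :=
  forall j : J, csmooth_on (mcod j) (fun z => f (minv j z)).

Definition intX (f : X -> C) : C :=
  \sum_(j : J) cint (lift0 j (fun x => (pou j x)%:C * f x)).
Definition L2X_sq (f : X -> C) : \bar R :=
  (\sum_(j : J) iint (fun z => (lift0 j (fun x => pou j x * cabs2 (f x)) z)%:E))%E.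
Definition sobX_sq (r : R) (f : X -> C) : \bar R :=
  (\sum_(j : J) sob2 r (lift0 j (fun x => ((pou j x)%:C * f x)%R)))%E.

(* kernels in S(R, C^oo(X x X)) *)
Definition schwartz_kernel (c : R -> X -> X -> C) :=
  forall i j : J,
    let cij := fun z : 'rV[R]_(1 + (n + n)) =>
      c (z 0 0) (minv i (lsubmx (rsubmx z))) (minv j (rsubmx (rsubmx z))) in
    csmooth_on [set z : 'rV[R]_(1 + (n + n)) |
                  mcod i (lsubmx (rsubmx z)) /\
                        mcod j (rsubmx (rsubmx z))] cij /\
    forall (A B : set 'rV[R]_n) (l : seq 'I_(1 + (n + n))) (N : nat),
      compact A -> A `<=` mcod i -> compact B -> B `<=` mcod j ->
      exists M : R, forall z : 'rV[R]_(1 + (n + n)),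
        A (lsubmx (rsubmx z)) -> B (rsubmx (rsubmx z)) ->
        (1 + `|z 0 0|) ^+ N * cabs (cpd l cij z) <= M.

(* L^mu_cl(X; R) *)
Definition Lcl (mu : R) (A : R -> (X -> C) -> X -> C) :=
  exists (psi : J -> X -> C) (a : J -> 'rV[R]_(n + (n + 1)) -> C)
         (c : R -> X -> X -> C),
  [/\ forall j, [/\ smoothX (psi j), closure [set x | psi j x != 0] `<=` mdom j
        & exists O, [/\ open O, closure [set x | pou j x != 0] `<=` O
                      & forall x, O x -> psi j x = 1]],
      forall j, classical_symbol mu (a j),
      schwartz_kernel c
    & forall lam f x, smoothX f ->
        A lam f x =
          \sum_(j : J) (pou j x)%:C *
             psido (a j) lam (lift0 j (fun y => psi j y * f y)) (mchart j x)
          + intX (fun y => c lam x y * f y)].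

(* A(lam) extends to an isomorphism H^r(X) -> H^(r-mu)(X) between the
   completions of C^oo(X). *)
Definition induces_iso (mu r : R) (A : (X -> C) -> X -> C) :=
  [/\ forall f, smoothX f -> smoothX (A f),
      norm_equivalent smoothX (sobX_sq r) (fun f => sobX_sq (r - mu) (A f))
    & forall g (e : R), smoothX g -> 0 < e -> exists2 f, smoothX f &
        (sobX_sq (r - mu) (fun x => (A f x - g x)%R) < e%:E)%E].

Definition order_reducing (mu : R) (A : R -> (X -> C) -> X -> C) :=
  Lcl mu A /\ forall lam r, induces_iso mu r (A lam).

(* Functions on R x X; a function on X^wedge is one of which only the values at
   r > 0 matter. *)
Definition cylfun := (R * X -> R[i]^o)%type.

Definition coord (j : J) (u : cylfun) (z : 'rV[R]_(1 + n)) : C :=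
  u (z 0 0, minv j (rsubmx z)).
Definition cyl (I : set R) (j : J) : set 'rV[R]_(1 + n) :=
  [set z : 'rV[R]_(1 + n) | I (z 0 0) /\ mcod j (rsubmx z)].
Definition halfline : set R := [set r | 0 < r].

Definition smooth_cyl (I : set R) (u : cylfun) :=
  forall j : J, csmooth_on (cyl I j) (coord j u).

(* C_0^oo(X^wedge) *)
Definition testf (u : cylfun) :=
  smooth_cyl halfline u /\
  exists a b : R, 0 < a /\ forall r x, ~ (a <= r <= b) -> u (r, x) = 0.

Definition L2cyl_sq (I : set R) (u : cylfun) : \bar R :=
  (\sum_(j : J) iint (fun z : 'rV[R]_(1 + n) =>
     (if z \in cyl I j then pou j (minv j (rsubmx z)) * cabs2 (coord j u z)
      else 0)%:E))%E.

Definition L2loc (I : set R) (u : cylfun) :=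
  (forall j : J, cborel_rV (fun z : 'rV[R]_(1 + n) =>
      if z \in cyl I j then coord j u z else 0)) /\
  forall a b : R, `[a, b]%classic `<=` I -> (L2cyl_sq `[a, b]%classic u < +oo)%E.

Definition pairing (u psi : cylfun) : C :=
  \sum_(j : J) cint (fun z : 'rV[R]_(1 + n) =>
    if z \in cyl halfline j
    then (pou j (minv j (rsubmx z)))%:C * coord j u z * coord j psi z else 0).

(* equality in D'(X^wedge) *)
Definition deq (u v : cylfun) := forall psi, testf psi -> pairing u psi = pairing v psi.

Definition mellin (beta lam : R) (u : cylfun) (x : X) : C :=
  let F r := (r `^ (beta - 1))%:C * cis (lam * ln r) * u (r, x) in
  (\int[lebesgue_measure]_(r in halfline) complex.Re (F r)) +i*
  (\int[lebesgue_measure]_(r in halfline) complex.Im (F r)).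

Section ConeSpaces.
(* Rs s is the order reducing family used for H^{s,gamma}; w is the cut-off
   function. *)
Context (Rs : nat -> R -> (X -> C) -> X -> C) (w : R -> R).

Definition Hsg_sq (s : nat) (gam : R) (u : cylfun) : \bar R :=
  ((2 * pi)^-1%:E * \int[lebesgue_measure]_lam
    L2X_sq (Rs s lam (mellin (n.+1%:R / 2 - gam) lam u)))%E.

(* H^{s,gamma}(X^wedge): the completion of C_0^oo(X^wedge), realized in
   L^2_loc(X^wedge). *)
Definition Hsg (s : nat) (gam : R) (u : cylfun) :=
  L2loc halfline u /\
  exists uk : nat -> cylfun,
    [/\ forall k, testf (uk k),
        forall e : R, 0 < e -> exists K, forall k l, (K <= k)%N -> (K <= l)%N ->
          (Hsg_sq s gam (uk k - uk l)%R < e%:E)%E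
      & forall a b : R, 0 < a ->
          (fun k => L2cyl_sq `[a, b]%classic (uk k - u)) @ \oo --> 0%E].

Definition Hloc (s : nat) (u : cylfun) :=
  forall (j : J) (phi : 'rV[R]_(1 + n) -> C) (A : set 'rV[R]_(1 + n)),
    csmooth_on setT phi -> compact A -> A `<=` cyl setT j ->
    (forall z, ~ A z -> phi z = 0) ->
    sobolev s (fun z => phi z * coord j u z).

(* A diffeomorphism chi1 of U onto an open subset of the unit sphere S^n, with
   inverse h; smoothness of h is that of its extension by homogeneity of degree
   zero to the open cone spanned by chi1(U). Since chi1(U) is not all of S^n, U
   is a coordinate neighbourhood, by stereographic projection. *)
Definition sphere_chart (U : set X) (chi1 : X -> 'rV[R]_(n.+1)) :=
  let cone := [set z | exists r x, [/\ 0 < r, U x & z = r *: chi1 x]] in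
  [/\ open U, open cone,
      forall x, U x -> enorm (chi1 x) = 1,
      (exists p, enorm p = 1 /\ ~ (chi1 @` U) p)
    & (forall (j : J) k, smooth_on (mchart j @` (mdom j `&` U))
         (fun z => chi1 (minv j z) 0 k)) /\
      exists h : 'rV[R]_(n.+1) -> X,
        (forall r x, 0 < r -> U x -> h (r *: chi1 x) = x) /\
        forall (j : J) k, smooth_on [set z | cone z /\ mdom j (h z)]
          (fun z => mchart j (h z) 0 k)].

Definition Hcone_cyl (s : nat) (u : cylfun) :=
  Hloc s u /\
  forall (U : set X) chi1 (phi : X -> C) (sgn : bool), sphere_chart U chi1 ->
    smoothX phi -> closure [set x | phi x != 0] `<=` U ->
    exists2 f, sobolev s f & forall r x, 0 < r -> U x ->
      f (r *: chi1 x) = (1 - w r)%:C * phi x * u ((-1) ^+ sgn * r, x).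

Definition Hcone (s : nat) (u : cylfun) :=
  exists2 u', Hcone_cyl s u' & forall r x, 0 < r -> u (r, x) = u' (r, x).

(* K^{s,gamma}(X^wedge) *)
Definition Ksg (s : nat) (gam : R) (u : cylfun) :=
  L2loc halfline u /\
  exists u0 uoo, [/\ Hsg s gam u0, Hcone s uoo &
    deq u (fun rx => (w rx.1)%:C * u0 rx + (1 - w rx.1)%:C * uoo rx)].

(* multiplication by <r>^e *)
Definition mulr_pow (e : R) (u : cylfun) : cylfun :=
  fun rx => (jap1 rx.1 `^ e)%:C * u rx.

(* K^{s,gamma;e}(X^wedge) = <r>^(-e) K^{s,gamma}(X^wedge) *)
Definition Ksge (s : nat) (gam e : R) (u : cylfun) := Ksg s gam (mulr_pow e u).

End ConeSpaces.

Definition dilate (lam : R) (u : cylfun) : cylfun :=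
  fun rx => u (lam * rx.1, rx.2).
Definition kappa (del : R) (u : cylfun) : cylfun :=
  fun rx => (del `^ (n.+1%:R / 2))%:C * u (del * rx.1, rx.2).

(* Diff^m(X^wedge) *)
Definition diffop (m : nat) (P : cylfun -> cylfun) :=
  (forall u, smooth_cyl halfline u -> smooth_cyl halfline (P u)) /\
  forall j : J, exists a : {ffun 'I_(1 + n) -> 'I_m.+1} -> 'rV[R]_(1 + n) -> C,
    (forall al, csmooth_on (cyl halfline j) (a al)) /\
    forall u z, smooth_cyl halfline u -> cyl halfline j z ->
      coord j (P u) z =
        \sum_(al | (mlen al <= m)%N) a al z * cD al (coord j u) z.

(* P u = g in D'(X^wedge), for u and g in L^2_loc; Pt is the formal transpose *)
Definition weakly (P : cylfun -> cylfun) (u g : cylfun) :=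
  [/\ L2loc halfline u, L2loc halfline g
    & exists Pt : cylfun -> cylfun,
    [/\ forall psi, testf psi -> testf (Pt psi),
        forall phi psi, testf phi -> testf psi ->
          pairing (P phi) psi = pairing phi (Pt psi)
      & forall psi, testf psi -> pairing u (Pt psi) = pairing g psi]].

(* (a representative of) P u as an element of the space H *)
Definition act (H : set cylfun) (P : cylfun -> cylfun) (u : cylfun) : cylfun :=
  xget 0 [set g | H g /\ weakly P u g].

End Manifold.

(* A Hilbert space presented as a linear subspace H of E with a positive
   semidefinite form ip; elements at distance zero are identified. *)
Section Hilbert.
Context {R : realType} {E : lmodType R[i]}.
Local Notation C := R[i].
Implicit Types (H : set E) (ip : E -> E -> C) (kap : R -> E -> E).

Definition hnorm ip (u : E) : R := Num.sqrt (complex.Re (ip u u)).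

Record hilbert H ip : Prop := Hilbert {
  hilb0 : H 0;
  hilbL : forall a u v, H u -> H v -> H (a *: u + v);
  hilb_linear : forall a u v z, H u -> H v -> H z ->
    ip (a *: u + v) z = a * ip u z + ip v z;
  hilb_herm : forall u v, H u -> H v -> ip v u = (ip u v)^*;
  hilb_ge0 : forall u, H u -> 0 <= ip u u;
  hilb_complete : forall uk : nat -> E, (forall k, H (uk k)) ->
    (forall e : R, 0 < e -> exists K, forall k l, (K <= k)%N -> (K <= l)%N ->
       hnorm ip (uk k - uk l) < e) ->
    exists2 u, H u & (fun k => hnorm ip (uk k - u)) @ \oo --> (0 : R)
}.

(* A group action on H: a strongly continuous group of isomorphisms of H. *)
Record group_action H ip kap : Prop := GroupAction {
  ga_stable : forall d u, 0 < d -> H u -> H (kap d u);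
  ga_linear : forall d a u v, 0 < d -> H u -> H v ->
    kap d (a *: u + v) = a *: kap d u + kap d v;
  ga_bounded : forall d, 0 < d -> exists c : R, forall u, H u ->
    hnorm ip (kap d u) <= c * hnorm ip u;
  ga1 : forall u, H u -> kap 1 u = u;
  gaM : forall d d' u, 0 < d -> 0 < d' -> H u ->
    kap d (kap d' u) = kap (d * d') u;
  ga_continuous : forall d u, 0 < d -> H u ->
    (fun d' => hnorm ip (kap d' u - kap d u)) @ d --> (0 : R)
}.

Section Edge.
Context (H : set E) (ip : E -> E -> C) (kap : R -> E -> E) {p : nat}.
Implicit Type f : 'rV[R]_p -> E.

Definition is_vderiv (i : 'I_p) f (y : 'rV[R]_p) (g : E) :=
  H g /\ (fun h : R => hnorm ip ((h^-1)%:C *: (f (y + h *: delta_mx 0 i) - f y) - g))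
           @ 0^' --> (0 : R).
(* the partial derivative, in the norm of H (unique up to elements of norm 0) *)
Definition vderiv (i : 'I_p) f (y : 'rV[R]_p) : E := xget 0 (is_vderiv i f y).
Definition vpd (l : seq 'I_p) f : 'rV[R]_p -> E := foldr vderiv f l.

Definition vD {k} (b : {ffun 'I_p -> 'I_k}) f (y : 'rV[R]_p) : E :=
  (0 -i* 1) ^+ mlen b *: vpd (mseq b) f y.

(* S(R^p, H) *)
Definition schwartz f :=
  (forall y, H (f y)) /\
  forall l : seq 'I_p,
    (forall y i, exists g, is_vderiv i (vpd l f) y g) /\
    forall N, exists M : R, forall y, jap y ^+ N * hnorm ip (vpd l f y) <= M.

(* The H-valued integral of exp(-i y eta) f(y) dy, in the weak sense. *)
Definition is_vfourier f (eta : 'rV[R]_p) (g : E) :=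
  H g /\ forall h, H h ->
    ip g h = cint (fun y => cis (- dotp y eta) * ip (f y) h).
Definition vfourier f (eta : 'rV[R]_p) : E := xget 0 (is_vfourier f eta).

Definition Wnorm (s : nat) f : \bar R :=
  esqrt (iint (fun eta =>
    (jap eta ^+ (2 * s) * hnorm ip (kap (jap eta)^-1 (vfourier f eta)) ^+ 2)%:E)).

(* W^s(R^p, H), the completion of S(R^p, H) in Wnorm: an element is represented
   by a Cauchy sequence of S(R^p, H), and its norm is Wlim. Operators on
   S(R^p, H) act on the completion by acting termwise. *)
Definition Wspace (s : nat) (v : nat -> 'rV[R]_p -> E) :=
  (forall k, schwartz (v k)) /\
  forall e : R, 0 < e -> exists K, forall k l, (K <= k)%N -> (K <= l)%N ->
    (Wnorm s (fun y => (v k y - v l y)%R) < e%:E)%E.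
Definition Wlim (s : nat) (v : nat -> 'rV[R]_p -> E) : \bar R :=
  limn (fun k => Wnorm s (v k)).

End Edge.
End Hilbert.

Definition cutoff {R : realType} (w : R -> R) :=
  (forall k r, 0 < r -> derivable (derive1n k w) r 1) /\
  exists a b : R, 0 < a /\ forall r, (0 <= r <= a -> w r = 1) /\
                                     (b <= r -> w r = 0).

Definition bracket {R : realType} (br : R -> R) :=
  [/\ forall k t, derivable (derive1n k br) t 1, forall t, 0 < br t
    & exists T : R, forall t, T <= `|t| -> br t = `|t|].

Section Cone.
Context {R : realType} {n : nat} (X : closed_manifold R n).
Local Notation C := R[i].
Local Notation E := (cylfun X).
Context (Rs : nat -> R -> (X -> C) -> X -> C) (w : R -> R).

(* ip is a Hilbert space structure on K^{s,gamma} with continuous embedding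
   into D'(X^wedge); by the closed graph theorem this determines the norm up to
   equivalence. *)
Definition K_structure (s : nat) (gam : R) (ip : E -> E -> C) :=
  [/\ hilbert (Ksg Rs w s gam) ip,
      forall u, Ksg Rs w s gam u -> hnorm ip u = 0 <-> deq u 0
    & forall psi, testf psi -> exists c : R, forall u, Ksg Rs w s gam u ->
        cabs (pairing u psi) <= c * hnorm ip u].

(* the structure transported to K^{s,gamma;e} *)
Definition ipe (ip : E -> E -> C) (e : R) : E -> E -> C :=
  fun u v => ip (mulr_pow e u) (mulr_pow e v).

Context (ip : nat -> R -> E -> E -> C).

Definition Knorm (s : nat) (gam e : R) (u : E) : R := hnorm (ipe (ip s gam) e) u.

Record cone_system (s N : nat)
    (D : 'I_N -> {ffun 'I_(1 + n) -> 'I_s.+1} -> E -> E) : Prop := ConeSystem {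
  cs_diff : forall j al, (mlen al <= s)%N -> diffop (mlen al) (D j al);
  cs_dilate : forall j al lam u g, (mlen al <= s)%N -> 0 < lam ->
    weakly (D j al) u g -> weakly (D j al) (dilate lam u) (dilate lam g);
  cs_dom : forall gam u j al, (mlen al <= s)%N -> Ksg Rs w s gam u ->
    exists2 g, Ksge Rs w 0 gam (- (mlen al)%:R) g & weakly (D j al) u g;
  cs_mem : forall gam u, Ksg Rs w s gam u <->
    Ksg Rs w 0 gam u /\
    forall j al, (mlen al <= s)%N ->
      exists2 g, Ksge Rs w 0 gam (- s%:R) g & weakly (D j al) u g;
  cs_norm1 : forall gam, norm_equivalent (Ksg Rs w s gam)
    (fun u => (Knorm s gam 0 u)%:E)
    (fun u => (Num.sqrt (Knorm 0 gam 0 u ^+ 2 +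
       \sum_(al | (0 < mlen al <= s)%N) \sum_(j < N)
         Knorm 0 gam (- (mlen al)%:R)
           (act (Ksge Rs w 0 gam (- (mlen al)%:R)) (D j al) u) ^+ 2))%:E);
  cs_norm2 : forall gam, norm_equivalent (Ksg Rs w s gam)
    (fun u => (Knorm s gam 0 u)%:E)
    (fun u => (Num.sqrt (Knorm 0 gam 0 u ^+ 2 +
       \sum_(al | mlen al == s) \sum_(j < N)
         Knorm 0 gam (- s%:R) (act (Ksge Rs w 0 gam (- s%:R)) (D j al) u) ^+ 2))%:E)
}.

(* W^sig(R^p, K^{s,gam;e}), with the group action kappa; its norm; the
   derivatives D^b of functions with values in K^{s,gam;e}; and the action of a
   differential operator on such functions, with values in K^{s,gam;e}. *)
Definition WK {p} (sig s : nat) (gam e : R) :=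
  @Wspace R E (Ksge Rs w s gam e) (ipe (ip s gam) e) (@kappa R n X) p sig.
Definition WKnorm {p} (sig s : nat) (gam e : R) :=
  @Wlim R E (Ksge Rs w s gam e) (ipe (ip s gam) e) (@kappa R n X) p sig.
Definition KD {p k} (s : nat) (gam e : R) (b : {ffun 'I_p -> 'I_k})
    (f : 'rV[R]_p -> E) := vD (Ksge Rs w s gam e) (ipe (ip s gam) e) b f.
Definition Kact {p} (s : nat) (gam e : R) (P : E -> E) (f : 'rV[R]_p -> E) :=
  fun y => act (Ksge Rs w s gam e) P (f y).

Context {q : nat} (br : R -> R).

(* delta_[t] and its inverse *)
Definition delta (f : 'rV[R]_(1 + q) -> E) (t r : R) (x : X) (y : 'rV[R]_q) : C :=
  f (row_mx (const_mx t : 'rV[R]_1) (br t *: y)) (br t * r, x).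
Definition delta_inv (u : R -> R -> X -> 'rV[R]_q -> C) (z : 'rV[R]_(1 + q)) : E :=
  fun rx => u (z 0 0) ((br (z 0 0))^-1 * rx.1) rx.2 ((br (z 0 0))^-1 *: rsubmx z).

(* W^{s,gam}_cone(R x R^q x X^wedge), an element being represented as in WK by a
   sequence of functions u(t,r,x,y), and its norm *)
Definition Wcone (s : nat) (gam : R)
    (u : nat -> R -> R -> X -> 'rV[R]_q -> C) :=
  exists2 f, WK s s gam 0 f & u = fun k => delta (f k).
Definition Wcone_norm (s : nat) (gam : R)
    (u : nat -> R -> R -> X -> 'rV[R]_q -> C) : \bar R :=
  WKnorm s s gam 0 (fun k => delta_inv (u k)).

End Cone.

(* Main.v *)
Require Import Defs.
From HB Require Import structures.
From mathcomp Require Import all_boot all_order all_algebra.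
From mathcomp Require Import complex.
From mathcomp Require Import all_classical all_reals all_analysis.
From mathcomp Require Import measurable_realfun ring lra.

Set Implicit Arguments.
Unset Strict Implicit.
Unset Printing Implicit Defensive.

Import Order.TTheory GRing.Theory Num.Theory.
Import numFieldNormedType.Exports.

Local Open Scope classical_set_scope.
Local Open Scope ring_scope.

(** The function v is the preimage of u under [delta], so that the claim concerns
    the norm of the edge space W^s(R^(1+q), K^{s,gamma}), whose square is the
    integral of <eta>^(2s) |a(eta)|^2, where a(eta) = kappa_<eta>^-1 v^(eta) is
    the transform [wtransform] of v and |.| is the norm of K^{s,gamma}.

    Two pointwise estimates are multiplied under this integral. In the fibre,
    |a|^2 is equivalent to the sum of the squares of the norms of a and of all
    D_j^alpha a with |alpha| = s ([op_of_equiv]). In the covariable, <eta>^(2s)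
    is equivalent to 1 plus the sum of the (eta^beta)^2 with |beta| = s
    ([monomials_equiv]). The product of the two sums has four groups of terms,
    and each term is the integrand of one of the norms on the right-hand side:
    multiplication by eta^beta is differentiation of v ([vfourier_vD]), while the
    dilation invariant operators D_j^alpha commute with kappa ([act_kappa]) and,
    being bounded, with the Fourier transform ([vfourier_op]). This is
    [edge_norm_equivalence]. Elements of the completions are Cauchy sequences of
    Schwartz functions; the same pointwise bounds applied to differences show
    that the operators preserve Cauchy sequences ([Wspace_edge]), and the
    equivalence passes to the limits of the norms ([Wspace_cvg]).

    The Fourier transform of a vector-valued function is a weak integral, which
    exists by the Riesz representation theorem. That it turns derivatives into
    monomials follows from the translation invariance of the integral
    ([vfourier_deriv]). The integrands of the norms are Borel functions because the
    transform is Lipschitz continuous and kappa is strongly continuous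
    ([borel_wfourier]).

    Vector derivatives and values of the weak action [act] are chosen
    representatives, so that all identities hold up to elements of norm zero
    ([heq]). For [act] this rests on the uniqueness of the formal transpose as an
    operator on test functions modulo null functions: the pairing of a test
    function with its own conjugate is a square integral
    ([pairing_testf_ext]). Equality of distributions is then equality up to norm
    zero in every weighted space ([heq_Ksge]). *)

(** * Lebesgue measure on R^m *)

Section LebesgueRm.
Context {R : realType}.
Local Notation TR m := (m.-tuple (measurableTypeR R)).

Definition row_of_tuple {m} (t : TR m) : 'rV[R]_m := \row_k tnth t k.
Definition tuple_of_row {m} (y : 'rV[R]_m) : TR m := [tuple y 0 k | k < m].

Lemma tuple_of_rowK {m} : cancel (@tuple_of_row m) row_of_tuple.
Proof. by move=> y; apply/rowP => k; rewrite mxE tnth_mktuple. Qed.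

Lemma row_of_tuple_cons {m} (x : R) (t : TR m) :
  row_of_tuple [tuple of x :: t] =
  row_mx (const_mx x : 'rV[R]_1) (row_of_tuple t) :> 'rV[R]_(1 + m).
Proof.
apply/rowP => k; rewrite !mxE; case: (@splitP 1 m k) => j jk; rewrite !mxE.
  rewrite (_ : k = @ord0 m) //; apply/val_inj => /=; rewrite [LHS]jk [j]ord1.
  by [].
rewrite (_ : k = @lift m.+1 ord0 j) ?tnthS//.
by apply/val_inj => /=; rewrite [LHS]jk.
Qed.

Section ConsMeasure.
Context {m : nat} (mu : {sigma_finite_measure set (TR m) -> \bar R}).

Definition cons_pair (p : measurableTypeR R * TR m) : TR m.+1 :=
  [tuple of p.1 :: p.2].

Lemma measurable_cons_pair : measurable_fun setT cons_pair.
Proof. exact: measurable_cons. Qed.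

(** Pushing the product measure forward along [cons] makes the recursion of
    [iint] on the dimension an instance of Tonelli's theorem. *)
Definition cons_measure : set (TR m.+1) -> \bar R :=
  pushforward (lebesgue_measure \x mu)%E cons_pair.

Let cons_measure0 : cons_measure set0 = 0%E.
Proof. by rewrite /cons_measure /pushforward preimage_set0 measure0. Qed.

Let cons_measure_ge0 A : (0 <= cons_measure A)%E.
Proof. by rewrite /cons_measure /pushforward measure_ge0. Qed.

Let cons_measure_additive : semi_sigma_additive cons_measure.
Proof.
move=> F mF tF mUF; rewrite /cons_measure/pushforward preimage_bigcup.
apply: measure_semi_sigma_additive.
- by move=> n; rewrite -[X in measurable X]setTI; exact: measurable_cons_pair.
- apply/trivIsetP => /= i j _ _ ij; rewrite -preimage_setI.
  by move/trivIsetP : tF => /(_ _ _ _ _ ij) ->//; rewrite preimage_set0.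
- by rewrite -preimage_bigcup -[X in measurable X]setTI; exact: measurable_cons_pair.
Qed.

HB.instance Definition _ := isMeasure.Build _ _ _ cons_measure
  cons_measure0 cons_measure_ge0 cons_measure_additive.

Let cons_measure_sigma_finite : sigma_finite setT cons_measure.
Proof.
have [F TF mF] : sigma_finite setT (lebesgue_measure \x mu)%E.
  have /sigma_finiteP[F [TF ndF Foo]] := sigma_finiteT (@lebesgue_measure R).
  have /sigma_finiteP[G [TG ndG Goo]] := sigma_finiteT mu.
  exists (fun n => F n `*` G n).
    rewrite -setXTT TF TG predeqE => -[x y]; split.
      move=> [/= [i _ Fx] [k _ Gy]]; exists (maxn i k) => //; split.
      - by move: x Fx; exact/subsetPset/ndF/leq_maxl.
      - by move: y Gy; exact/subsetPset/ndG/leq_maxr.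
    by move=> [i _ []/= ? ?]; split; exists i.
  move=> k; have [? ?] := Foo k; have [? ?] := Goo k.
  split; first exact: measurableX.
  by rewrite product_measure1E// lte_mul_pinfty// ge0_fin_numE.
pose unc (t : TR m.+1) : measurableTypeR R * TR m := (thead t, [tuple of behead t]).
have munc : measurable_fun setT unc.
  apply/measurable_fun_pairP; split; last exact: measurable_behead.
  exact: measurable_tnth.
have cK : cancel cons_pair unc.
  move=> [x t]; rewrite /unc /cons_pair /=; congr pair.
  exact/val_inj.
exists (fun n => unc @^-1` F n).
  by rewrite -preimage_bigcup -TF preimage_setT.
move=> n; have [mFn Fn] := mF n; split.
  by rewrite -[X in measurable X]setTI; exact: munc.
rewrite /cons_measure /pushforward -comp_preimage.
suff -> : unc \o cons_pair = id by [].
by apply/funext => p /=; rewrite cK.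
Qed.

HB.instance Definition _ := Measure_isSigmaFinite.Build _ _ _ cons_measure
  cons_measure_sigma_finite.

End ConsMeasure.

Definition iint_repr {m} (mu : set (TR m) -> \bar R) :=
  forall f : 'rV[R]_m -> \bar R, (forall x, 0 <= f x)%E ->
    measurable_fun setT (fun t : TR m => f (row_of_tuple t)) ->
    iint f = (\int[mu]_t f (row_of_tuple t))%E.

(** Iterated integrals are integrals against one measure on R^m; this gives
    access to additivity, domination and almost everywhere equality. *)
Lemma iint_measure m :
  exists mu : {sigma_finite_measure set (TR m) -> \bar R}, iint_repr mu.
Proof.
elim: m => [|m [mu IH]].
  exists (dirac [tuple] : {sigma_finite_measure set (TR 0) -> \bar R}).
  move=> f f0 mf /=.
  rewrite integral_dirac// diracT mul1e; congr f; apply/rowP => -[? //].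
exists (cons_measure mu) => f f0 mf /=.
rewrite /cons_measure ge0_integral_pushforward//=; last exact: measurable_cons_pair.
rewrite preimage_setT.
have mfc : measurable_fun setT (fun p => f (row_of_tuple (cons_pair p))).
  exact: (measurableT_comp mf measurable_cons_pair).
rewrite fubini_tonelli1//.
apply: eq_integral => x _; rewrite /fubini_F IH//.
  by apply: eq_integral => t _; rewrite -row_of_tuple_cons.
rewrite [X in measurable_fun _ X](_ : _ = fun t => f (row_of_tuple (cons_pair (x, t)))).
  exact: (measurableT_comp mfc (pair1_measurable x)).
by apply/funext => t /=; rewrite -row_of_tuple_cons.
Qed.

(** Only the representation of iterated integrals characterises it here, hence
    the choice of a witness. *)
Definition lebm m : {sigma_finite_measure set (TR m) -> \bar R} :=
  projT1 (cid (iint_measure m)).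

Lemma iintE {m} (f : 'rV[R]_m -> \bar R) : (forall x, 0 <= f x)%E ->
  measurable_fun setT (fun t : TR m => f (row_of_tuple t)) ->
  iint f = (\int[lebm m]_t f (row_of_tuple t))%E.
Proof. exact: (projT2 (cid (iint_measure m))). Qed.

(** * Borel functions on R^m *)

Lemma borel_rVE {m} (f : 'rV[R]_m -> R) :
  borel_rV f = measurable_fun setT (f \o row_of_tuple).
Proof. by []. Qed.

(** Coordinates, as integers, of the point of the lattice 2^-k Z^m below [y]:
    its countably many values make preimages measurable. *)
Definition lattice_pt {m} (k : nat) (y : 'rV[R]_m) : 'rV[int]_m :=
  \row_i Num.floor (2 ^+ k * y 0 i).
Definition lattice {m} (k : nat) (y : 'rV[R]_m) : 'rV[R]_m :=
  \row_i (2 ^- k * (lattice_pt k y 0 i)%:~R).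

Lemma lattice_near {m} k (y : 'rV[R]_m) : `|y - lattice k y| <= 2 ^- k.
Proof.
have p0 : 0 < 2 ^- k :> R by rewrite invr_gt0 exprn_gt0.
rewrite /Num.norm/= mx_normrE; apply/bigmax_leP.
split=> [|[i j] _ /=]; first exact: ltW.
rewrite !mxE.
rewrite (_ : y i j = 2 ^- k * (2 ^+ k * y 0 j)); last first.
  by rewrite mulrA mulVf ?mul1r ?ord1// expf_neq0.
rewrite -mulrBr normrM gtr0_norm// ler_piMr ?ltW//.
set x := _ * y 0 j.
have /andP[h1 h2] := floor_itv x.
rewrite ger0_norm ?subr_ge0//.
by rewrite ltrBlDl -[X in _ + X](_ : 1%:~R = 1)// -intrD.
Qed.

Lemma measurable_lattice {m} k (P : set 'rV[int]_m) :
  measurable ((lattice_pt k \o row_of_tuple) @^-1` P : set (TR m)).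
Proof.
rewrite (_ : _ @^-1` _ = \bigcup_(z in P)
   ((lattice_pt k \o row_of_tuple) @^-1` [set z])); last first.
  apply/seteqP; split=> [t Pt|t [z Pz /= Pt]]; last by rewrite /= Pt.
  by exists (lattice_pt k (row_of_tuple t)).
rewrite bigcup_mkcond; apply: countable_bigcupT_measurable => // z.
case: ifPn => // _.
rewrite (_ : _ @^-1` _ = \big[setI/setT]_(i < m)
   ((@tnth m R ^~ i) @^-1` [set x | Num.floor (2 ^+ k * x) = z 0 i])); last first.
  rewrite -bigcap_seq; apply/seteqP; split=> t /=.
    by move=> <- i _ /=; rewrite !mxE.
  move=> h; apply/rowP => i; rewrite !mxE.
  by apply: h => /=; rewrite mem_index_enum.
apply: bigsetI_measurable => i _.
rewrite -[X in measurable X]setTI.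
apply: measurable_tnth => //=.
rewrite [X in measurable X](_ : _ =
  `[2 ^- k * (z 0 i)%:~R, 2 ^- k * (z 0 i + 1)%:~R[%classic); first exact: measurable_itv.
have p0 : 0 < 2 ^+ k :> R by rewrite exprn_gt0.
apply/seteqP; split=> x /=; rewrite in_itv/= ![2 ^- k * _]mulrC ler_pdivrMr// ltr_pdivlMr// [x * _]mulrC.
  by move=> <-; exact: floor_itv.
by move=> h; apply/eqP; rewrite floor_eq.
Qed.

(** Freezing the first argument on the cubes of a lattice: each of the countably
    many values contributes a measurable piece. *)
Lemma measurable_lattice_fun d (T : measurableType d) {m} k
    (F : 'rV[R]_m -> 'rV[R]_m -> T) :
  (forall z, measurable_fun setT (F z \o row_of_tuple)) ->
  measurable_fun setT (fun t : TR m =>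
     F (lattice k (row_of_tuple t)) (row_of_tuple t)).
Proof.
move=> mF _ B mB; rewrite setTI.
pose emb (z : 'rV[int]_m) : 'rV[R]_m := \row_i (2 ^- k * (z 0 i)%:~R).
rewrite (_ : _ @^-1` _ = \bigcup_(z in [set: 'rV[int]_m])
   ((lattice_pt k \o row_of_tuple) @^-1` [set z] `&`
    (F (emb z) \o row_of_tuple) @^-1` B)); last first.
  apply/seteqP; split=> [t /= Bt|t [z _ [/= <-]]]; last by [].
  by exists (lattice_pt k (row_of_tuple t)).
apply: countable_bigcupT_measurable => // z.
apply: measurableI; first exact: measurable_lattice.
by rewrite -[X in measurable X]setTI; exact: mF.
Qed.

(** The sigma-algebra on tuples is the product one; an open set belongs to it
    as a countable union of lattice cubes. *)
Lemma measurable_open_row {m} (A : set 'rV[R]_m) : open A ->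
  measurable (row_of_tuple @^-1` A : set (TR m)).
Proof.
move=> oA.
pose emb k (z : 'rV[int]_m) : 'rV[R]_m := \row_i (2 ^- k * (z 0 i)%:~R).
rewrite (_ : _ @^-1` _ = \bigcup_k
  ((lattice_pt k \o row_of_tuple) @^-1`
     [set z | closed_ball (emb k z) (2 ^- k) `<=` A])); last first.
  apply/seteqP; split=> t /=.
    move=> At.
    have /nbhs_ballP[e /= e0 He] : nbhs (row_of_tuple t) A by exact: open_nbhs_nbhs.
    (* a cube of half this size around [t] stays inside the ball *)
    have [k Hk] : exists k, 2 ^- k + 2 ^- k < e.
      have /cvgr0_norm_lt/(_ (e / 2)) : (fun k => (2^-1 : R) ^+ k) @ \oo --> (0 : R).
        by apply: cvg_expr; rewrite ger0_norm ?invf_lt1 ?ltr1n.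
      rewrite divr_gt0// => /(_ isT)[k _ /(_ k (leqnn _)) /=].
      rewrite ger0_norm ?exprn_ge0// exprVn => h; exists k.
      by rewrite (splitr e) ltrD.
    exists k => // z /= Hz; apply: He.
    rewrite -ball_normE /= (le_lt_trans _ Hk)//.
    have p0 : 0 < 2 ^- k :> R by rewrite invr_gt0 exprn_gt0.
    move: Hz; rewrite closed_ballE// /closed_ball_ /= => Hz.
    rewrite -(subrK (lattice k (row_of_tuple t)) (row_of_tuple t)) -addrA.
    by rewrite (le_trans (ler_normD _ _))// lerD// lattice_near.
  move=> [k _ /=]; apply.
  have p0 : 0 < 2 ^- k :> R by rewrite invr_gt0 exprn_gt0.
  by rewrite closed_ballE// /closed_ball_ /= distrC lattice_near.
apply: bigcup_measurable => k _; exact: measurable_lattice.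
Qed.

Lemma borel_continuous_on {m} (A : set 'rV[R]_m) (f : 'rV[R]_m -> R) :
  open A -> (forall x, A x -> {for x, continuous f}) ->
  borel_rV (fun x => if x \in A then f x else 0).
Proof.
move=> oA cf; rewrite borel_rVE.
apply: (measurability (@RGenOpens.G R)); first exact: RGenOpens.measurableE.
move=> _ [_ [a [b ->]] <-]; rewrite setTI.
set f0 := fun x => _.
have oAI : open (A `&` f @^-1` `]a, b[%classic).
  rewrite openE => x [Ax fx].
  apply: filterI; first exact: open_nbhs_nbhs.
  by apply: cf => //; apply: open_nbhs_nbhs; split => //; exact: interval_open.
(* the extension by zero adds the complement of [A] to the preimage of an
   interval that contains zero *)
have [ab0|ab0] := pselect (`]a, b[%classic (0 : R)).
  rewrite (_ : _ @^-1` _ = row_of_tuple @^-1` (A `&` f @^-1` `]a, b[%classic) `|`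
     row_of_tuple @^-1` (~` A)).
    by apply: measurableU; [|apply: measurableC]; exact: measurable_open_row.
  apply/seteqP; split=> t /=; rewrite /f0/=.
    by case: ifPn => [/set_mem At ?|/negP nAt _]; [left|right => /mem_set].
  by move=> [[At ft]|At]; [rewrite mem_set|rewrite memNset].
rewrite (_ : _ @^-1` _ = row_of_tuple @^-1` (A `&` f @^-1` `]a, b[%classic)).
  exact: measurable_open_row.
apply/seteqP; split=> t /=; rewrite /f0/=.
  by case: ifPn => [/set_mem|/negP] // _ /ab0.
by move=> [At ft]; rewrite mem_set.
Qed.

Lemma borel_continuous {m} (f : 'rV[R]_m -> R) : continuous f -> borel_rV f.
Proof.
move=> cf; rewrite (_ : f = fun x => if x \in setT then f x else 0).
  by apply: borel_continuous_on; [exact: openT|move=> x _; exact: cf].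
by apply/funext => x; rewrite in_setT.
Qed.

(** * Translation invariance *)

Lemma lebesgue_measure_shift (a : R) (A : set R) : measurable A ->
  pushforward lebesgue_measure ((+%R a) : _ -> measurableTypeR R) A =
  lebesgue_measure A.
Proof.
move=> mA; have ma : measurable_fun setT ((+%R a) : _ -> measurableTypeR R).
  by apply: measurable_funD => //; exact: measurable_cst.
apply/esym/(lebesgue_measure_unique (mu := pushforward _ _)) => //= _ [[c d]] _ <-.
rewrite /pushforward (_ : _ @^-1` _ = `]c - a, d - a]%classic).
  rewrite !lebesgue_measure_itv/= !lte_fin ltrD2r; case: ifP => // _.
  by rewrite -!EFinD opprB addrA subrK.
by apply/seteqP; split=> x /=; rewrite !in_itv/= ltrBlDl lerBrDl.
Qed.

Lemma ge0_integral_shift (a : R) (f : R -> \bar R) :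
  measurable_fun [set: measurableTypeR R] f -> (forall r, 0 <= f r)%E ->
  (\int[lebesgue_measure]_x f (a + x)%R = \int[lebesgue_measure]_x f x)%E.
Proof.
move=> mf f0.
have ma : measurable_fun setT ((+%R a) : _ -> measurableTypeR R).
  by apply: measurable_funD => //; exact: measurable_cst.
transitivity (\int[pushforward lebesgue_measure
    ((+%R a) : measurableTypeR R -> measurableTypeR R)]_x f x)%E.
  by rewrite ge0_integral_pushforward.
by apply: eq_measure_integral => A mA _; exact: lebesgue_measure_shift.
Qed.

(** By induction on the dimension from the translation invariance of the
    one-dimensional measure. *)
Lemma iint_shift {m} (a : 'rV[R]_m) (f : 'rV[R]_m -> \bar R) :
  (forall x, 0 <= f x)%E ->
  measurable_fun setT (fun t : TR m => f (row_of_tuple t)) ->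
  iint (fun y => f (a + y)%R) = iint f.
Proof.
elim: m a f => [|m IH] a f f0 mf /=; first by congr f; apply/rowP => -[? //].
have mfc : measurable_fun setT (fun p => f (row_of_tuple (cons_pair p))).
  exact: (measurableT_comp mf measurable_cons_pair).
have mfx (x : R) : measurable_fun setT
    (fun t : TR m => f (row_mx (const_mx x : 'rV_1) (row_of_tuple t) : 'rV_(1 + m))).
  rewrite [X in measurable_fun _ X](_ : _ = fun t => f (row_of_tuple (cons_pair (x, t)))).
    exact: (measurableT_comp mfc (pair1_measurable x)).
  by apply/funext => t /=; rewrite -row_of_tuple_cons.
pose F x := iint (fun z => f (row_mx (const_mx x : 'rV_1) z : 'rV_(1 + m))).
have F0 x : (0 <= F x)%E.
  by rewrite /F iintE//; apply: integral_ge0.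
have mF : measurable_fun [set: measurableTypeR R] F.
  rewrite (_ : F = fubini_F (lebm m) (fun p => f (row_of_tuple (cons_pair p)))).
    exact: measurable_fun_fubini_tonelli_F.
  apply/funext => x; rewrite /F iintE//; apply: eq_integral => t _.
  by rewrite -row_of_tuple_cons.
transitivity (\int[lebesgue_measure]_x F (a 0 ord0 + x)%R)%E; last exact: ge0_integral_shift.
apply: eq_integral => x _.
rewrite /F -[RHS](IH (rsubmx (a : 'rV_(1 + m))))//.
congr iint; apply/funext => z; congr f.
apply/rowP => k; rewrite !mxE; case: (@splitP 1 m k) => j jk; rewrite !mxE.
  by congr (a _ _ + _); apply/val_inj; rewrite /= [LHS]jk [j]ord1.
by congr (a _ _ + _); apply/val_inj; rewrite /= [LHS]jk.
Qed.

End LebesgueRm.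

(** * Integrals of real functions on R^m *)

Section IntegrableRm.
Context {R : realType}.
Local Notation C := R[i].
Local Notation TR m := (m.-tuple (measurableTypeR R)).

Lemma ge0_iintE {m} (f : 'rV[R]_m -> R) : (forall x, 0 <= f x) -> borel_rV f ->
  iint (fun x => (f x)%:E) = (\int[lebm m]_t (f (row_of_tuple t))%:E)%E.
Proof.
move=> f0 bf; rewrite iintE//.
exact/measurable_EFinP.
Qed.

Lemma iint_ge0 {m} (f : 'rV[R]_m -> R) : (forall x, 0 <= f x) -> borel_rV f ->
  (0 <= iint (fun x => (f x)%:E))%E.
Proof.
by move=> f0 bf; rewrite ge0_iintE//; apply: integral_ge0 => t _; rewrite lee_fin.
Qed.

Lemma iint_le {m} (f g : 'rV[R]_m -> R) : borel_rV f -> borel_rV g ->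
  (forall x, 0 <= f x <= g x) ->
  (iint (fun x => (f x)%:E) <= iint (fun x => (g x)%:E))%E.
Proof.
move=> bf bg fg.
have f0 x : 0 <= f x by case/andP: (fg x).
have g0 x : 0 <= g x by case/andP: (fg x) => /le_trans; exact.
rewrite !ge0_iintE//; apply: ge0_le_integral => //=.
- by move=> t _; rewrite lee_fin.
- exact/measurable_EFinP.
- exact/measurable_EFinP.
- by move=> t _; rewrite lee_fin; case/andP: (fg (row_of_tuple t)).
Qed.

Lemma borel_rVD {m} (f g : 'rV[R]_m -> R) :
  borel_rV f -> borel_rV g -> borel_rV (fun x => f x + g x).
Proof. by move=> bf bg; exact: measurable_funD. Qed.

Lemma borel_rVM {m} (f g : 'rV[R]_m -> R) :
  borel_rV f -> borel_rV g -> borel_rV (fun x => f x * g x).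
Proof. by move=> bf bg; exact: measurable_funM. Qed.

Lemma borel_rVN {m} (f : 'rV[R]_m -> R) : borel_rV f -> borel_rV (fun x => - f x).
Proof. by move=> bf; apply: measurableT_comp. Qed.

Lemma borel_rV_cst {m} (c : R) : borel_rV (fun _ : 'rV[R]_m => c).
Proof. exact: measurable_cst. Qed.

Lemma borel_rVX {m} (f : 'rV[R]_m -> R) k : borel_rV f -> borel_rV (fun x => f x ^+ k).
Proof. exact: measurable_funX. Qed.

Lemma borel_rV_sum {m} I (s : seq I) (f : I -> 'rV[R]_m -> R) :
  (forall i, borel_rV (f i)) -> borel_rV (fun x => \sum_(i <- s) f i x).
Proof. by move=> bf; exact: measurable_sum. Qed.

Lemma iintD {m} (f g : 'rV[R]_m -> R) :
  (forall x, 0 <= f x) -> (forall x, 0 <= g x) -> borel_rV f -> borel_rV g ->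
  iint (fun x => (f x + g x)%:E) =
  (iint (fun x => (f x)%:E) + iint (fun x => (g x)%:E))%E.
Proof.
move=> f0 g0 bf bg; rewrite !ge0_iintE//; last 2 first.
- by move=> x; exact: addr_ge0.
- exact: borel_rVD.
under eq_integral do rewrite EFinD.
rewrite ge0_integralD//=.
- by move=> t _; rewrite lee_fin.
- exact/measurable_EFinP.
- by move=> t _; rewrite lee_fin.
- exact/measurable_EFinP.
Qed.

Lemma iintZ {m} (c : R) (f : 'rV[R]_m -> R) :
  0 <= c -> (forall x, 0 <= f x) -> borel_rV f ->
  iint (fun x => (c * f x)%:E) = (c%:E * iint (fun x => (f x)%:E))%E.
Proof.
move=> c0 f0 bf; rewrite !ge0_iintE//; last 2 first.
- by move=> x; exact: mulr_ge0.
- by apply: borel_rVM => //; exact: borel_rV_cst.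
under eq_integral do rewrite EFinM.
rewrite ge0_integralZl_EFin//=.
- by move=> t _; rewrite lee_fin.
- exact/measurable_EFinP.
Qed.

Lemma iint0 {m} : iint (fun _ : 'rV[R]_m => 0%:E) = 0%E.
Proof.
rewrite ge0_iintE//; last exact: borel_rV_cst.
by rewrite integral0.
Qed.

Lemma iint_sum {m} I (s : seq I) (P : pred I) (f : I -> 'rV[R]_m -> R) :
  (forall i x, 0 <= f i x) -> (forall i, borel_rV (f i)) ->
  iint (fun x => (\sum_(i <- s | P i) f i x)%:E) =
  (\sum_(i <- s | P i) iint (fun x => (f i x)%:E))%E.
Proof.
move=> f0 bf; under eq_fun do rewrite -big_filter.
rewrite -[RHS]big_filter; elim: (seq.filter P s) => [|i r IH].
  by under eq_fun do rewrite big_nil; rewrite iint0 big_nil.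
under eq_fun do rewrite big_cons.
rewrite iintD//; first by rewrite IH big_cons.
- by move=> x; apply: sumr_ge0.
- exact: borel_rV_sum.
Qed.

(** Almost everywhere equality for the measure behind [iint]. With [f] a density
    of squares, it shows that every integral controlled by [f] vanishes. *)
Lemma iint_eq0 {m} (f g : 'rV[R]_m -> R) :
  (forall x, 0 <= f x) -> (forall x, 0 <= g x) -> borel_rV f -> borel_rV g ->
  (forall x, f x = 0 -> g x = 0) ->
  iint (fun x => (f x)%:E) = 0%E -> iint (fun x => (g x)%:E) = 0%E.
Proof.
move=> f0 g0 bf bg fg; rewrite !ge0_iintE//.
have mf : measurable_fun setT (fun t : TR m => (f (row_of_tuple t))%:E).
  exact/measurable_EFinP.
have mg : measurable_fun setT (fun t : TR m => (g (row_of_tuple t))%:E).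
  exact/measurable_EFinP.
move=> If.
have : ae_eq (lebm m) setT (fun t : TR m => (f (row_of_tuple t))%:E) (cst 0%E).
  apply/ae_eq_integral_abs => //.
  by rewrite -[RHS]If; apply: eq_integral => t _; rewrite gee0_abs// lee_fin.
move=> fae; have gae : ae_eq (lebm m) setT (fun t : TR m => (g (row_of_tuple t))%:E) (cst 0%E).
  by apply: filterS fae => t /= ft /ft [] /fg ->.
rewrite (ge0_ae_eq_integral _ mg _ _ _ gae)//= ?integral0//.
by move=> t _; rewrite lee_fin.
Qed.

(** * Integrable functions *)

Definition L1 {m} (f : 'rV[R]_m -> R) :=
  borel_rV f /\ (iint (fun x => `|f x|%:E) < +oo)%E.

Lemma borel_rV_norm {m} (f : 'rV[R]_m -> R) : borel_rV f -> borel_rV (fun x => `|f x|).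
Proof. by move=> bf; apply: measurableT_comp. Qed.

Lemma L1P {m} {f : 'rV[R]_m -> R} :
  L1 f <-> (lebm m).-integrable setT (EFin \o (f \o row_of_tuple)).
Proof.
split=> [[bf If]|/integrableP[/measurable_EFinP mf If]].
  apply/integrableP; split; first exact/measurable_EFinP.
  by rewrite ge0_iintE in If => //; exact: borel_rV_norm.
by split => //; rewrite ge0_iintE//; exact: borel_rV_norm.
Qed.

Let measurable_EFin_row {m} (f : 'rV[R]_m -> R) : borel_rV f ->
  measurable_fun [set: TR m] (EFin \o (f \o row_of_tuple)).
Proof. by move=> bf; exact/measurable_EFinP. Qed.

Let measurable_funepos_row {m} (f : 'rV[R]_m -> R) : borel_rV f ->
  measurable_fun [set: TR m] (fun t => (EFin \o f)^\+%E (row_of_tuple t)).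
Proof.
by move=> /measurable_EFin_row/measurable_funepos; rewrite !funepos.unlock.
Qed.

Let measurable_funeneg_row {m} (f : 'rV[R]_m -> R) : borel_rV f ->
  measurable_fun [set: TR m] (fun t => (EFin \o f)^\-%E (row_of_tuple t)).
Proof.
by move=> /measurable_EFin_row/measurable_funeneg; rewrite !funeneg.unlock.
Qed.

Lemma iint_funepos {m} (f : 'rV[R]_m -> R) : borel_rV f ->
  iint (EFin \o f)^\+%E = (\int[lebm m]_t ((EFin \o (f \o row_of_tuple))^\+%E t))%E.
Proof.
move=> bf; rewrite iintE//; last exact: measurable_funepos_row.
by apply: eq_integral => t _; rewrite !funepos.unlock.
Qed.

Lemma iint_funeneg {m} (f : 'rV[R]_m -> R) : borel_rV f ->
  iint (EFin \o f)^\-%E = (\int[lebm m]_t ((EFin \o (f \o row_of_tuple))^\-%E t))%E.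
Proof.
move=> bf; rewrite iintE//; last exact: measurable_funeneg_row.
by apply: eq_integral => t _; rewrite !funeneg.unlock.
Qed.

Lemma rintE {m} (f : 'rV[R]_m -> R) : L1 f ->
  rint f = \int[lebm m]_t f (row_of_tuple t).
Proof.
move=> Lf; have If := L1P.1 Lf; case: Lf => bf _.
rewrite /rint /Rintegral [in RHS]integralE fineB.
- by rewrite iint_funepos// iint_funeneg.
- exact: integrable_pos_fin_num.
- exact: integrable_neg_fin_num.
Qed.

Lemma L1D {m} (f g : 'rV[R]_m -> R) : L1 f -> L1 g -> L1 (fun x => f x + g x).
Proof. by move=> /L1P If /L1P Ig; apply/L1P; exact: (integrableD _ If Ig). Qed.

Lemma L1Z {m} (c : R) (f : 'rV[R]_m -> R) : L1 f -> L1 (fun x => c * f x).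
Proof. by move=> /L1P If; apply/L1P; exact: (integrableZl _ c If). Qed.

Lemma rintD {m} (f g : 'rV[R]_m -> R) : L1 f -> L1 g ->
  rint (fun x => f x + g x) = rint f + rint g.
Proof.
move=> If Ig; rewrite !rintE//; last exact: L1D.
by rewrite RintegralD//; exact/L1P.
Qed.

Lemma rintZ {m} (c : R) (f : 'rV[R]_m -> R) : L1 f ->
  rint (fun x => c * f x) = c * rint f.
Proof.
move=> If; rewrite !rintE//; last exact: L1Z.
by rewrite RintegralZl//; exact/L1P.
Qed.

Lemma rint_le {m} (f g : 'rV[R]_m -> R) : L1 f -> L1 g -> (forall x, f x <= g x) ->
  rint f <= rint g.
Proof.
move=> If Ig fg; rewrite !rintE//; apply: le_Rintegral => //; exact/L1P.
Qed.

Lemma L1_dom {m} (f g : 'rV[R]_m -> R) : borel_rV f -> L1 g ->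
  (forall x, `|f x| <= g x) -> L1 f.
Proof.
move=> bf /L1P Ig fg; apply/L1P; apply: le_integrable Ig => //.
  exact/measurable_EFinP.
move=> t _ /=; rewrite lee_fin (le_trans (fg _))//.
exact: ler_norm.
Qed.

Lemma rint_norm {m} (f g : 'rV[R]_m -> R) : L1 f -> L1 g -> (forall x, `|f x| <= g x) ->
  `|rint f| <= rint g.
Proof.
move=> If Ig fg; rewrite ler_norml; apply/andP; split.
  rewrite lerNl -mulN1r -rintZ//; apply: rint_le => //; first exact: L1Z.
  by move=> x; rewrite mulN1r; move: (fg x); rewrite ler_norml lerNl => /andP[].
by apply: rint_le => // x; move: (fg x); rewrite ler_norml => /andP[].
Qed.

Lemma rint_shift {m} (a : 'rV[R]_m) (f : 'rV[R]_m -> R) : L1 f ->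
  rint (fun y => f (a + y)) = rint f.
Proof.
move=> [bf _]; rewrite /rint; congr (fine _ - fine _).
  rewrite -[RHS](iint_shift a)//; last exact: measurable_funepos_row.
  by congr iint; rewrite !funepos.unlock.
rewrite -[RHS](iint_shift a)//; last exact: measurable_funeneg_row.
by congr iint; rewrite !funeneg.unlock.
Qed.

Lemma borel_rV_shift {m} (a : 'rV[R]_m) (f : 'rV[R]_m -> R) :
  borel_rV f -> borel_rV (fun y => f (a + y)).
Proof.
move=> bf; rewrite borel_rVE.
rewrite [X in measurable_fun _ X](_ : _ = (f \o row_of_tuple) \o
  (fun t : TR m => tuple_of_row (a + row_of_tuple t))).
  apply: measurableT_comp => //; apply/measurable_fun_tnthP => i /=.
  rewrite [X in measurable_fun _ X](_ : _ = fun t => a 0 i + tnth t i).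
    by apply: measurable_funD => //; exact: measurable_tnth.
  by apply/funext => t /=; rewrite tnth_mktuple !mxE.
by apply/funext => t /=; rewrite tuple_of_rowK.
Qed.

Lemma L1_shift {m} (a : 'rV[R]_m) (f : 'rV[R]_m -> R) : L1 f -> L1 (fun y => f (a + y)).
Proof.
move=> [bf If]; split; first exact: borel_rV_shift.
rewrite (iint_shift a (f := fun y => `|f y|%:E)) => //.
by apply/measurable_EFinP; exact: borel_rV_norm.
Qed.

(** * Complex-valued integrals *)

Definition cL1 {m} (f : 'rV[R]_m -> C) :=
  L1 (fun x => complex.Re (f x)) /\ L1 (fun x => complex.Im (f x)).

Lemma cL1_lin {m} (a : C) (f g : 'rV[R]_m -> C) : cL1 f -> cL1 g ->
  cL1 (fun x => a * f x + g x).
Proof.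
move=> [If1 If2] [Ig1 Ig2].
split.
  rewrite (_ : (fun _ => _) = fun x => complex.Re a * complex.Re (f x) +
      (- complex.Im a) * complex.Im (f x) + complex.Re (g x)).
    by apply: L1D => //; apply: L1D; exact: L1Z.
  by apply/funext => x; case: a (f x) (g x) => [? ?] [? ?] [? ?] /=; ring.
rewrite (_ : (fun _ => _) = fun x => complex.Re a * complex.Im (f x) +
    complex.Im a * complex.Re (f x) + complex.Im (g x)).
  by apply: L1D => //; apply: L1D; exact: L1Z.
by apply/funext => x; case: a (f x) (g x) => [? ?] [? ?] [? ?] /=; ring.
Qed.

Lemma cint_lin {m} (a : C) (f g : 'rV[R]_m -> C) : cL1 f -> cL1 g ->
  cint (fun x => a * f x + g x) = a * cint f + cint g.
Proof.
move=> [If1 If2] [Ig1 Ig2]; rewrite /cint.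
rewrite (_ : (fun x => complex.Re _) = fun x => complex.Re a * complex.Re (f x) +
    (- complex.Im a) * complex.Im (f x) + complex.Re (g x)); last first.
  by apply/funext => x; case: a (f x) (g x) => [? ?] [? ?] [? ?] /=; ring.
rewrite (_ : (fun x => complex.Im (a * _ + _)) = fun x => complex.Re a * complex.Im (f x) +
    complex.Im a * complex.Re (f x) + complex.Im (g x)); last first.
  by apply/funext => x; case: a (f x) (g x) => [? ?] [? ?] [? ?] /=; ring.
rewrite !rintD ?rintZ//; try by [apply: L1D => //; exact: L1Z|exact: L1Z].
by case: a => a1 a2; apply/eqP; rewrite eq_complex /=; apply/andP; split; apply/eqP; ring.
Qed.

Lemma cint0 {m} : cint (fun _ : 'rV[R]_m => 0) = 0.
Proof.
have L0 : L1 (fun _ : 'rV[R]_m => 0 : R).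
  split; first exact: borel_rV_cst.
  by under eq_fun do rewrite normr0; rewrite iint0 ltry.
have r0 : rint (fun _ : 'rV[R]_m => 0) = 0.
  by rewrite rintE// Rintegral_cst//= mul0r.
by rewrite /cint /= r0.
Qed.

Lemma le_Re_cabs (z : C) : `|complex.Re z| <= cabs z.
Proof. by rewrite -sqrtr_sqr ler_wsqrtr// lerDl sqr_ge0. Qed.

Lemma le_Im_cabs (z : C) : `|complex.Im z| <= cabs z.
Proof. by rewrite -sqrtr_sqr ler_wsqrtr// lerDr sqr_ge0. Qed.

Lemma cabs_ge0 (z : C) : 0 <= cabs z. Proof. exact: sqrtr_ge0. Qed.

Lemma cabs_le_ReIm (z : C) : cabs z <= `|complex.Re z| + `|complex.Im z|.
Proof.
rewrite -[leRHS]ger0_norm ?addr_ge0// -sqrtr_sqr ler_wsqrtr// sqrrD !real_normK ?num_real//.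
by rewrite addrAC lerDl mulrn_wge0 // mulr_ge0.
Qed.

Lemma cL1_dom {m} (f : 'rV[R]_m -> C) (g : 'rV[R]_m -> R) :
  cborel_rV f -> L1 g -> (forall x, cabs (f x) <= g x) -> cL1 f.
Proof.
move=> [bf1 bf2] Ig fg; split; apply: (L1_dom (g := g)) => // x;
  by rewrite (le_trans _ (fg x))// (le_Re_cabs, le_Im_cabs).
Qed.

(** The factor 2 comes from treating real and imaginary parts separately; no
    sharp constant is ever needed. *)
Lemma cabs_cint {m} (f : 'rV[R]_m -> C) (g : 'rV[R]_m -> R) :
  cL1 f -> L1 g -> (forall x, cabs (f x) <= g x) -> cabs (cint f) <= 2 * rint g.
Proof.
move=> [If1 If2] Ig fg; rewrite (le_trans (cabs_le_ReIm _))//= mulr2n mulrDl !mul1r.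
by rewrite lerD// rint_norm// => x; rewrite (le_trans _ (fg x))// (le_Re_cabs, le_Im_cabs).
Qed.

Lemma cint_shift {m} (a : 'rV[R]_m) (f : 'rV[R]_m -> C) : cL1 f ->
  cint (fun y => f (a + y)) = cint f.
Proof.
by move=> [If1 If2]; rewrite /cint (rint_shift a If1) (rint_shift a If2).
Qed.

(** * Integrability of negative powers of the Japanese bracket *)

Lemma dotp_ge0 {m} (y : 'rV[R]_m) : 0 <= dotp y y.
Proof. by apply: sumr_ge0 => i _; rewrite -expr2 sqr_ge0. Qed.

Lemma jap_sqr {m} (y : 'rV[R]_m) : jap y ^+ 2 = 1 + dotp y y.
Proof. by rewrite sqr_sqrtr// addr_ge0// dotp_ge0. Qed.

Lemma jap_ge1 {m} (y : 'rV[R]_m) : 1 <= jap y.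
Proof. by rewrite -[leLHS]sqrtr1 ler_wsqrtr// lerDl dotp_ge0. Qed.

Lemma jap_gt0 {m} (y : 'rV[R]_m) : 0 < jap y.
Proof. exact: lt_le_trans (jap_ge1 y). Qed.

Lemma continuous_dotp {m} : continuous (fun y : 'rV[R]_m => dotp y y).
Proof.
apply: continuous_big => [|i _ x]; first by move=> p; exact: add_continuous.
by apply: continuousM; exact: coord_continuous.
Qed.

Lemma continuous_jap {m} : continuous (@jap R m).
Proof.
move=> y; apply: (continuous_comp (f := fun y : 'rV[R]_m => 1 + dotp y y)).
  by apply: continuousD; [exact: cst_continuous|exact: continuous_dotp].
exact: sqrt_continuous.
Qed.

Lemma measurable_oneDsqrV :
  measurable_fun [set: measurableTypeR R] (fun x : R => (1 + x ^+ 2)^-1).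
Proof. exact: (continuous_measurable_fun (@continuous_oneDsqrV R)). Qed.

Lemma integral_oneDsqrV_lty :
  (\int[lebesgue_measure]_x ((1 + x ^+ 2)^-1 : R)%:E < +oo)%E.
Proof.
pose f (x : R) : \bar R := (oneDsqr x)^-1%:E.
have mf : measurable_fun [set: R] f.
  by apply/measurable_EFinP; exact: measurable_oneDsqrV.
have f0 x : (0 <= f x)%E by rewrite lee_fin invr_ge0 ltW// (lt_le_trans ltr01)// oneDsqr_ge1.
have fN x : f (- x) = f x by rewrite /f /oneDsqr sqrrN.
have I1 : (\int[lebesgue_measure]_(x in `[0%R, +oo[) f x = (pi / 2)%:E)%E.
  exact: integral0y_oneDsqr.
have I2 : (\int[lebesgue_measure]_(x in `]-oo, 0%R]) f x = (pi / 2)%:E)%E.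
  rewrite -I1 ge0_integration_by_substitution0//.
  by apply: eq_integral => x _; rewrite fN.
rewrite (_ : [set: _] = `]-oo, 0%R] `|` `]0%R, +oo[); last first.
  by apply/seteqP; split => x //= _; rewrite !in_itv/= andbT; case: leP; [left|right].
rewrite ge0_integral_setU//=; last 3 first.
- exact: measurable_funS mf.
- by move=> x _; exact: f0.
- apply/disj_setPS => x [] /=; rewrite !in_itv/= andbT => x0 /lt_le_trans/(_ x0).
  by rewrite ltxx.
rewrite I2 integral_itv_obnd_cbnd; last exact: measurable_funS mf.
by rewrite I1 -EFinD ltry.
Qed.

(** A product density, integrable by induction on the dimension, that dominates
    <y>^(-2m). *)
Definition cauchy_density {m} (y : 'rV[R]_m) : R := \prod_i (1 + y 0 i ^+ 2)^-1.

Lemma oneDsqr_gt0 (x : R) : 0 < 1 + x ^+ 2.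
Proof. by rewrite (lt_le_trans ltr01)// lerDl sqr_ge0. Qed.

Lemma cauchy_density_ge0 {m} (y : 'rV[R]_m) : 0 <= cauchy_density y.
Proof. by apply: prodr_ge0 => i _; rewrite invr_ge0 ltW// oneDsqr_gt0. Qed.

Lemma borel_cauchy_density {m} : borel_rV (@cauchy_density m).
Proof.
rewrite borel_rVE; apply: measurable_prod => i _.
apply: (measurableT_comp (f := fun x : R => (1 + x ^+ 2)^-1)).
  exact: measurable_oneDsqrV.
rewrite [X in measurable_fun _ X](_ : _ = @tnth m R ^~ i).
  exact: measurable_tnth.
by apply/funext => t; rewrite mxE.
Qed.

Lemma iint_cauchy_density m : (iint (fun y : 'rV[R]_m => (cauchy_density y)%:E) < +oo)%E.
Proof.
elim: m => [|m IH] /=; first by rewrite ltry.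
under eq_integral => x _.
  rewrite (_ : (fun z : 'rV_m => _) = fun z : 'rV_m => ((1 + x ^+ 2)^-1 * cauchy_density z)%:E).
    rewrite iintZ; [|by rewrite invr_ge0 ltW// oneDsqr_gt0|exact: cauchy_density_ge0|exact: borel_cauchy_density].
    over.
  apply/funext => z; congr EFin; rewrite /cauchy_density big_ord_recl; congr (_ * _).
    by rewrite mxE; case: (@splitP 1 m ord0) => // j; rewrite mxE.
  apply: eq_bigr => i _; rewrite mxE.
  case: (@splitP 1 m (lift ord0 i)) => j /= /eqP; first by rewrite [j]ord1.
  by rewrite /bump leq0n !add1n eqSS => /eqP ij; rewrite (_ : i = j)//; exact/val_inj.
rewrite ge0_integralZr//=.
- rewrite lte_mul_pinfty//.
  + by apply: integral_ge0 => x _; rewrite lee_fin invr_ge0 ltW// oneDsqr_gt0.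
  + by rewrite ge0_fin_numE ?integral_oneDsqrV_lty//; apply: integral_ge0 => x _; rewrite lee_fin invr_ge0 ltW// oneDsqr_gt0.
- by apply/measurable_EFinP; exact: measurable_oneDsqrV.
- by move=> x _; rewrite lee_fin invr_ge0 ltW// oneDsqr_gt0.
- by apply: iint_ge0; [exact: cauchy_density_ge0|exact: borel_cauchy_density].
Qed.

Lemma borel_japV {m} k : borel_rV (fun y : 'rV[R]_m => (jap y)^-1 ^+ k).
Proof.
apply: borel_rVX; apply: borel_continuous => y.
by apply: continuousV; [rewrite gt_eqF// jap_gt0|exact: continuous_jap].
Qed.

Lemma L1_japV {m} (c : R) : L1 (fun y : 'rV[R]_m => c * (jap y)^-1 ^+ (2 * m)).
Proof.
apply: L1Z; apply: (L1_dom (g := cauchy_density)).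
- exact: borel_japV.
- split; first exact: borel_cauchy_density.
  under eq_fun do rewrite ger0_norm ?cauchy_density_ge0//.
  exact: iint_cauchy_density.
move=> y; rewrite ger0_norm; last by rewrite exprn_ge0// invr_ge0 ltW// jap_gt0.
rewrite exprM exprVn jap_sqr -{2}[m]card_ord -prodr_const.
apply: ler_prod => i _; rewrite invr_ge0 addr_ge0 ?dotp_ge0//=.
rewrite lef_pV2 ?posrE ?oneDsqr_gt0 ?ltr_wpDr ?dotp_ge0//.
rewrite lerD2l /dotp (bigD1 i)//= -expr2 lerDl.
by apply: sumr_ge0 => j _; rewrite -expr2 sqr_ge0.
Qed.

End IntegrableRm.

(** * Hilbert spaces presented by representatives *)

Section HilbertTheory.
Context {R : realType} {E : lmodType R[i]}.
Local Notation C := R[i].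
Context {H : set E} {ip : E -> E -> C} (hH : hilbert H ip).
Local Notation N := (hnorm ip).
Implicit Types (u v z : E).

Lemma hilbD u v : H u -> H v -> H (u + v).
Proof. by move=> Hu Hv; rewrite -[u]scale1r; exact: (hilbL hH). Qed.

Lemma hilbZ a u : H u -> H (a *: u).
Proof. by move=> Hu; rewrite -[_ *: _]addr0; apply: (hilbL hH) => //; exact: hilb0 hH. Qed.

Lemma hilbN u : H u -> H (- u).
Proof. by move=> Hu; rewrite -scaleN1r; exact: hilbZ. Qed.

Lemma hilbB u v : H u -> H v -> H (u - v).
Proof. by move=> Hu Hv; apply: hilbD => //; exact: hilbN. Qed.

Lemma ipDl u v z : H u -> H v -> H z -> ip (u + v) z = ip u z + ip v z.
Proof. by move=> Hu Hv Hz; rewrite -[u in LHS]scale1r (hilb_linear hH)// mul1r. Qed.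

Lemma ip0l z : H z -> ip 0 z = 0.
Proof.
move=> Hz; have H0 := hilb0 hH.
by apply: (@addrI _ (ip 0 z)); rewrite -ipDl// !addr0.
Qed.

Lemma ipZl a u z : H u -> H z -> ip (a *: u) z = a * ip u z.
Proof.
move=> Hu Hz; rewrite -[_ *: _]addr0 (hilb_linear hH)//; last exact: hilb0 hH.
by rewrite ip0l// addr0.
Qed.

Lemma ipBl u v z : H u -> H v -> H z -> ip (u - v) z = ip u z - ip v z.
Proof.
by move=> Hu Hv Hz; rewrite -scaleN1r ipDl ?ipZl ?mulN1r//; exact: hilbZ.
Qed.

Lemma ipC u v : H u -> H v -> ip v u = conjc (ip u v).
Proof. exact: (hilb_herm hH). Qed.

Lemma ipDr u v z : H u -> H v -> H z -> ip z (u + v) = ip z u + ip z v.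
Proof.
move=> Hu Hv Hz; rewrite ipC ?ipDl//; last exact: hilbD.
by rewrite rmorphD/= -(ipC Hu Hz) -(ipC Hv Hz).
Qed.

Lemma ipZr a u z : H u -> H z -> ip z (a *: u) = conjc a * ip z u.
Proof.
move=> Hu Hz; rewrite ipC ?ipZl//; last exact: hilbZ.
by rewrite rmorphM/= -(ipC Hu Hz).
Qed.

Local Notation rip u v := (complex.Re (ip u v)).

Lemma rip_ge0 u : H u -> 0 <= rip u u.
Proof. by move=> /(hilb_ge0 hH); case: (ip u u) => a b; rewrite lecE => /andP[]. Qed.

Lemma ripC u v : H u -> H v -> rip v u = rip u v.
Proof. by move=> Hu Hv; rewrite (ipC Hu Hv); case: (ip u v). Qed.

Lemma hnorm_ge0 u : 0 <= N u.
Proof. exact: sqrtr_ge0. Qed.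

Lemma hnorm_sqr u : H u -> N u ^+ 2 = rip u u.
Proof. by move=> Hu; rewrite sqr_sqrtr// rip_ge0. Qed.

Lemma hnormZ a u : H u -> N (a *: u) = cabs a * N u.
Proof.
move=> Hu; rewrite /hnorm ipZl// ?ipZr//; last exact: hilbZ.
rewrite mulrA -sqrtrM ?addr_ge0 ?sqr_ge0//; congr Num.sqrt.
have := hilb_ge0 hH Hu; case: (ip u u) => b c; rewrite lecE => /andP[/eqP /= -> _].
by case: a => a a'; rewrite /cabs2 /=; ring.
Qed.

Lemma cabs_real (r : R) : cabs (r%:C)%C = `|r|.
Proof. by rewrite /cabs /cabs2 /= expr0n addr0 sqrtr_sqr. Qed.

Lemma cabsN (a : C) : cabs (- a) = cabs a.
Proof. by case: a => a b; rewrite /cabs /cabs2 /= !sqrrN. Qed.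

Lemma cabs1 : cabs (1 : C) = 1.
Proof. by rewrite /cabs /cabs2 /= expr0n addr0 expr1n sqrtr1. Qed.

Lemma hnormN u : H u -> N (- u) = N u.
Proof. by move=> Hu; rewrite -scaleN1r hnormZ// cabsN cabs1 mul1r. Qed.

Lemma hnormBC u v : H u -> H v -> N (u - v) = N (v - u).
Proof. by move=> Hu Hv; rewrite -opprB hnormN//; exact: hilbB. Qed.

Lemma hnorm0 : N 0 = 0.
Proof. by rewrite /hnorm ip0l ?sqrtr0//; exact: hilb0 hH. Qed.

Lemma hnorm_sqrD u v : H u -> H v ->
  N (u + v) ^+ 2 = N u ^+ 2 + rip u v *+ 2 + N v ^+ 2.
Proof.
move=> Hu Hv; rewrite !hnorm_sqr//; last exact: hilbD.
rewrite ipDl ?ipDr//; last exact: hilbD.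
have := ripC Hu Hv.
case: (ip u u) (ip u v) (ip v u) (ip v v) => [? ?] [? ?] [? ?] [? ?] /= ->.
by rewrite mulr2n !addrA.
Qed.

Lemma ripZ (r : R) u v : H u -> H v -> rip u ((r%:C)%C *: v) = r * rip u v.
Proof. by move=> Hu Hv; rewrite ipZr//; case: (ip u v) => a b /=; ring. Qed.

Lemma rip_CS u v : H u -> H v -> `|rip u v| <= N u * N v.
Proof.
move=> Hu Hv; rewrite -[leRHS]ger0_norm ?mulr_ge0 ?hnorm_ge0// -ler_sqr ?nnegrE//.
rewrite !real_normK ?num_real// exprMn.
have h (t : R) : 0 <= N u ^+ 2 + t * rip u v *+ 2 + t ^+ 2 * N v ^+ 2.
  have := sqr_ge0 (N (u + (t%:C)%C *: v)).
  rewrite hnorm_sqrD//; last exact: hilbZ.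
  by rewrite ripZ// hnormZ// exprMn cabs_real real_normK ?num_real.
(* the quadratic polynomial of [h] in [t] is nonnegative; evaluate it at its
   minimum, or far out when it degenerates to an affine function *)
have [v0|v0] := eqVneq (N v ^+ 2) 0.
  have [->|r0] := eqVneq (rip u v) 0; first by rewrite expr0n v0 mulr0.
  have := h (- (N u ^+ 2 + 1) / (rip u v *+ 2)).
  rewrite v0 mulr0 addr0 -mulrnAr divfK ?mulrn_eq0//.
  by rewrite opprD addrA subrr add0r ler0N1.
have vp : 0 < N v ^+ 2 by rewrite lt_neqAle eq_sym v0 sqr_ge0.
have := h (- rip u v / N v ^+ 2).
rewrite -(pmulr_rge0 _ vp) => h2.
rewrite -subr_ge0 (le_trans h2)// le_eqVlt; apply/orP; left; apply/eqP.
by move: (N v ^+ 2) v0 {vp h h2} => b b0; field.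
Qed.

Lemma hnormD u v : H u -> H v -> N (u + v) <= N u + N v.
Proof.
move=> Hu Hv; rewrite -ler_sqr ?nnegrE ?addr_ge0 ?hnorm_ge0// hnorm_sqrD//.
by rewrite sqrrD lerD2r lerD2l lerMn2r/= (le_trans (ler_norm _))// rip_CS.
Qed.

Lemma hnormB_le u v z : H u -> H v -> H z -> N (u - z) <= N (u - v) + N (v - z).
Proof.
move=> Hu Hv Hz; rewrite -[u - z](subrKA v) hnormD//; exact: hilbB.
Qed.

Lemma hnorm_lip u v : H u -> H v -> `|N u - N v| <= N (u - v).
Proof.
move=> Hu Hv; rewrite ler_norml lerBlDr lerNl opprB lerBlDr; apply/andP; split.
  by rewrite hnormBC// -{1}[v](subrK u) hnormD//; exact: hilbB.
by rewrite -{1}[u](subrK v) hnormD//; exact: hilbB.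
Qed.

Lemma im_rip u v : H u -> H v -> complex.Im (ip u v) = - rip ('i%C *: u) v.
Proof. by move=> Hu Hv; rewrite ipZl//; case: (ip u v) => a b /=; ring. Qed.

Lemma cabs_i : cabs ('i%C : C) = 1.
Proof. by rewrite /cabs /cabs2 /= expr0n add0r expr1n sqrtr1. Qed.

Lemma cabs_ip u v : H u -> H v -> cabs (ip u v) <= 2 * (N u * N v).
Proof.
move=> Hu Hv; rewrite (le_trans (cabs_le_ReIm _))// mulr2n mulrDl mul1r.
rewrite lerD ?rip_CS// im_rip// normrN (le_trans (rip_CS _ _))//; first exact: hilbZ.
by rewrite hnormZ// cabs_i mul1r.
Qed.

Lemma cabs_eq0 (a : C) : cabs a = 0 -> a = 0.
Proof.
move=> a0; have := le_Re_cabs a; have := le_Im_cabs a; rewrite a0 !normr_le0.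
by case: a {a0} => a b /= /eqP -> /eqP ->.
Qed.

(** Vectors at distance zero represent the same element of the Hilbert space;
    all constructions below are only determined up to this relation. *)
Definition heq u v := N (u - v) = 0.

Lemma heq_refl u : heq u u.
Proof. by rewrite /heq subrr hnorm0. Qed.

Lemma heq_sym u v : H u -> H v -> heq u v -> heq v u.
Proof. by move=> Hu Hv uv; rewrite /heq hnormBC. Qed.

Lemma heq_trans v u z : H u -> H v -> H z -> heq u v -> heq v z -> heq u z.
Proof.
move=> Hu Hv Hz uv vz; apply/eqP; rewrite eq_le hnorm_ge0 andbT.
by rewrite (le_trans (hnormB_le Hu Hv Hz))// uv vz addr0.
Qed.

Lemma heq_norm u v : H u -> H v -> heq u v -> N u = N v.
Proof.
move=> Hu Hv uv; apply/eqP; rewrite -subr_eq0 -normr_le0.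
by rewrite (le_trans (hnorm_lip Hu Hv))// uv.
Qed.

Lemma heqL a u v u' v' : H u -> H v -> H u' -> H v' ->
  heq u u' -> heq v v' -> heq (a *: u + v) (a *: u' + v').
Proof.
move=> Hu Hv Hu' Hv' uu vv; apply/eqP; rewrite eq_le hnorm_ge0 andbT.
rewrite opprD addrACA -scalerBr (le_trans (hnormD _ _))//.
- by apply: hilbZ; exact: hilbB.
- exact: hilbB.
by rewrite vv hnormZ ?uu ?mulr0 ?addr0//; exact: hilbB.
Qed.

Lemma heqZ a u u' : H u -> H u' -> heq u u' -> heq (a *: u) (a *: u').
Proof.
move=> Hu Hu' uu; rewrite -[X in heq X]addr0 -[X in heq _ X]addr0.
by apply: heqL => //; [exact: hilb0 hH|exact: hilb0 hH|exact: heq_refl].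
Qed.

Lemma heqB u v u' v' : H u -> H v -> H u' -> H v' ->
  heq u u' -> heq v v' -> heq (u - v) (u' - v').
Proof.
move=> Hu Hv Hu' Hv' uu vv; rewrite addrC [X in heq _ X]addrC -(scaleN1r v) -(scaleN1r v').
exact: heqL.
Qed.

Lemma heq_ip u v z : H u -> H v -> H z -> heq u v -> ip u z = ip v z.
Proof.
move=> Hu Hv Hz uv; apply/eqP; rewrite -subr_eq0 -ipBl//; apply/eqP/cabs_eq0/eqP.
rewrite eq_le cabs_ge0 andbT (le_trans (cabs_ip _ _))//; first exact: hilbB.
by rewrite uv mul0r mulr0.
Qed.

Lemma heqP u v : H u -> H v -> (forall z, H z -> ip u z = ip v z) -> heq u v.
Proof.
move=> Hu Hv uv; have Huv := hilbB Hu Hv.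
by rewrite /heq /hnorm ipBl// uv// subrr sqrtr0.
Qed.

(** Take [z = u]. This turns estimates of scalar integrals into estimates of
    vectors defined weakly. *)
Lemma hnorm_le_rip u c : H u -> 0 <= c ->
  (forall z, H z -> rip u z <= c * N z) -> N u <= c.
Proof.
move=> Hu c0 /(_ _ Hu); rewrite -hnorm_sqr// expr2.
have [->//|u0] := eqVneq (N u) 0.
by rewrite ler_pM2r// lt_neqAle eq_sym u0 hnorm_ge0.
Qed.

(** Variational proof: the energy [phi u = |u|^2 - 2 Re (L u)] is bounded below,
    a minimizing sequence is Cauchy by the parallelogram law, and the first
    variation at the minimizer represents [L]. *)
Lemma riesz (L : E -> C) (c : R) :
  (forall a u v, H u -> H v -> L (a *: u + v) = conjc a * L u + L v) ->
  (forall u, H u -> cabs (L u) <= c * N u) ->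
  exists2 g, H g & forall u, H u -> ip g u = L u.
Proof.
move=> Llin Lbnd; have H0 := hilb0 hH.
have L0 : L 0 = 0.
  by apply/cabs_eq0/eqP; rewrite eq_le cabs_ge0 andbT (le_trans (Lbnd _ H0))// hnorm0 mulr0.
pose l u := complex.Re (L u).
have lD u v : H u -> H v -> l (u + v) = l u + l v.
  by move=> Hu Hv; rewrite /l -[u in LHS]scale1r Llin// rmorph1 mul1r; case: (L u) (L v) => [? ?] [].
have lZ (r : R) u : H u -> l ((r%:C)%C *: u) = r * l u.
  move=> Hu; rewrite /l -[_ *: _]addr0 Llin// L0 addr0.
  by case: (L u) => a b /=; ring.
have lB u : H u -> `|l u| <= c * N u.
  by move=> Hu; rewrite (le_trans _ (Lbnd _ Hu))// le_Re_cabs.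
pose phi u := N u ^+ 2 - l u *+ 2.
have phi_lb u : H u -> - c ^+ 2 <= phi u.
  move=> Hu; have := lB _ Hu; rewrite ler_norml => /andP[_ h].
  rewrite /phi -subr_ge0 opprK.
  have := sqr_ge0 (N u - c); rewrite mulr2n; nra.
pose S : set R := [set phi u | u in H].
have S0 : has_inf S.
  split; first by exists (phi 0); exists 0.
  by exists (- c ^+ 2) => _ [u Hu <-]; exact: phi_lb.
pose mu := inf S.
have phi_mu u : H u -> mu <= phi u.
  by move=> Hu; apply: ge_inf; [case: S0|exists u].
have [g Hg] : exists g : nat -> E, forall k, H (g k) /\ phi (g k) < mu + k.+1%:R^-1.
  suff h k : {u | H u /\ phi u < mu + k.+1%:R^-1}.
    by exists (fun k => projT1 (h k)) => k; exact: (projT2 (h k)).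
  apply: cid; have k0 : 0 < k.+1%:R^-1 :> R by rewrite invr_gt0.
  have [_ [u Hu <-] hu] := inf_adherent k0 S0.
  by exists u.
(* parallelogram law at the midpoint of [u] and [v], whose energy is at least
   the infimum *)
have par u v : H u -> H v -> N (u - v) ^+ 2 <= (phi u + phi v - mu *+ 2) *+ 2.
  move=> Hu Hv; pose h := ((2^-1)%:C)%C *: (u + v).
  have Hh : H h by apply: hilbZ; exact: hilbD.
  have := phi_mu _ Hh; rewrite /phi lZ; last exact: hilbD.
  rewrite lD// hnormZ; last exact: hilbD.
  rewrite exprMn cabs_real real_normK ?num_real// (hnorm_sqrD Hu Hv).
  rewrite (hnorm_sqrD Hu (hilbN Hv)).
  have -> : rip u (- v) = - rip u v.
    by rewrite -scaleN1r ipZr//; case: (ip u v) => a b /=; ring.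
  rewrite hnormN//; lra.
have cauchy : forall e : R, 0 < e -> exists K, forall k l, (K <= k)%N -> (K <= l)%N ->
       N (g k - g l) < e.
  move=> e e0.
  have [K hK] : exists K : nat, 4 * K.+1%:R^-1 < e ^+ 2.
    have e2 : 0 < e ^+ 2 / 4 by rewrite divr_gt0// exprn_gt0.
    exists (Num.truncn (e ^+ 2 / 4)^-1).
    rewrite mulrC -ltr_pdivlMr// invf_plt ?posrE//.
    by rewrite truncnS_gt.
  exists K => k j Kk Kj; rewrite -ltr_sqr ?nnegrE ?hnorm_ge0 ?ltW//.
  have [Hk pk] := Hg k; have [Hj pj] := Hg j.
  apply: le_lt_trans (par _ _ Hk Hj) _; apply: le_lt_trans hK.
  have hh i : (K <= i)%N -> i.+1%:R^-1 <= K.+1%:R^-1 :> R.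
    by move=> Ki; rewrite lef_pV2 ?posrE// ler_nat.
  have := hh _ Kk; have := hh _ Kj.
  by move: (k.+1%:R^-1) (j.+1%:R^-1) (K.+1%:R^-1) pk pj => *; lra.
have [x Hx gx] := hilb_complete hH (fun k => (Hg k).1) cauchy.
(* the energy is continuous along the minimizing sequence *)
have phix : phi x = mu.
  apply/eqP; rewrite eq_le phi_mu// andbT; apply/ler_addgt0Pr => e e0.
  pose B := 2 * (N x + `|c|) + 1.
  have B0 : 0 < B by rewrite ltr_wpDl// mulr_ge0// addr_ge0// hnorm_ge0.
  have [k [gk1 gk2]] : exists k, N (g k - x) < e / 2 / B /\ k.+1%:R^-1 < e / 2.
    have e2 : 0 < e / 2 by rewrite divr_gt0.
    have eB : 0 < e / 2 / B by rewrite divr_gt0.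
    have /cvgr0_norm_lt/(_ _ eB)[k1 _ hk1] := gx.
    exists (maxn k1 (Num.truncn (e / 2)^-1)); split.
      exact: (le_lt_trans (ler_norm _) (hk1 _ (leq_maxl _ _))).
    rewrite invf_plt ?posrE// (lt_le_trans (truncnS_gt _))//.
    by rewrite ler_nat ltnS leq_maxr.
  have [Hk pk] := Hg k; have Hd := hilbB Hk Hx.
  have : phi x - (2 * (N x + `|c|)) * N (g k - x) <= phi (g k).
    have -> : phi (g k) = phi (x + (g k - x)) by rewrite addrC subrK.
    rewrite /phi (lD _ _ Hx Hd) (hnorm_sqrD Hx Hd).
    have := rip_CS Hx Hd; have := lB _ Hd; have := sqr_ge0 (N (g k - x)).
    have := ler_wpM2r (hnorm_ge0 (g k - x)) (ler_norm c).
    rewrite !ler_norml !mulr2n => h1 h2 /andP[_ h3] /andP[h4 _]; lra.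
  have : (2 * (N x + `|c|)) * N (g k - x) <= e / 2.
    have : B * N (g k - x) <= e / 2 by rewrite mulrC -ler_pdivlMr// ltW.
    apply: le_trans; rewrite ler_wpM2r ?hnorm_ge0// /B; lra.
  move: (k.+1%:R^-1) (2 * _ * _) pk gk2 => a b pk gk2 be ?.
  have : phi x <= mu + (e / 2 + e / 2) by lra.
  by rewrite -splitr.
exists x => // u Hu.
(* the energy at [x + t z] is minimal at [t = 0] *)
have key z : H z -> rip x z = l z.
  move=> Hz; apply/eqP; rewrite -subr_eq0; set d := _ - _.
  have h (t : R) : 0 <= t * d *+ 2 + t ^+ 2 * N z ^+ 2.
    have Htz : H ((t%:C)%C *: z) by exact: hilbZ.
    have := phi_mu _ (hilbD Hx Htz); rewrite -phix /phi lD// lZ// hnorm_sqrD// ripZ// hnormZ//.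
    by rewrite exprMn cabs_real real_normK ?num_real// /d !mulr2n; lra.
  apply/eqP; apply: contrapT => /eqP d0.
  have := h (- d / (N z ^+ 2 + 1)).
  have z1 : 0 < N z ^+ 2 + 1 by rewrite ltr_wpDl ?sqr_ge0.
  apply/negP; rewrite -ltNge.
  rewrite (_ : _ + _ = - (d ^+ 2 * (N z ^+ 2 + 2)) / (N z ^+ 2 + 1) ^+ 2); last first.
    by rewrite mulr2n; field; rewrite gt_eqF.
  rewrite pmulr_llt0 ?invr_gt0 ?exprn_gt0// oppr_lt0 mulr_gt0// ?exprn_even_gt0//.
  by rewrite ltr_wpDl ?sqr_ge0.
(* the imaginary parts are the real parts at [i u] *)
have Hiu : H ('i%C *: u) by exact: hilbZ.
apply/eqP; rewrite eq_complex; apply/andP; split; apply/eqP.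
  exact: key.
have := key _ Hiu; rewrite /l -[in L _](addr0 ('i%C *: u)) Llin// L0 addr0 ipZr//.
by case: (ip x u) (L u) => [a b] [a' b'] /=; rewrite !mul0r !mulN1r !sub0r !opprK.
Qed.

End HilbertTheory.

(** * Calculus for functions with values in a Hilbert space *)

Section RealMeanValue.
Context {R : realType}.

(** Stated without ordering the end points, since increments of either sign
    occur. *)
Lemma mean_value (f f' : R -> R) (a b : R) :
  (forall x, is_derive x (1 : R) f (f' x)) ->
  exists2 c, `|c - a| <= `|b - a| & f b - f a = f' c * (b - a).
Proof.
move=> df.
have cf x y : {within `[x, y], continuous f}.
  apply: derivable_within_continuous => z _.
  by have := df z => -[].
have [ab|/ltW ba] := leP a b.
  have [c /[!in_itv]/= /andP[ac cb] ->] := MVT_segment ab (fun x _ => df x) (cf a b).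
  exists c => //; rewrite !ger0_norm ?subr_ge0//; lra.
have [c /[!in_itv]/= /andP[ac cb] h] := MVT_segment ba (fun x _ => df x) (cf b a).
exists c; last by rewrite -opprB h; ring.
by rewrite !ler0_norm ?subr_le0//; lra.
Qed.

End RealMeanValue.

Section VectorCalculus.
Context {R : realType} {E : lmodType R[i]}.
Local Notation C := R[i].
Context {H : set E} {ip : E -> E -> C} (hH : hilbert H ip) {p : nat}.
Local Notation N := (hnorm ip).
Local Notation heq := (heq (ip := ip)).
Implicit Types (f g : 'rV[R]_p -> E) (y eta : 'rV[R]_p) (l : seq 'I_p).

Local Notation De i := (delta_mx 0 i : 'rV[R]_p).
Local Notation quot f y i h := (((h^-1)%:C)%C *: (f (y + h *: De i) - f y)).

Lemma hilb_quot f y i h : (forall y, H (f y)) -> H (quot f y i h).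
Proof. by move=> Hf; apply: (hilbZ hH); exact: (hilbB hH). Qed.

Lemma cvg0_le (F G1 G2 : R -> R) (c1 c2 : R) :
  (forall h, 0 <= F h <= c1 * G1 h + c2 * G2 h) ->
  G1 @ 0^' --> (0 : R) -> G2 @ 0^' --> (0 : R) -> F @ 0^' --> (0 : R).
Proof.
move=> FG G10 G20; apply/cvgr0Pnorm_lt => e e0.
have e1 : 0 < e / 2 / (`|c1| + 1) by rewrite !divr_gt0// ltr_wpDl.
have e2 : 0 < e / 2 / (`|c2| + 1) by rewrite !divr_gt0// ltr_wpDl.
have h1 : \forall h \near 0^', `|G1 h| < e / 2 / (`|c1| + 1) by move/cvgr0_norm_lt : G10; apply.
have h2 : \forall h \near 0^', `|G2 h| < e / 2 / (`|c2| + 1) by move/cvgr0_norm_lt : G20; apply.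
near=> h.
have /andP[F0 Fle] := FG h; rewrite ger0_norm// (le_lt_trans Fle)//.
have k1 : `|G1 h| < e / 2 / (`|c1| + 1) by near: h.
have k2 : `|G2 h| < e / 2 / (`|c2| + 1) by near: h.
have aux (c x : R) : `|x| < e / 2 / (`|c| + 1) -> c * x < e / 2.
  move=> hx; rewrite (le_lt_trans (ler_norm _))// normrM.
  have [->|c0] := eqVneq c 0; first by rewrite normr0 mul0r divr_gt0.
  have : (`|c| + 1) * `|x| < e / 2 by rewrite mulrC -ltr_pdivlMr// ltr_wpDl.
  by apply: le_lt_trans; rewrite ler_wpM2r// lerDl.
by rewrite [e in ltRHS]splitr ltrD// aux.
Unshelve. all: by end_near. Qed.

Lemma cvg0_cst (c : R) : (fun _ : R => c) @ 0^' --> (0 : R) -> c = 0.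
Proof. by move=> h; apply: cvg_unique h => //; exact: cvg_cst. Qed.

Lemma is_vderiv_heq f g y i u v :
  (forall y, H (f y)) -> (forall y, H (g y)) -> (forall y, heq (f y) (g y)) ->
  H v -> heq u v -> is_vderiv H ip i f y u -> is_vderiv H ip i g y v.
Proof.
move=> Hf Hg fg Hv uv [Hu cf]; split => //.
apply: (cvg0_le (c1 := 1) (c2 := 0) _ cf cf) => h; rewrite hnorm_ge0 mul1r mul0r addr0/=.
rewrite (heq_norm hH (v := quot f y i h - u))//.
- by apply: (hilbB hH) => //; exact: hilb_quot.
- by apply: (hilbB hH) => //; exact: hilb_quot.
apply: (heqB hH) => //; try exact: hilb_quot; last exact: (heq_sym hH).
apply: (heqZ hH); try exact: (hilbB hH).
by apply: (heqB hH) => //; exact: (heq_sym hH).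
Qed.

Lemma is_vderiv_uniq f y i u v : (forall y, H (f y)) ->
  is_vderiv H ip i f y u -> is_vderiv H ip i f y v -> heq u v.
Proof.
move=> Hf [Hu cu] [Hv cv].
apply: cvg0_cst; apply: (cvg0_le (c1 := 1) (c2 := 1) _ cu cv) => h.
have Hq := hilb_quot y i h Hf.
rewrite hnorm_ge0 !mul1r/= -(hnormBC hH Hu Hq).
exact: (hnormB_le hH).
Qed.

Lemma is_vderivL (a : C) f g y i u v :
  (forall y, H (f y)) -> (forall y, H (g y)) ->
  is_vderiv H ip i f y u -> is_vderiv H ip i g y v ->
  is_vderiv H ip i (fun y => a *: f y + g y) y (a *: u + v).
Proof.
move=> Hf Hg [Hu cu] [Hv cv]; split; first exact: (hilbL hH).
apply: (cvg0_le (c1 := cabs a) (c2 := 1) _ cu cv) => h; rewrite hnorm_ge0 mul1r/=.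
have Hq := hilb_quot y i h Hf; have Hr := hilb_quot y i h Hg.
rewrite (_ : _ - _ = a *: (quot f y i h - u) + (quot g y i h - v)).
  rewrite -(hnormZ hH); last exact: (hilbB hH).
  exact: (hnormD hH (hilbZ hH a (hilbB hH Hq Hu)) (hilbB hH Hr Hv)).
rewrite [a *: (_ - u)]scalerBr scalerA mulrC -scalerA addrACA -opprD; congr (_ - _).
by rewrite -scalerDr; congr (_ *: _); rewrite [a *: (_ - _)]scalerBr opprD addrACA.
Qed.

(** Real parts of pairings with a fixed vector reduce the vector calculus to the
    mean value theorem for real functions. *)
Lemma is_derive_rip f y i u z : (forall y, H (f y)) -> H z ->
  is_vderiv H ip i f y u ->
  is_derive (0 : R) (1 : R) (fun t : R => complex.Re (ip (f (y + t *: De i)) z))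
    (complex.Re (ip u z)).
Proof.
move=> Hf Hz [Hu cu].
set psi := fun t : R => _.
suff c : (fun h : R => h^-1 *: ((psi \o shift 0) (h *: (1 : R)) - psi 0)) @ 0^' --> complex.Re (ip u z).
  by apply: DeriveDef; [exact: cvgP c|exact: cvg_lim c].
apply/subr_cvg0.
apply/norm_cvg0P.
apply: (cvg0_le (c1 := N z) (c2 := 0) _ cu cu) => h.
rewrite normr_ge0 mul0r addr0/=.
have Hq := hilb_quot y i h Hf.
rewrite mulrC; apply: le_trans (rip_CS hH _ Hz); last exact: (hilbB hH).
rewrite (ipBl hH)// (ipZl hH)//; last exact: (hilbB hH).
rewrite (ipBl hH)// /psi /= addr0 scale0r addr0 /GRing.scale /= mulr1.
by case: (ip _ _) (ip _ _) (ip _ _) => [? ?] [? ?] [? ?] /=; rewrite mul0r subr0.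
Qed.

Lemma is_derive_rip_line f f' y i z : (forall y, H (f y)) -> H z ->
  (forall y, is_vderiv H ip i f y (f' y)) ->
  forall t : R, is_derive t (1 : R) (fun t : R => complex.Re (ip (f (y + t *: De i)) z))
    (complex.Re (ip (f' (y + t *: De i)) z)).
Proof.
move=> Hf Hz df t.
have := is_derive_rip Hf Hz (df (y + t *: De i)).
set F := fun s => _; set G := fun s => _ => h.
have -> : G = F \o (fun s => s - t).
  apply/funext => s; rewrite /F /G /= -addrA -scalerDl; congr (complex.Re (ip (f (_ + _ *: _)) z)).
  by rewrite addrC subrK.
have h' : is_derive (t - t) (1 : R) F (complex.Re (ip (f' (y + t *: De i)) z)).
  by rewrite subrr.
have := @is_derive1_comp _ F (fun s => s - t) t _ 1 h'.
rewrite mulr1; apply.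
by rewrite -[X in is_derive _ _ _ X]subr0; apply: is_deriveB.
Qed.

(** Test against an arbitrary vector [z] and use the real mean value theorem; the
    intermediate point depends on [z], the bound does not. *)
Lemma vector_mean_value f f' y i (c : E) (K h : R) :
  (forall y, H (f y)) -> (forall y, is_vderiv H ip i f y (f' y)) -> H c -> 0 <= K ->
  (forall t, `|t| <= `|h| -> N (f' (y + t *: De i) - c) <= K) ->
  N (f (y + h *: De i) - f y - (h%:C)%C *: c) <= K * `|h|.
Proof.
move=> Hf df Hc K0 fK.
have Hd : H (f (y + h *: De i) - f y) by exact: (hilbB hH).
have Hf' y' : H (f' y') by case: (df y').
have Hhc : H ((h%:C)%C *: c) by exact: (hilbZ hH).
apply: (hnorm_le_rip hH); [exact: (hilbB hH)|by rewrite mulr_ge0|move=> z Hz].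
have [s hs] := mean_value 0 h (is_derive_rip_line y Hf Hz df).
rewrite !subr0 scale0r addr0 in hs *.
rewrite !(ipBl hH)// (ipZl hH)// => e.
have -> : complex.Re (ip (f (y + h *: De i)) z - ip (f y) z - (h%:C)%C * ip c z) =
    h * complex.Re (ip (f' (y + s *: De i) - c) z).
  rewrite (ipBl hH)//; move: e.
  by case: (ip _ _) (ip _ _) (ip _ _) (ip _ _) => [? ?] [? ?] [? ?] [? ?] /= e; lra.
have Hs : H (f' (y + s *: De i) - c) by exact: (hilbB hH).
rewrite (le_trans (ler_norm _))// normrM mulrC -mulrA [`|h| * _]mulrC mulrA ler_wpM2r//.
rewrite (le_trans (rip_CS hH Hs Hz))// ler_wpM2r ?hnorm_ge0//.
exact: fK.
Qed.

End VectorCalculus.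

(** * Schwartz functions with values in a Hilbert space *)

Section SchwartzFunctions.
Context {R : realType} {E : lmodType R[i]}.
Local Notation C := R[i].
Context {H : set E} {ip : E -> E -> C} (hH : hilbert H ip) {p : nat}.
Local Notation N := (hnorm ip).
Local Notation heq := (heq (ip := ip)).
Implicit Types (f g : 'rV[R]_p -> E) (y eta : 'rV[R]_p) (l : seq 'I_p).

Local Notation De i := (delta_mx 0 i : 'rV[R]_p).

(** The derivatives [vpd] are chosen representatives. To compute with them, one
    guesses the family of all iterated derivatives and uses uniqueness up to
    null elements at each step. *)
Lemma vpd_family (F : seq 'I_p -> 'rV[R]_p -> E) :
  (forall l y, H (F l y)) ->
  (forall l y i, is_vderiv H ip i (F l) y (F (i :: l) y)) ->
  forall l, (forall y, H (vpd H ip l (F [::]) y) /\ heq (vpd H ip l (F [::]) y) (F l y)) /\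
    (forall y i, is_vderiv H ip i (vpd H ip l (F [::])) y (F (i :: l) y)).
Proof.
move=> HF dF.
have step l : (forall y, H (vpd H ip l (F [::]) y) /\ heq (vpd H ip l (F [::]) y) (F l y)) ->
    forall y i, is_vderiv H ip i (vpd H ip l (F [::])) y (F (i :: l) y).
  move=> hl y i; apply: (is_vderiv_heq hH (f := F l) (u := F (i :: l) y)) => //.
  - by move=> z; case: (hl z).
  - by move=> z; have [? ?] := hl z; apply: (heq_sym hH).
  - exact: (heq_refl hH).
elim=> [|i l [IH1 IH2]].
  have h y : H (vpd H ip [::] (F [::]) y) /\ heq (vpd H ip [::] (F [::]) y) (F [::] y).
    by split; [exact: HF|exact: (heq_refl hH)].
  by split => //; exact: step.
have h y : H (vpd H ip (i :: l) (F [::]) y) /\ heq (vpd H ip (i :: l) (F [::]) y) (F (i :: l) y).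
  have /(xgetPex 0) : exists g : E, is_vderiv H ip i (vpd H ip l (F [::])) y g.
    by exists (F (i :: l) y); exact: IH2.
  rewrite -/(vderiv H ip i (vpd H ip l (F [::])) y) => d; split; first by case: d.
  by apply: (is_vderiv_uniq hH _ d (IH2 y i)) => z; case: (IH1 z).
by split => //; exact: step.
Qed.

Lemma schwartz_family (F : seq 'I_p -> 'rV[R]_p -> E) :
  (forall l y, H (F l y)) ->
  (forall l y i, is_vderiv H ip i (F l) y (F (i :: l) y)) ->
  (forall l k, exists M : R, forall y, jap y ^+ k * N (F l y) <= M) ->
  schwartz H ip (F [::]).
Proof.
move=> HF dF bF; split=> [y|l]; first exact: HF.
have [h1 h2] := vpd_family HF dF l; split=> [y i|k].
  by exists (F (i :: l) y); exact: h2.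
have [M hM] := bF l k; exists M => y; have [Hy hy] := h1 y.
by rewrite (heq_norm hH Hy _ hy).
Qed.

Lemma schwartz_vpd f : schwartz H ip f -> forall l y,
  H (vpd H ip l f y) /\
  forall i, is_vderiv H ip i (vpd H ip l f) y (vpd H ip (i :: l) f y).
Proof.
move=> [Hf Sf]; have d l y i : is_vderiv H ip i (vpd H ip l f) y (vpd H ip (i :: l) f y).
  by have [/(_ y i) /(xgetPex 0)] := Sf l.
by move=> [|i l] y; split => //; case: (d l y i).
Qed.

Lemma schwartz_bound f : schwartz H ip f -> forall l k,
  exists2 M : R, 0 <= M & forall y, N (vpd H ip l f y) <= M * (jap y)^-1 ^+ k.
Proof.
move=> [_ Sf] l k; have [_ /(_ k)[M hM]] := Sf l.
exists M; first by rewrite (le_trans _ (hM 0))// mulr_ge0 ?hnorm_ge0// exprn_ge0// ltW// jap_gt0.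
by move=> y; rewrite exprVn ler_pdivlMr ?exprn_gt0 ?jap_gt0// mulrC.
Qed.

Lemma schwartz_of_vpd f l : schwartz H ip f -> schwartz H ip (vpd H ip l f).
Proof.
move=> Sf; apply: (schwartz_family (F := fun l' => vpd H ip (l' ++ l) f)).
- by move=> l' y; case: (schwartz_vpd Sf (l' ++ l) y).
- by move=> l' y i; case: (schwartz_vpd Sf (l' ++ l) y).
- by move=> l' k; case: Sf => _ /(_ (l' ++ l))[_ /(_ k)].
Qed.

Lemma schwartzZ (a : C) f : schwartz H ip f -> schwartz H ip (fun y => a *: f y).
Proof.
move=> Sf; pose F l y := a *: vpd H ip l f y.
apply: (schwartz_family (F := F)).
- by move=> l y; apply: (hilbZ hH); case: (schwartz_vpd Sf l y).
- move=> l y i; rewrite /F.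
  (* [is_vderivL] has coefficient one on the second function *)
  rewrite (_ : (fun y => _) = fun y => (a - 1) *: vpd H ip l f y + vpd H ip l f y); last first.
    by apply/funext => z; rewrite scalerBl scale1r subrK.
  rewrite (_ : a *: _ = (a - 1) *: vpd H ip (i :: l) f y + vpd H ip (i :: l) f y); last first.
    by rewrite scalerBl scale1r subrK.
  by apply: (is_vderivL hH) => //; first [by move=> z; case: (schwartz_vpd Sf l z)|by case: (schwartz_vpd Sf l y)].
- move=> l k; have [_ /(_ l)[_ /(_ k)[M hM]]] := Sf.
  exists (cabs a * M) => y; rewrite (hnormZ hH); last by case: (schwartz_vpd Sf l y).
  by rewrite mulrCA ler_wpM2l// cabs_ge0.
Qed.

Lemma row_entry_le (m : nat) (y : 'rV[R]_m) i : `|y 0 i| <= `|y|.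
Proof. by rewrite [leRHS]/Num.norm/= mx_normrE (le_bigmax _ _ (0, i)). Qed.

(** Pass from [y'] to [y] by changing one coordinate at a time. *)
Lemma vector_lipschitz f (f' : 'I_p -> 'rV[R]_p -> E) (M : R) :
  (forall y, H (f y)) -> (forall i y, is_vderiv H ip i f y (f' i y)) ->
  (forall i y, N (f' i y) <= M) -> 0 <= M ->
  forall y y', N (f y - f y') <= p%:R * M * `|y - y'|.
Proof.
move=> Hf df bf M0 y y'.
pose mix k : 'rV[R]_p := \row_j if (j < k)%N then y 0 j else y' 0 j.
have mixS k (kp : (k < p)%N) :
    mix k.+1 = mix k + (y 0 (Ordinal kp) - y' 0 (Ordinal kp)) *: De (Ordinal kp).
  apply/rowP => j; rewrite !mxE eqxx /= ltnS leq_eqVlt.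
  have [jk|jk] := eqVneq (j : nat) k.
    have -> : j = Ordinal kp by exact/val_inj.
    by rewrite eqxx /= ltnn mulr1 addrC subrK.
  have -> : (j == Ordinal kp) = false by apply/negbTE; apply: contra jk => /eqP ->.
  by rewrite mulr0 addr0.
have h k : (k <= p)%N -> N (f (mix k) - f (mix 0)) <= k%:R * M * `|y - y'|.
  elim: k => [_|k IH kp]; first by rewrite subrr (hnorm0 hH) !mul0r.
  rewrite (le_trans (hnormB_le hH (v := f (mix k)) _ _ _))//.
  rewrite -natr1 !mulrDl addrC lerD ?IH ?(ltnW kp)// mul1r mixS.
  set h := y 0 _ - _.
  have := vector_mean_value hH (y := mix k) (h := h) (c := 0) Hf (df (Ordinal kp)) (hilb0 hH) M0.
  rewrite scaler0 subr0 => /(_ _)/le_trans; apply.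
    by move=> t _; rewrite subr0.
  rewrite ler_wpM2l// (le_trans _ (row_entry_le (y - y') (Ordinal kp)))//.
  by rewrite !mxE.
have -> : y = mix p by apply/rowP => j; rewrite mxE ltn_ord.
have -> : f y' = f (mix 0) by congr f; apply/rowP => j; rewrite mxE.
rewrite (le_trans (h p (leqnn p)))// ler_wpM2l ?mulr_ge0//.
rewrite le_eqVlt; apply/orP; left; apply/eqP; congr (`| _ - _|).
by apply/rowP => j; rewrite mxE ltn_ord.
Qed.

(** All that the Fourier integral needs of a function. Unlike [schwartz], these
    properties pass to sums without identifying the derivatives of a sum. The
    extra factor [jap y] in the decay bounds the first moment. *)
Record tame f : Prop := Tame {
  tame_mem : forall y, H (f y);
  tame_decay : exists2 M : R, 0 <= M &
    forall y, jap y * N (f y) <= M * (jap y)^-1 ^+ (2 * p);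
  tame_lip : exists2 L : R, 0 <= L & forall y y', N (f y - f y') <= L * `|y - y'|
}.

Lemma schwartz_tame f : schwartz H ip f -> tame f.
Proof.
move=> Sf; split.
- by case: Sf.
- have [M M0 hM] := schwartz_bound Sf [::] (2 * p).+1; exists M => // y.
  rewrite (le_trans (ler_wpM2l (ltW (jap_gt0 y)) (hM y)))//.
  by rewrite exprS mulrCA mulVKf// gt_eqF// jap_gt0.
- have /choice[M hM] : forall i : 'I_p, exists M : R, 0 <= M /\ forall y, N (vpd H ip [:: i] f y) <= M.
    move=> i; have [M M0 hM] := schwartz_bound Sf [:: i] 0.
    by exists M; split => // y; rewrite (le_trans (hM y))// expr0 mulr1.
  have M0 : 0 <= \sum_i M i by apply: sumr_ge0 => i _; case: (hM i).
  exists (p%:R * \sum_i M i); first by rewrite mulr_ge0.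
  apply: (vector_lipschitz (f' := fun i => vpd H ip [:: i] f)) => //.
  + by case: Sf.
  + by move=> i y; case: (schwartz_vpd Sf [::] y).
  + move=> i y; case: (hM i) => _ /(_ y)/le_trans; apply.
    rewrite (bigD1 i)//= lerDl; apply: sumr_ge0 => j _; by case: (hM j).
Qed.

End SchwartzFunctions.

Arguments tame {R E} H ip {p}.

(** * The vector-valued Fourier transform *)

Section FourierTransform.
Context {R : realType} {E : lmodType R[i]}.
Local Notation C := R[i].
Context {H : set E} {ip : E -> E -> C} (hH : hilbert H ip) {p : nat}.
Local Notation N := (hnorm ip).
Local Notation heq := (heq (ip := ip)).
Implicit Types (f g : 'rV[R]_p -> E) (y eta : 'rV[R]_p) (l : seq 'I_p).

Local Notation De i := (delta_mx 0 i : 'rV[R]_p).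

Lemma cabsM (a b : C) : cabs (a * b) = cabs a * cabs b.
Proof.
rewrite /cabs -sqrtrM ?addr_ge0 ?sqr_ge0//; congr Num.sqrt.
by case: a b => [? ?] [? ?]; rewrite /cabs2 /=; ring.
Qed.

Lemma cabs_cis (x : R) : cabs (cis x) = 1.
Proof. by rewrite /cabs /cabs2 /= cos2Dsin2 sqrtr1. Qed.

Lemma cisD (x y : R) : cis (x + y) = cis x * cis y.
Proof. by rewrite /cis cosD sinD; apply/eqP; rewrite eq_complex /=; apply/andP; split; apply/eqP; ring. Qed.

Lemma dotpDl (x y z : 'rV[R]_p) : dotp (x + y) z = dotp x z + dotp y z.
Proof. by rewrite /dotp -big_split /=; apply: eq_bigr => i _; rewrite mxE mulrDl. Qed.

Lemma dotpBr (x y z : 'rV[R]_p) : dotp x (y - z) = dotp x y - dotp x z.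
Proof.
rewrite /dotp -sumrN -big_split /=; apply: eq_bigr => i _.
by rewrite !mxE mulrBr.
Qed.

Lemma dotpBN (x y z : 'rV[R]_p) : - (dotp x y - dotp x z) = dotp x (z - y).
Proof. by rewrite dotpBr opprB. Qed.

Lemma dotp_De i eta (h : R) : dotp (h *: De i) eta = h * eta 0 i.
Proof.
rewrite /dotp (bigD1 i)//= big1 ?addr0 => [|j ji]; first by rewrite !mxE !eqxx mulr1.
by rewrite !mxE (negbTE ji) andbF mulr0 mul0r.
Qed.

Lemma lipschitz_continuous (m : nat) (F : 'rV[R]_m -> R) (L : R) :
  (forall y y' : 'rV[R]_m, `|F y - F y'| <= L * `|y - y'|) -> continuous F.
Proof.
move=> FL y; apply/(@cvgrPdist_lt _ _ _ (nbhs y) (nbhs_filter y)) => e e0.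
have L0 : 0 < `|L| + 1 by rewrite ltr_wpDl.
apply/nbhs_ballP; exists ((`|L| + 1)^-1 * e) => /=; first by rewrite mulr_gt0 ?invr_gt0.
move=> z; rewrite -ball_normE /= => yz.
rewrite (le_lt_trans (FL _ _))// (le_lt_trans (y := (`|L| + 1) * `|y - z|))//.
  by rewrite ler_wpM2r// (le_trans (ler_norm _))// lerDl.
by rewrite -ltr_pdivlMl.
Qed.

Lemma borel_cis_dotp eta : cborel_rV (fun y => cis (- dotp y eta)).
Proof.
have c : continuous (fun y : 'rV[R]_p => - dotp y eta).
  have c : continuous (fun y : 'rV[R]_p => dotp y eta).
    apply: continuous_big => [q|i _ x]; first exact: add_continuous.
    by apply: continuousM; [exact: coord_continuous|exact: cst_continuous].
  by move=> y; apply: (continuous_comp (c y)); exact: oppr_continuous.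
by split; apply: borel_continuous => y; apply: continuous_comp;
  [exact: c|exact: continuous_cos|exact: c|exact: continuous_sin].
Qed.

Lemma cborelM (m : nat) (F G : 'rV[R]_m -> C) :
  cborel_rV F -> cborel_rV G -> cborel_rV (fun y : 'rV[R]_m => F y * G y).
Proof.
move=> [F1 F2] [G1 G2]; split.
  rewrite (_ : (fun _ => _) = fun y : 'rV[R]_m => complex.Re (F y) * complex.Re (G y) +
    - (complex.Im (F y) * complex.Im (G y))).
    by apply: borel_rVD; [|apply: borel_rVN]; exact: borel_rVM.
  by apply/funext => y; case: (F y) (G y) => [? ?] [].
rewrite (_ : (fun _ => _) = fun y : 'rV[R]_m => complex.Re (F y) * complex.Im (G y) +
    complex.Im (F y) * complex.Re (G y)).
  by apply: borel_rVD; exact: borel_rVM.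
by apply/funext => y; case: (F y) (G y) => [? ?] [].
Qed.

Lemma cborel_ip f z : tame H ip f -> H z -> cborel_rV (fun y => ip (f y) z).
Proof.
move=> [Hf _ [L L0 fL]] Hz.
have h y y' : cabs (ip (f y) z - ip (f y') z) <= 2 * L * N z * `|y - y'|.
  rewrite -(ipBl hH)// (le_trans (cabs_ip hH _ _))//; first exact: (hilbB hH).
  by rewrite -!mulrA ler_wpM2l// [N z * _]mulrC mulrA ler_wpM2r ?hnorm_ge0.
by split; apply: borel_continuous; apply: lipschitz_continuous => y y';
  apply: le_trans (h y y'); [apply: le_trans (le_Re_cabs _)|apply: le_trans (le_Im_cabs _)];
  case: (ip _ _) (ip _ _) => [? ?] [].
Qed.

Lemma tame_decay0 f : tame H ip f -> exists2 M : R, 0 <= M &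
    forall y, N (f y) <= M * (jap y)^-1 ^+ (2 * p).
Proof.
move=> [_ [M M0 hM] _]; exists M => // y; rewrite (le_trans _ (hM y))//.
by rewrite ler_peMl ?hnorm_ge0// jap_ge1.
Qed.

Lemma cL1_fourier f eta z : tame H ip f -> H z ->
  cL1 (fun y => cis (- dotp y eta) * ip (f y) z).
Proof.
move=> tf Hz; have [M M0 hM] := tame_decay0 tf.
apply: (cL1_dom (g := fun y => (2 * M * N z) * (jap y)^-1 ^+ (2 * p))).
- by apply: cborelM; [exact: borel_cis_dotp|exact: cborel_ip].
- exact: L1_japV.
move=> y; rewrite cabsM cabs_cis mul1r (le_trans (cabs_ip hH _ _))//.
  exact: (tame_mem tf).
by rewrite -!mulrA ler_wpM2l// [N z * _]mulrC mulrA ler_wpM2r ?hnorm_ge0.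
Qed.

Let Ip : R := rint (fun y : 'rV[R]_p => (jap y)^-1 ^+ (2 * p)).

Let L1_weight (c : R) : L1 (fun y : 'rV[R]_p => c * (jap y)^-1 ^+ (2 * p)).
Proof. exact: L1_japV. Qed.

Let L1_weight1 : L1 (fun y : 'rV[R]_p => (jap y)^-1 ^+ (2 * p)).
Proof. by have := L1_weight 1; congr L1; apply/funext => y; rewrite mul1r. Qed.

Lemma cabs_cint_weight (F : 'rV[R]_p -> C) (c : R) : cL1 F ->
  (forall y, cabs (F y) <= c * (jap y)^-1 ^+ (2 * p)) -> cabs (cint F) <= 2 * Ip * c.
Proof.
move=> LF FM; rewrite (le_trans (cabs_cint LF (L1_weight c) FM))//.
by rewrite rintZ -?mulrA 1?[c * _]mulrC.
Qed.

(** The weak integral exists by the Riesz theorem: the decay of [f] makes the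
    antilinear functional [z |-> int e^(-i y eta) <f y, z> dy] bounded. *)
Lemma vfourierP f eta : tame H ip f -> is_vfourier H ip f eta (vfourier H ip f eta).
Proof.
move=> tf; have Hf := tame_mem tf; have [M M0 hM] := tame_decay0 tf.
apply: (xgetPex 0).
have [||g Hg gE] := riesz hH (L := fun z => cint (fun y => cis (- dotp y eta) * ip (f y) z))
   (c := 2 * Ip * (2 * M)).
- move=> a u v Hu Hv.
  rewrite -cint_lin; [|exact: cL1_fourier|exact: cL1_fourier].
  congr cint; apply/funext => y.
  rewrite (ipDr hH)//; last exact: (hilbZ hH).
  by rewrite (ipZr hH)// mulrDr mulrCA.
- move=> u Hu; rewrite -mulrA; apply: cabs_cint_weight; first exact: cL1_fourier.
  move=> y; rewrite cabsM cabs_cis mul1r (le_trans (cabs_ip hH _ _))//.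
  by rewrite -!mulrA ler_wpM2l// [N u * _]mulrC mulrA ler_wpM2r ?hnorm_ge0.
by exists g.
Qed.

Lemma vfourier_mem f eta : tame H ip f -> H (vfourier H ip f eta).
Proof. by move=> /(vfourierP eta)[]. Qed.

Lemma vfourierE f eta z : tame H ip f -> H z ->
  ip (vfourier H ip f eta) z = cint (fun y => cis (- dotp y eta) * ip (f y) z).
Proof. by move=> /(vfourierP eta)[_]; exact. Qed.

Lemma vfourier_uniq f eta (u : E) : tame H ip f -> H u ->
  (forall z, H z -> ip u z = cint (fun y => cis (- dotp y eta) * ip (f y) z)) ->
  heq (vfourier H ip f eta) u.
Proof.
by move=> tf Hu uE; apply: (heqP hH) => //; [exact: vfourier_mem|move=> z Hz; rewrite vfourierE// uE].
Qed.

Lemma tame_lin (a : C) f g : tame H ip f -> tame H ip g ->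
  tame H ip (fun y => a *: f y + g y).
Proof.
move=> [Hf [M M0 hM] [L L0 hL]] [Hg [M' M'0 hM'] [L' L'0 hL']]; split.
- by move=> y; exact: (hilbL hH).
- exists (cabs a * M + M') => [|y]; first by rewrite addr_ge0// mulr_ge0// cabs_ge0.
  rewrite (le_trans (ler_wpM2l _ (hnormD hH _ _)))//; [exact/ltW/jap_gt0|exact: (hilbZ hH)|].
  by rewrite mulrDr mulrDl lerD// (hnormZ hH)// mulrCA -mulrA ler_wpM2l// cabs_ge0.
- exists (cabs a * L + L') => [|y y']; first by rewrite addr_ge0// mulr_ge0// cabs_ge0.
  rewrite opprD addrACA -scalerBr (le_trans (hnormD hH _ _))//.
  + by apply: (hilbZ hH); exact: (hilbB hH).
  + exact: (hilbB hH).
  by rewrite mulrDl lerD// (hnormZ hH) -?mulrA ?ler_wpM2l ?cabs_ge0//; exact: (hilbB hH).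
Qed.

Lemma vfourier_lin (a : C) f g eta : tame H ip f -> tame H ip g ->
  heq (vfourier H ip (fun y => a *: f y + g y) eta)
      (a *: vfourier H ip f eta + vfourier H ip g eta).
Proof.
move=> tf tg; have Hf := tame_mem tf; have Hg := tame_mem tg.
apply: vfourier_uniq; first exact: tame_lin.
  by apply: (hilbL hH); exact: vfourier_mem.
move=> z Hz; rewrite (ipDl hH) ?(ipZl hH) ?vfourierE//; try exact: vfourier_mem; last first.
  by apply: (hilbZ hH); exact: vfourier_mem.
rewrite -cint_lin; [|exact: cL1_fourier|exact: cL1_fourier].
congr cint; apply/funext => y; rewrite (ipDl hH) ?(ipZl hH)//; last exact: (hilbZ hH).
by rewrite mulrDr mulrCA.
Qed.

Lemma cis_lipschitz (a b : R) : cabs (cis a - cis b) <= 2 * `|a - b|.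
Proof.
have h (F F' : R -> R) : (forall x, is_derive x (1 : R) F (F' x)) ->
    (forall x, `|F' x| <= 1) -> `|F a - F b| <= `|a - b|.
  move=> dF bF; have [c _ ->] := mean_value b a dF.
  by rewrite normrM ler_piMl.
rewrite (le_trans (cabs_le_ReIm _))//= mulr2n mulrDl mul1r lerD//.
  by apply: (h _ (fun x => - sin x)) => x; rewrite normrN ler_norml sin_geN1 sin_le1.
by apply: (h _ cos) => x; rewrite ler_norml cos_geN1 cos_le1.
Qed.

Lemma dotp_le (y z : 'rV[R]_p) : `|dotp y z| <= p%:R * jap y * `|z|.
Proof.
rewrite /dotp (le_trans (ler_norm_sum _ _ _))//.
apply: (le_trans (y := \sum_(i < p) jap y * `|z|)); last first.
  by rewrite sumr_const card_ord -mulrA mulr_natl.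
apply: ler_sum => i _; rewrite normrM ler_pM ?row_entry_le//.
rewrite -sqrtr_sqr ler_wsqrtr// (le_trans (y := dotp y y)) ?lerDr//.
rewrite /dotp (bigD1 i)//= -expr2 lerDl; apply: sumr_ge0 => j _.
by rewrite -expr2 sqr_ge0.
Qed.

(** The first moment of [f] is finite and characters are Lipschitz. This
    regularity is used to show that the norms are integrals of Borel
    functions. *)
Lemma vfourier_lip f : tame H ip f -> exists L : R, forall eta eta',
  N (vfourier H ip f eta - vfourier H ip f eta') <= L * `|eta - eta'|.
Proof.
move=> tf; have Hf := tame_mem tf; have [_ [M M0 hM] _] := tf.
have Ip0 : 0 <= Ip.
  have := rint_le (L1Z 0 L1_weight1) L1_weight1; rewrite rintZ// mul0r; apply.
  by move=> y; rewrite mul0r exprn_ge0// invr_ge0 ltW// jap_gt0.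
exists (2 * Ip * (4 * p%:R * M)) => eta eta'.
apply: (hnorm_le_rip hH).
- by apply: (hilbB hH); exact: vfourier_mem.
- by rewrite !mulr_ge0.
move=> z Hz; rewrite (ipBl hH) ?vfourierE//; try exact: vfourier_mem.
rewrite -mulN1r addrC -cint_lin; [|exact: cL1_fourier|exact: cL1_fourier].
rewrite (le_trans (ler_norm _))// (le_trans (le_Re_cabs _))//.
have -> : 2 * Ip * (4 * p%:R * M) * `|eta - eta'| * N z =
          2 * Ip * (4 * p%:R * M * `|eta - eta'| * N z) by rewrite !mulrA.
apply: cabs_cint_weight.
  by apply: cL1_lin; exact: cL1_fourier.
move=> y; rewrite mulN1r addrC -mulrBl cabsM.
rewrite (le_trans (ler_pM _ _ (cis_lipschitz _ _) (cabs_ip hH (Hf y) Hz))) ?cabs_ge0//.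
rewrite opprK addrC -dotpBr -normrN -dotpBN.
apply: (le_trans (y := 4 * (p%:R * `|eta - eta'| * N z) * (jap y * N (f y)))).
  have -> : 4 * (p%:R * `|eta - eta'| * N z) * (jap y * N (f y)) =
     2 * (p%:R * jap y * `|eta - eta'|) * (2 * (N (f y) * N z)) by ring.
  rewrite ler_wpM2r ?mulr_ge0 ?hnorm_ge0// ler_wpM2l//.
  by rewrite normrN -dotpBr dotp_le.
rewrite (le_trans (ler_wpM2l _ (hM y))) ?mulr_ge0 ?hnorm_ge0//.
by rewrite (normrN (eta - eta')) le_eqVlt; apply/orP; left; apply/eqP; ring.
Qed.

(** Comparability of <y> and <y + z> keeps the weight in Taylor estimates. *)
Lemma jap_shift (y z : 'rV[R]_p) : (forall i, `|z 0 i| <= 1) ->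
  jap y <= Num.sqrt (2 * (p%:R + 1)) * jap (y + z).
Proof.
move=> z1; rewrite -sqrtrM ?mulr_ge0// ?addr_ge0// ler_wsqrtr//.
rewrite mulrDr mulr1 /dotp.
have h (i : 'I_p) : y 0 i * y 0 i <= 2 * ((y + z) 0 i * (y + z) 0 i) + 2.
  have := z1 i; rewrite ler_norml => /andP[? ?]; rewrite mxE.
  have := sqr_ge0 (y 0 i + 2 * z 0 i); have : z 0 i * z 0 i <= 1 by nra.
  by rewrite expr2; lra.
have : \sum_i y 0 i * y 0 i <= 2 * \sum_i ((y + z) 0 i * (y + z) 0 i) + 2 * p%:R.
  rewrite mulr_sumr (_ : 2 * p%:R = \sum_(i < p) 2).
    by rewrite -big_split; apply: ler_sum => i _; exact: h.
  by rewrite sumr_const card_ord mulr_natr.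
have : 0 <= \sum_i ((y + z) 0 i * (y + z) 0 i) by exact: dotp_ge0.
have : 0 <= p%:R :> R by [].
move: (\sum_i _) (\sum_i _) (p%:R : R) => a b c; nra.
Qed.

Lemma cis_taylor (x : R) : cabs (cis x - 1 - 'i%C * (x%:C)%C) <= 2 * x ^+ 2.
Proof.
have sinx (t : R) : `|sin t| <= `|t|.
  have [c _] := mean_value 0 t (fun x => is_derive_sin x).
  rewrite sin0 !subr0 => ->; rewrite normrM ler_piMl//.
  by rewrite ler_norml cos_geN1 cos_le1.
have cosx (t : R) : `|cos t - 1| <= `|t|.
  have [c _] := mean_value 0 t (fun x => is_derive_cos x).
  rewrite cos0 !subr0 => ->; rewrite normrM normrN ler_piMl//.
  by rewrite ler_norml sin_geN1 sin_le1.
have cosx2 : `|cos x - 1| <= `|x| ^+ 2.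
  have [c] := mean_value 0 x (fun x => is_derive_cos x).
  rewrite cos0 !subr0 => ct ->; rewrite normrM normrN expr2 ler_wpM2r//.
  exact: le_trans (sinx c) ct.
have sinx2 : `|sin x - x| <= `|x| ^+ 2.
  have [c] := mean_value 0 x (fun x => is_deriveB (is_derive_sin x) (is_derive_id x (1 : R))).
  rewrite -[(sin - id) x - _]/((sin x - x) - (sin 0 - 0)) sin0 !subr0 => ct ->.
  rewrite normrM expr2 ler_wpM2r//.
  exact: le_trans (cosx c) ct.
rewrite (le_trans (cabs_le_ReIm _))//= -real_normK ?num_real// mulr2n mulrDl mul1r.
by rewrite !mul0r !mul1r !subr0 add0r lerD.
Qed.

Lemma cabsD (a b : C) : cabs (a + b) <= cabs a + cabs b.
Proof.
have cabsE (z : C) : ((cabs z)%:C)%C = `|z| by case: z.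
by rewrite -lecR rmorphD /= !cabsE ler_normD.
Qed.

(** How the first-order terms of two expansions in a small increment are
    compared. *)
Lemma le0_of_linear (x B : R) : (forall h, 0 < h -> h <= 1 -> x <= B * h) -> x <= 0.
Proof.
move=> xB; rewrite leNgt; apply/negP => x0.
have B1 : 0 < `|B| + 1 by rewrite ltr_wpDl.
pose h := Num.min 1 (x / (`|B| + 1) / 2).
have h0 : 0 < h by rewrite lt_min ltr01 !divr_gt0.
have hle : h <= 1 by rewrite ge_min lexx.
have := xB _ h0 hle; apply/negP; rewrite -ltNge.
have : (`|B| + 1) * h <= x / 2.
  by rewrite -ler_pdivlMl// [leRHS]mulrC mulrAC ge_min lexx orbT.
have : B * h <= (`|B| + 1) * h by rewrite ler_wpM2r ?(ltW h0)// (le_trans (ler_norm _))// lerDl.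
lra.
Qed.

Lemma cL1_0 : cL1 (fun _ : 'rV[R]_p => 0 : C).
Proof.
suff L0 : L1 (fun _ : 'rV[R]_p => 0 : R) by [].
split; first exact: borel_rV_cst.
by under eq_fun do rewrite normr0; rewrite iint0 ltry.
Qed.

Lemma cL1Z (a : C) (F : 'rV[R]_p -> C) : cL1 F -> cL1 (fun y => a * F y).
Proof.
move=> LF; have := cL1_lin a LF cL1_0; congr cL1.
by apply/funext => y; rewrite addr0.
Qed.

Lemma cintZ (a : C) (F : 'rV[R]_p -> C) : cL1 F -> cint (fun y => a * F y) = a * cint F.
Proof.
move=> LF; have := cint_lin a LF cL1_0; rewrite cint0 addr0 => <-.
by congr cint; apply/funext => y; rewrite addr0.
Qed.

Lemma cL1_shift (a : 'rV[R]_p) (F : 'rV[R]_p -> C) : cL1 F -> cL1 (fun y => F (a + y)).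
Proof. by case=> h1 h2; split; [exact: (L1_shift a h1)|exact: (L1_shift a h2)]. Qed.

(** Two mean value estimates; the integrable weight at [y] absorbs the
    intermediate points by [jap_shift]. *)
Lemma schwartz_taylor f i : schwartz H ip f -> exists2 K : R, 0 <= K & forall y (h : R), `|h| <= 1 ->
  N (f (y + h *: De i) - f y - (h%:C)%C *: vpd H ip [:: i] f y) <=
    h ^+ 2 * (K * (jap y)^-1 ^+ (2 * p)).
Proof.
move=> Sf; have [M M0 hM] := schwartz_bound Sf [:: i; i] (2 * p).
have Hf l y := (schwartz_vpd Sf l y).1.
pose c := Num.sqrt (2 * (p%:R + 1)) : R.
have c0 : 0 < c by rewrite sqrtr_gt0 mulr_gt0// ltr_wpDl.
exists (M * c ^+ (2 * p)); first by rewrite mulr_ge0// exprn_ge0// ltW.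
move=> y h h1.
pose B := M * c ^+ (2 * p) * (jap y)^-1 ^+ (2 * p).
have B0 : 0 <= B by rewrite !mulr_ge0// exprn_ge0// ?invr_ge0 ltW// jap_gt0.
have hB (t : R) : `|t| <= 1 -> N (vpd H ip [:: i; i] f (y + t *: De i)) <= B.
  move=> t1; rewrite (le_trans (hM _))// /B -mulrA ler_wpM2l// -exprMn.
  have jt0 := jap_gt0 (y + t *: De i); have jy0 := jap_gt0 y.
  have q : (jap (y + t *: De i))^-1 <= c * (jap y)^-1.
    rewrite -[leLHS]mul1r ler_pdivrMr// mulrAC ler_pdivlMr// mul1r.
    apply: jap_shift => j; rewrite !mxE eqxx /=.
    by case: (_ == _); rewrite ?mulr1// mulr0 normr0.
  apply: lerXn2r => //; rewrite nnegrE; first by rewrite invr_ge0 ltW.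
  by rewrite mulr_ge0 ?invr_ge0 ?(ltW c0) ?(ltW jy0).
have h2 (t : R) : `|t| <= `|h| ->
    N (vpd H ip [:: i] f (y + t *: De i) - vpd H ip [:: i] f y) <= B * `|h|.
  move=> th.
  have := vector_mean_value hH (y := y) (h := t) (c := 0) (K := B) (f := vpd H ip [:: i] f)
    (f' := vpd H ip [:: i; i] f) (Hf _) (fun y => (schwartz_vpd Sf [:: i] y).2 i) (hilb0 hH) B0.
  rewrite scaler0 subr0 => /(_ _)/le_trans; apply; last by rewrite ler_wpM2l.
  by move=> t' tt'; rewrite subr0 hB// (le_trans tt')// (le_trans th).
have := vector_mean_value hH (y := y) (h := h) (c := vpd H ip [:: i] f y) (K := B * `|h|) (f := f)
  (f' := vpd H ip [:: i] f) (Hf [::]) (fun y => (schwartz_vpd Sf [::] y).2 i) (Hf _ y).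
move=> /(_ (mulr_ge0 B0 (normr_ge0 h)) h2)/le_trans; apply.
by rewrite -mulrA -expr2 real_normK ?num_real// mulrC.
Qed.

(** Integration by parts is replaced by translation invariance of the integral:
    translating [f] by [h] multiplies its transform by a character, and the
    first-order terms in [h] give the claim. *)
Lemma vfourier_deriv f i eta : schwartz H ip f ->
  heq (vfourier H ip (vpd H ip [:: i] f) eta)
      (('i%C * ((eta 0 i)%:C)%C) *: vfourier H ip f eta).
Proof.
move=> Sf; have tf := schwartz_tame hH Sf; have Hf := tame_mem tf.
have Sf1 := schwartz_of_vpd hH [:: i] Sf; have tf1 := schwartz_tame hH Sf1.
have Hf1 := tame_mem tf1.
apply: vfourier_uniq => //; first by apply: (hilbZ hH); exact: vfourier_mem.
move=> z Hz; rewrite (ipZl hH) ?vfourierE//; last exact: vfourier_mem.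
have [K K0 hK] := schwartz_taylor i Sf.
set e := fun y => cis (- dotp y eta).
set Phi := cint _; set Phi1 := cint _.
(* the transform of [f (y + h e_i) - f y - h f' y] is of second order in [h] *)
have key (h : R) : `|h| <= 1 ->
    cabs ((cis (h * eta 0 i) - 1) * Phi - (h%:C)%C * Phi1) <= 2 * Ip * (2 * K * N z) * h ^+ 2.
  move=> h1.
  pose G y := e y * ip (f y) z.
  have LG : cL1 G by exact: cL1_fourier.
  pose D y := (- (h%:C)%C) * (e y * ip (vpd H ip [:: i] f y) z) +
     ((cis (h * eta 0 i)) * G (h *: De i + y) + (-1) * G y).
  have LG' : cL1 (fun y => G (h *: De i + y)).
    exact: cL1_shift.
  have LG0 : cL1 (fun y => (cis (h * eta 0 i)) * G (h *: De i + y) + (-1) * G y).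
    by apply: cL1_lin => //; exact: cL1Z.
  have LF1 : cL1 (fun y => e y * ip (vpd H ip [:: i] f y) z) by exact: cL1_fourier.
  have -> : (cis (h * eta 0 i) - 1) * Phi - (h%:C)%C * Phi1 = cint D.
    rewrite /D cint_lin// cint_lin//; last exact: cL1Z.
    rewrite !cintZ// (cint_shift _ LG).
    have -> : cint G = Phi by [].
    have -> : cint (fun y => e y * ip (vpd H ip [:: i] f y) z) = Phi1 by [].
    by ring.
  rewrite -[leRHS]mulrA; apply: cabs_cint_weight; first exact: cL1_lin.
  move=> y.
  have -> : D y = e y * ip (f (y + h *: De i) - f y - (h%:C)%C *: vpd H ip [:: i] f y) z.
    have -> : e y = cis (h * eta 0 i) * e (h *: De i + y).
      by rewrite /e -cisD dotpDl dotp_De opprD addrA subrr add0r.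
    rewrite !(ipBl hH) ?(ipZl hH)//; try exact: (hilbB hH); try exact: (hilbZ hH).
    have eE : e y = cis (h * eta 0 i) * e (h *: De i + y).
      by rewrite /e -cisD dotpDl dotp_De opprD addrA subrr add0r.
    by rewrite /D /G eE [h *: _ + y]addrC; ring.
  have Hd : H (f (y + h *: De i) - f y - (h%:C)%C *: vpd H ip [:: i] f y).
    by apply: (hilbB hH); [exact: (hilbB hH)|exact: (hilbZ hH)].
  rewrite cabsM cabs_cis mul1r (le_trans (cabs_ip hH Hd Hz))//.
  apply: (le_trans (y := 2 * (h ^+ 2 * (K * (jap y)^-1 ^+ (2 * p)) * N z))).
    by rewrite ler_wpM2l// ler_wpM2r ?hnorm_ge0// hK.
  by rewrite le_eqVlt; apply/orP; left; apply/eqP; ring.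
set a := 'i%C * ((eta 0 i)%:C)%C.
apply/eqP; rewrite -subr_eq0; apply/eqP/cabs_eq0/eqP; rewrite eq_le cabs_ge0 andbT.
apply: (@le0_of_linear _ (2 * Ip * (2 * K * N z) + 2 * (eta 0 i) ^+ 2 * cabs Phi)) => h h0 h1.
rewrite -(ler_pM2l h0) -{1}(ger0_norm (ltW h0)) -cabs_real -cabsM.
have -> : (h%:C)%C * (a * Phi - Phi1) = ((cis (h * eta 0 i) - 1) * Phi - (h%:C)%C * Phi1) +
    (- (cis (h * eta 0 i) - 1 - 'i%C * ((h * eta 0 i)%:C)%C)) * Phi.
  by rewrite /a rmorphM /=; ring.
rewrite (le_trans (cabsD _ _))//.
have h1' : `|h| <= 1 by rewrite ger0_norm// ltW.
rewrite (le_trans (lerD (key _ h1') (lexx _)))// cabsM cabsN.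
have := ler_wpM2r (cabs_ge0 Phi) (cis_taylor (h * eta 0 i)).
rewrite exprMn; move: (cabs (_ - _)) (cabs Phi) (N z) => c1 c2 c3 hc.
have -> : h * ((2 * Ip * (2 * K * c3) + 2 * eta 0 i ^+ 2 * c2) * h) =
  2 * Ip * (2 * K * c3) * h ^+ 2 + 2 * (h ^+ 2 * eta 0 i ^+ 2) * c2 by ring.
by rewrite lerD2l.
Qed.

End FourierTransform.

(** * The integrand of the edge norms *)

Section WNorms.
Context {R : realType} {E : lmodType R[i]}.
Local Notation C := R[i].
Context {H : set E} {ip : E -> E -> C} (hH : hilbert H ip) {p : nat}.
Local Notation N := (hnorm ip).
Local Notation heq := (heq (ip := ip)).
Implicit Types (f g : 'rV[R]_p -> E) (y eta : 'rV[R]_p) (l : seq 'I_p).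

Lemma vfourier_vpd f eta : schwartz H ip f -> forall l,
  heq (vfourier H ip (vpd H ip l f) eta)
    ((\prod_(i <- l) ('i%C * ((eta 0 i)%:C)%C)) *: vfourier H ip f eta).
Proof.
move=> Sf; have Hv l := vfourier_mem hH eta (schwartz_tame hH (schwartz_of_vpd hH l Sf)).
elim=> [|i l IH].
  by rewrite big_nil scale1r; exact: (heq_refl hH).
rewrite big_cons -scalerA.
have h1 := vfourier_deriv hH i eta (schwartz_of_vpd hH l Sf).
apply: (heq_trans hH _ _ _ h1).
- exact: (Hv (i :: l)).
- by apply: (hilbZ hH); exact: Hv.
- by do 2 apply: (hilbZ hH); exact: (Hv [::]).
by apply: (heqZ hH) => //; apply: (hilbZ hH); exact: (Hv [::]).
Qed.

Definition monomial {k} (b : {ffun 'I_p -> 'I_k}) (eta : 'rV[R]_p) : R :=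
  \prod_i eta 0 i ^+ b i.

Lemma prod_mseq {k} (b : {ffun 'I_p -> 'I_k}) (F : 'I_p -> C) :
  \prod_(i <- mseq b) F i = \prod_i F i ^+ b i.
Proof.
rewrite /mseq big_flatten /= big_map big_enum /=; apply: eq_bigr => i _.
by rewrite big_nseq iter_mulr_1.
Qed.

Lemma vD_schwartz {k} (b : {ffun 'I_p -> 'I_k}) f : schwartz H ip f ->
  schwartz H ip (vD H ip b f).
Proof. by move=> Sf; apply: (schwartzZ hH); exact: (schwartz_of_vpd hH). Qed.

(** The factor (-i)^|b| in D^b cancels the powers of i. *)
Lemma vfourier_vD {k} (b : {ffun 'I_p -> 'I_k}) f eta : schwartz H ip f ->
  heq (vfourier H ip (vD H ip b f) eta)
    (((monomial b eta)%:C)%C *: vfourier H ip f eta).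
Proof.
move=> Sf; have Sl := schwartz_of_vpd hH (mseq b) Sf.
have tl := schwartz_tame hH Sl; have tf := schwartz_tame hH Sf.
have Hl := vfourier_mem hH eta tl; have Hf := vfourier_mem hH eta tf.
have := vfourier_vpd eta Sf (mseq b).
rewrite prod_mseq => h.
set c : C := (0 -i* 1)%C ^+ mlen b.
have h2 : heq (vfourier H ip (vD H ip b f) eta) (c *: vfourier H ip (vpd H ip (mseq b) f) eta).
  have tv := schwartz_tame hH (vD_schwartz b Sf).
  apply: (vfourier_uniq hH) => //; first exact: (hilbZ hH).
  move=> z Hz; rewrite (ipZl hH)// (vfourierE hH)//.
  rewrite -cintZ; last exact: (cL1_fourier hH).
  congr cint; apply/funext => y; rewrite /vD (ipZl hH)//; last exact: (tame_mem tl).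
  by rewrite mulrCA.
apply: (heq_trans hH _ _ _ h2) => //.
- exact: (vfourier_mem hH eta (schwartz_tame hH (vD_schwartz b Sf))).
- exact: (hilbZ hH).
- exact: (hilbZ hH).
have -> : ((monomial b eta)%:C)%C = c * \prod_i ('i%C * ((eta 0 i)%:C)%C) ^+ b i.
  rewrite /c /mlen -prodrXr -big_split /= /monomial rmorph_prod /=.
  apply: eq_bigr => i _; rewrite rmorphXn /= -exprMn mulrA; congr (_ ^+ _).
  by apply/eqP; rewrite eq_complex /=; apply/andP; split; apply/eqP; ring.
rewrite -scalerA; apply: (heqZ hH) => //; exact: (hilbZ hH).
Qed.

Context {kap : R -> E -> E} (ga : group_action H ip kap).

Lemma japV_gt0 eta : 0 < (jap eta)^-1.
Proof. by rewrite invr_gt0 jap_gt0. Qed.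

Lemma kapB d u v : 0 < d -> H u -> H v -> kap d (u - v) = kap d u - kap d v.
Proof.
by move=> d0 Hu Hv; rewrite addrC -scaleN1r (ga_linear ga)// scaleN1r addrC.
Qed.

Lemma kapZ d (a : C) u : 0 < d -> H u -> kap d (a *: u) = a *: kap d u.
Proof.
move=> d0 Hu; have H0 := hilb0 hH.
have k0 : kap d 0 = 0.
  by have := kapB d0 H0 H0; rewrite !subrr.
by rewrite -[_ *: u]addr0 (ga_linear ga)// k0 addr0.
Qed.

Lemma kap_heq d u v : 0 < d -> H u -> H v -> heq u v -> heq (kap d u) (kap d v).
Proof.
move=> d0 Hu Hv uv; rewrite -[heq _ _]/(N _ = 0) -kapB//.
have [c hc] := ga_bounded ga d0.
apply/eqP; rewrite eq_le hnorm_ge0 andbT (le_trans (hc _ _))//; first exact: (hilbB hH).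
by rewrite uv mulr0.
Qed.

(** The transform of [f] in the normalization in which the norm of the edge
    space is a weighted square integral. *)
Definition wtransform f eta : E := kap (jap eta)^-1 (vfourier H ip f eta).
Definition wfourier f eta : R := N (wtransform f eta).

Lemma wfourier_ge0 f eta : 0 <= wfourier f eta.
Proof. exact: hnorm_ge0. Qed.

Lemma wtransform_mem f eta : tame H ip f -> H (wtransform f eta).
Proof. by move=> tf; apply: (ga_stable ga); [exact: japV_gt0|exact: vfourier_mem]. Qed.

Lemma wtransform_lin (a : C) f g eta : tame H ip f -> tame H ip g ->
  heq (wtransform (fun y => a *: f y + g y) eta) (a *: wtransform f eta + wtransform g eta).
Proof.
move=> tf tg; have Hf := vfourier_mem hH eta tf; have Hg := vfourier_mem hH eta tg.
rewrite /wtransform -(ga_linear ga) ?japV_gt0//.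
apply: kap_heq; [exact: japV_gt0| |exact: (hilbL hH)|exact: vfourier_lin].
by apply: (vfourier_mem hH); exact: tame_lin.
Qed.

Lemma wtransformB f g eta : tame H ip f -> tame H ip g ->
  heq (wtransform (fun y => f y - g y) eta) (wtransform f eta - wtransform g eta).
Proof.
move=> tf tg; have := wtransform_lin (-1) eta tg tf; rewrite scaleN1r [X in heq _ X]addrC.
by have -> : (fun y => -1 *: g y + f y) = fun y => f y - g y
  by apply/funext => y; rewrite scaleN1r addrC.
Qed.

Lemma tameB f g : tame H ip f -> tame H ip g -> tame H ip (fun y => f y - g y).
Proof.
move=> tf tg; have := tame_lin hH (-1) tg tf; congr tame; apply/funext => y.
by rewrite scaleN1r addrC.
Qed.

Lemma wtransform_vD {k} (b : {ffun 'I_p -> 'I_k}) f eta : schwartz H ip f ->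
  heq (wtransform (vD H ip b f) eta) (((monomial b eta)%:C)%C *: wtransform f eta).
Proof.
move=> Sf; have tf := schwartz_tame hH Sf; have tD := schwartz_tame hH (vD_schwartz b Sf).
have Hf := vfourier_mem hH eta tf.
rewrite /wtransform -kapZ ?japV_gt0//.
apply: kap_heq; [exact: japV_gt0|exact: vfourier_mem|exact: (hilbZ hH)|exact: vfourier_vD].
Qed.

Lemma continuous_kap u : H u -> continuous (fun eta : 'rV[R]_p => N (kap (jap eta)^-1 u)).
Proof.
move=> Hu eta.
have ck : {for (jap eta)^-1, continuous (fun d => N (kap d u))}.
  apply/(@cvgrPdist_lt _ _ _ (nbhs (jap eta)^-1) (nbhs_filter _)) => e e0.
  have /cvgr0_norm_lt/(_ _ e0) c := ga_continuous ga (japV_gt0 eta) Hu.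
  near=> d.
  have d0 : 0 < d by near: d; exact: lt_nbhsr (japV_gt0 eta).
  have Hd := ga_stable ga d0 Hu; have He := ga_stable ga (japV_gt0 eta) Hu.
  rewrite (le_lt_trans (hnorm_lip hH He Hd))// (hnormBC hH)//.
  rewrite -[X in X < _]ger0_norm ?hnorm_ge0//; near: d; exact: c.
apply: (continuous_comp (f := fun eta : 'rV[R]_p => (jap eta)^-1) _ ck).
by apply: continuousV; [rewrite gt_eqF// jap_gt0|exact: continuous_jap].
Unshelve. all: by end_near. Qed.

(** Strong continuity of the action gives measurability of the integrand
    without a uniform bound on the action: it is the pointwise limit of the
    functions obtained by freezing the transform on small cubes. *)
Lemma borel_wfourier f : tame H ip f -> borel_rV (wfourier f).
Proof.
move=> tf; have [L hL] := vfourier_lip hH tf.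
have Hv eta := vfourier_mem hH eta tf.
apply: (@measurable_fun_cvg _ _ _ _ (fun k t =>
  N (kap (jap (row_of_tuple t))^-1 (vfourier H ip f (lattice k (row_of_tuple t)))))) => [k|t _].
  apply: (measurable_lattice_fun k (F := fun z eta => N (kap (jap eta)^-1 (vfourier H ip f z)))) => z.
  by apply: borel_continuous; exact: continuous_kap.
rewrite -/(row_of_tuple t); set eta := row_of_tuple t.
have [c hc] := ga_bounded ga (japV_gt0 eta).
apply/subr_cvg0; apply/norm_cvg0P.
have c0 : (fun k : nat => (`|c| * `|L|) * (2^-1 : R) ^+ k) @ \oo --> (0 : R).
  rewrite -(mulr0 (`|c| * `|L|)); apply: cvgMr.
  by apply: cvg_expr; rewrite ger0_norm ?invf_lt1 ?ltr1n.
apply: (squeeze_cvgr _ (cvg_cst 0) c0); near=> k; rewrite normr_ge0/=.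
rewrite (le_trans (hnorm_lip hH _ _))//; try exact: (ga_stable ga (japV_gt0 _) (Hv _)).
rewrite -kapB ?japV_gt0// (le_trans (hc _ _))//; first exact: (hilbB hH).
rewrite (le_trans (ler_wpM2r (hnorm_ge0 _) (ler_norm c)))// -mulrA ler_wpM2l//.
rewrite (le_trans (hL _ _))// (le_trans (ler_wpM2r (normr_ge0 _) (ler_norm L)))//.
by rewrite ler_wpM2l// distrC exprVn lattice_near.
Unshelve. all: by end_near. Qed.

Lemma wfourier_sub f g eta : tame H ip f -> tame H ip g ->
  wfourier f eta <= wfourier g eta + wfourier (fun y => f y - g y) eta.
Proof.
move=> tf tg; have Hf := wtransform_mem eta tf; have Hg := wtransform_mem eta tg.
have Hfg := wtransform_mem eta (tameB tf tg).
rewrite {3}/wfourier (heq_norm hH Hfg (hilbB hH Hf Hg) (wtransformB eta tf tg)).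
rewrite /wfourier addrC -{1}[wtransform f eta](subrK (wtransform g eta)).
by apply: (hnormD hH) => //; exact: (hilbB hH).
Qed.

End WNorms.

(** * Bounded operators and the transform *)

Section BoundedOperators.
Context {R : realType} {E : lmodType R[i]}.
Local Notation C := R[i].

(** A bounded operator between two Hilbert spaces, linear up to elements of
    norm zero only, since its values are chosen representatives. *)
Record bounded_op (H : set E) (ip : E -> E -> C) (H' : set E) (ip' : E -> E -> C)
    (T : E -> E) : Prop := BoundedOp {
  op_mem : forall u, H u -> H' (T u);
  op_lin : forall a u v, H u -> H v ->
    heq (ip := ip') (T (a *: u + v)) (a *: T u + T v);
  op_bound : exists2 c : R, 0 <= c & forall u, H u -> hnorm ip' (T u) <= c * hnorm ip u
}.

Context {H : set E} {ip : E -> E -> C} (hH : hilbert H ip).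
Context {H' : set E} {ip' : E -> E -> C} (hH' : hilbert H' ip').
Context {T : E -> E} (hT : bounded_op H ip H' ip' T).
Context {p : nat}.
Local Notation N := (hnorm ip).
Local Notation N' := (hnorm ip').
Local Notation "u ~ v" := (heq (ip := ip') u v) (at level 70).
Implicit Types (f g : 'rV[R]_p -> E) (y eta : 'rV[R]_p) (l : seq 'I_p).

Local Notation De i := (delta_mx 0 i : 'rV[R]_p).

Lemma opB u v : H u -> H v -> T (u - v) ~ T u - T v.
Proof.
move=> Hu Hv; have := op_lin hT (-1) Hv Hu.
by rewrite !scaleN1r addrC [X in _ ~ X]addrC.
Qed.

Lemma op0 : N' (T 0) = 0.
Proof.
have [c _ hc] := op_bound hT; have H0 := hilb0 hH.
apply/eqP; rewrite eq_le hnorm_ge0 andbT (le_trans (hc _ H0))//.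
by rewrite (hnorm0 hH) mulr0.
Qed.

Lemma opZ (a : C) u : H u -> T (a *: u) ~ a *: T u.
Proof.
move=> Hu; have H0 := hilb0 hH; have HT := op_mem hT.
have := op_lin hT a Hu H0; rewrite addr0 => h.
apply: (heq_trans hH' _ _ _ h).
- by apply: HT; exact: (hilbZ hH).
- by apply: (hilbD hH'); [apply: (hilbZ hH')|]; exact: HT.
- by apply: (hilbZ hH'); exact: HT.
by rewrite /heq addrC addrA addNr add0r op0.
Qed.

Lemma op_heq u v : H u -> H v -> heq (ip := ip) u v -> T u ~ T v.
Proof.
move=> Hu Hv uv; have HT := op_mem hT; have Huv := hilbB hH Hu Hv.
have [c _ hc] := op_bound hT.
have e : N' (T (u - v)) = 0.
  apply/eqP; rewrite eq_le hnorm_ge0 andbT (le_trans (hc _ Huv))//.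
  by rewrite uv mulr0.
rewrite /heq -e; apply: esym; apply: (heq_norm hH') (opB Hu Hv); first exact: HT.
by apply: (hilbB hH'); exact: HT.
Qed.

Lemma is_vderiv_op f y i u : (forall y, H (f y)) -> is_vderiv H ip i f y u ->
  is_vderiv H' ip' i (T \o f) y (T u).
Proof.
move=> Hf [Hu cu]; have HT := op_mem hT; split; first exact: HT.
have [c _ hc] := op_bound hT.
apply: (cvg0_le (c1 := c) (c2 := 0) _ cu cu) => h; rewrite hnorm_ge0 mul0r addr0/=.
set a := ((h^-1)%:C)%C; set d := f (y + h *: De i) - f y.
have Hd : H d by exact: (hilbB hH).
have Had : H (a *: d) by exact: (hilbZ hH).
rewrite -(heq_norm hH' (u := T (a *: d - u))) ?hc//; try exact: (hilbB hH).
- by apply: HT; exact: (hilbB hH).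
- by apply: (hilbB hH'); [apply: (hilbZ hH'); apply: (hilbB hH')|]; exact: HT.
apply: (heq_trans hH' _ _ _ (opB Had Hu)).
- by apply: HT; exact: (hilbB hH).
- by apply: (hilbB hH'); exact: HT.
- by apply: (hilbB hH'); [apply: (hilbZ hH'); apply: (hilbB hH')|]; exact: HT.
have Hz : H' (T (f (y + h *: De i)) - T (f y)) by apply: (hilbB hH'); exact: HT.
apply: (heqB hH'); [exact: HT|exact: HT|exact: (hilbZ hH')|exact: HT| |exact: (heq_refl hH')].
apply: (heq_trans hH' _ _ _ (opZ a Hd)).
- exact: HT.
- by apply: (hilbZ hH'); exact: HT.
- exact: (hilbZ hH').
by apply: (heqZ hH') => //; [exact: HT|exact: opB].
Qed.

Lemma schwartz_op f : schwartz H ip f ->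
  schwartz H' ip' (T \o f).
Proof.
move=> Sf; have HT := op_mem hT; have Hf l y := (schwartz_vpd Sf l y).1.
pose F l y := T (vpd H ip l f y).
have HF l y : H' (F l y) by exact: HT.
have dF l y i : is_vderiv H' ip' i (F l) y (F (i :: l) y).
  by apply: is_vderiv_op => //; exact: (schwartz_vpd Sf l y).2.
apply: (schwartz_family hH' HF dF) => l k.
have [c c0 hc] := op_bound hT; have [_ /(_ l)[_ /(_ k)[M hM]]] := Sf.
exists (c * M) => y; rewrite (le_trans (ler_wpM2l _ (hc _ (Hf l y))))//.
  by rewrite exprn_ge0// ltW// jap_gt0.
by rewrite mulrCA ler_wpM2l.
Qed.

(** The Riesz theorem represents [u |-> <T u, z>] by an element [g] of the source
    space, a value of the adjoint; then both sides have the same pairing with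
    [z]. *)
Lemma vfourier_op f eta : tame H ip f -> tame H' ip' (T \o f) ->
  vfourier H' ip' (T \o f) eta ~ T (vfourier H ip f eta).
Proof.
move=> tf tTf; have HT := op_mem hT; have Hf := vfourier_mem hH eta tf.
apply: (vfourier_uniq hH') => //; first exact: HT.
move=> z Hz; have [c c0 hc] := op_bound hT.
have [||g Hg gE] := riesz hH (L := fun u => ip' z (T u)) (c := 2 * N' z * c).
- move=> a u v Hu Hv; have HTu := HT _ Hu; have HTv := HT _ Hv.
  have Hl : H' (a *: T u + T v) by exact: (hilbL hH').
  have Hl' : H' (T (a *: u + v)) by apply: HT; exact: (hilbL hH).
  rewrite (ipC hH' Hl' Hz) (heq_ip hH' Hl' Hl Hz (op_lin hT a Hu Hv)) -(ipC hH' Hl Hz).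
  by rewrite (ipDr hH')// ?(ipZr hH')//; exact: (hilbZ hH').
- move=> u Hu; rewrite (le_trans (cabs_ip hH' Hz (HT _ Hu)))// -!mulrA ler_wpM2l//.
  by rewrite ler_wpM2l ?hnorm_ge0// hc.
have E1 u : H u -> ip' (T u) z = ip u g.
  by move=> Hu; rewrite (ipC hH' Hz (HT _ Hu)) -gE// -(ipC hH Hg Hu).
rewrite E1// (vfourierE hH)//; congr cint; apply/funext => y.
by rewrite -E1//; exact: (tame_mem tf).
Qed.

Lemma wtransform_op (kap : R -> E -> E) (ga : group_action H ip kap)
    (ga' : group_action H' ip' kap)
    (Tkap : forall d u, 0 < d -> H u -> T (kap d u) ~ kap d (T u)) f eta :
  schwartz H ip f ->
  wtransform (H := H') (ip := ip') (kap := kap) (T \o f) eta ~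
  T (wtransform (H := H) (ip := ip) (kap := kap) f eta).
Proof.
move=> Sf; have tf := schwartz_tame hH Sf; have HT := op_mem hT.
have tTf := schwartz_tame hH' (schwartz_op Sf).
have Hv := vfourier_mem hH eta tf; have Hv' := vfourier_mem hH' eta tTf.
have d0 := japV_gt0 eta.
apply: (heq_trans hH' (v := kap (jap eta)^-1 (T (vfourier H ip f eta)))).
- exact: (ga_stable ga').
- by apply: (ga_stable ga') => //; exact: HT.
- by apply: HT; exact: (ga_stable ga).
- by apply: (kap_heq hH' ga') => //; [exact: HT|exact: vfourier_op].
apply: (heq_sym hH').
- by apply: HT; exact: (ga_stable ga).
- by apply: (ga_stable ga') => //; exact: HT.
exact: Tkap.
Qed.

End BoundedOperators.

(** * Weighted square norms and limits of Cauchy sequences *)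

Section SquareNorms.
Context {R : realType} {m : nat}.
Implicit Types (F G K : 'rV[R]_m -> R).
Local Open Scope ereal_scope.

Definition l2norm F : \bar R := esqrt (iint (fun y => (F y ^+ 2)%R%:E)).

Lemma esqrt_ge0 (x : \bar R) : 0 <= esqrt x.
Proof. exact: poweR_ge0. Qed.

Lemma esqrt_sqr (x : \bar R) : 0 <= x -> esqrt x * esqrt x = x.
Proof.
move=> x0; have h : (2^-1 + 2^-1 = 1 :> R)%R by rewrite [RHS]splitr div1r.
rewrite /esqrt -poweRD ?h ?poweRe1//.
by apply: add_neq0_poweRD_def; rewrite h oner_neq0.
Qed.

Lemma le_esqrt (x y : \bar R) : 0 <= x -> x <= y -> esqrt x <= esqrt y.
Proof.
move=> x0 xy; apply: gt0_ler_poweR => //; rewrite ?invr_ge0 ?in_itv/= ?leey ?andbT//.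
by rewrite (le_trans x0).
Qed.

Lemma esqrtM_sqr (c : R) (x : \bar R) : (0 <= c)%R -> 0 <= x ->
  esqrt ((c ^+ 2)%R%:E * (x * x)) = c%:E * x.
Proof.
move=> c0; case: x => [x| |//]; rewrite ?lee_fin => x0.
  rewrite -!EFinM /esqrt poweR_EFin -[in LHS]expr2 -exprMn powR12_sqrt ?sqr_ge0//.
  by rewrite sqrtr_sqr ger0_norm// mulr_ge0.
move: c0; rewrite le_eqVlt => /predU1P[<-|c0].
  by rewrite expr0n/= !mul0e /esqrt poweR0r// invr_neq0.
by rewrite mulyy !gt0_muley ?lte_fin ?exprn_gt0// /esqrt poweRyr// invr_neq0.
Qed.

Lemma l2norm_sqr F : borel_rV F ->
  l2norm F * l2norm F = iint (fun y => (F y ^+ 2)%R%:E).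
Proof.
move=> bF; apply: esqrt_sqr; apply: iint_ge0 => [y|]; first exact: sqr_ge0.
exact: borel_rVX.
Qed.

Lemma l2norm_le F G (c : R) : borel_rV F -> borel_rV G -> (0 <= c)%R ->
  (forall y, 0 <= F y <= c * G y)%R -> l2norm F <= c%:E * l2norm G.
Proof.
move=> bF bG c0 FG; rewrite -esqrtM_sqr ?esqrt_ge0// l2norm_sqr//.
have bF2 := borel_rVX 2 bF; have bG2 := borel_rVX 2 bG.
rewrite -iintZ//; [|exact: sqr_ge0|by move=> y; exact: sqr_ge0].
apply: le_esqrt; first by apply: iint_ge0 => // y; exact: sqr_ge0.
apply: iint_le => //; first by apply: borel_rVM => //; exact: borel_rV_cst.
move=> y; rewrite sqr_ge0 -exprMn /=; have /andP[F0 Fle] := FG y.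
by rewrite lerXn2r// nnegrE// (le_trans F0).
Qed.

Lemma l2norm_triangle F G K : borel_rV F -> borel_rV G -> borel_rV K ->
  (forall y, 0 <= F y <= G y + K y)%R -> (forall y, 0 <= G y)%R -> (forall y, 0 <= K y)%R ->
  l2norm F <= l2norm G + l2norm K.
Proof.
move=> bF bG bK FGK G0 K0.
have lE (P : 'rV[R]_m -> R) : borel_rV P ->
    l2norm P = Lnorm (lebm m) 2%:E (EFin \o (P \o row_of_tuple)).
  move=> bP; rewrite Lnorm.unlock /l2norm /esqrt ge0_iintE; last 2 first.
  - by move=> y; exact: sqr_ge0.
  - exact: borel_rVX.
  congr (_ `^ _); apply: eq_integral => t _ /=.
  by rewrite powR_mulrn// real_normK ?num_real.
have bGK := borel_rVD bG bK.
apply: (@le_trans _ _ (l2norm (fun y => G y + K y)%R)).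
  rewrite -[leRHS]mul1e; apply: l2norm_le => // y.
  by rewrite mul1r.
rewrite !lE//.
by apply: (@minkowski_EFin _ _ _ (lebm m) (G \o row_of_tuple) (K \o row_of_tuple) 2) => //; rewrite ler1n.
Qed.

Lemma l2norm_equiv I (r : seq I) (P : pred I) F (G : I -> 'rV[R]_m -> R) (c1 c2 : R) :
  borel_rV F -> (forall i, borel_rV (G i)) ->
  (forall y, (c1 ^+ 2 * F y ^+ 2 <= \sum_(i <- r | P i) G i y ^+ 2 <= c2 ^+ 2 * F y ^+ 2)%R) ->
  (c1 ^+ 2)%R%:E * (l2norm F * l2norm F) <= \sum_(i <- r | P i) l2norm (G i) * l2norm (G i) /\
  \sum_(i <- r | P i) l2norm (G i) * l2norm (G i) <= (c2 ^+ 2)%R%:E * (l2norm F * l2norm F).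
Proof.
move=> bF bG FG.
have bF2 := borel_rVX 2 bF; have bG2 i := borel_rVX 2 (bG i).
have bcF (c : R) : borel_rV (fun y => (c ^+ 2 * F y ^+ 2)%R).
  by apply: borel_rVM => //; exact: borel_rV_cst.
have bS : borel_rV (fun y => (\sum_(i <- r | P i) G i y ^+ 2)%R).
  under eq_fun do rewrite -big_filter.
  exact: (borel_rV_sum (f := fun i y => (G i y ^+ 2)%R) (seq.filter P r)).
under eq_bigr do rewrite l2norm_sqr//.
rewrite l2norm_sqr// -!iintZ//; try by [move=> y; exact: sqr_ge0|exact: sqr_ge0].
rewrite -iint_sum//; last by move=> i y; exact: sqr_ge0.
split; apply: iint_le => // y; have /andP[h1 h2] := FG y.
  by rewrite h1 mulr_ge0// sqr_ge0.
by rewrite h2 sumr_ge0// => i _; exact: sqr_ge0.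
Qed.

End SquareNorms.

Section ExtendedLimits.
Context {R : realType}.
Local Open Scope ereal_scope.

(** From some point on the sequence is either constantly infinite, or finite and
    Cauchy in the real numbers. *)
Lemma ereal_cauchy_cvg (x : nat -> \bar R) : (forall k, 0 <= x k) ->
  (forall e : R, (0 < e)%R -> exists K, forall k l, (K <= k)%N -> (K <= l)%N ->
     x k <= x l + e%:E) -> cvgn x.
Proof.
move=> x0 xC; have [K1 hK1] := xC 1%R ltr01.
have [xy|xy] := eqVneq (x K1) +oo.
  have e k : (K1 <= k)%N -> x k = +oo.
    move=> Kk; have := hK1 _ _ (leqnn K1) Kk; rewrite xy leye_eq.
    by case: (x k) => [r|_|//]; rewrite -?EFinD.
  apply/cvg_ex; exists +oo.
  apply: cvg_near_cst; exists K1 => // k /= Kk; exact/esym/e.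
have fin k : (K1 <= k)%N -> x k \is a fin_num.
  move=> Kk; rewrite ge0_fin_numE// (le_lt_trans (hK1 _ _ Kk (leqnn K1)))//.
  by rewrite lte_add_pinfty ?ltry// lt_neqAle xy leey.
have cf : cvgn (fun k => fine (x k)).
  apply/cauchy_cvgP/cauchy_ballP => e e0.
  have e2 : (0 < e / 2)%R by rewrite divr_gt0.
  have [K2 hK2] := xC _ e2.
  pose A := (fun k => fine (x k)) @` [set k | (maxn K1 K2 <= k)%N].
  have nA : nbhs (fine (x k) @[k --> \oo]) A.
    by exists (maxn K1 K2) => // k /= Kk; exists k.
  exists (A, A) => // -[_ _] [/= [k Kk <-] [l Kl <-]].
  have /andP[k1 k2] : (K1 <= k)%N && (K2 <= k)%N by rewrite -geq_max.
  have /andP[l1 l2] : (K1 <= l)%N && (K2 <= l)%N by rewrite -geq_max.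
  rewrite -ball_normE /= ltr_norml.
  have h (i j : nat) : (K1 <= i)%N -> (K2 <= i)%N -> (K1 <= j)%N -> (K2 <= j)%N ->
      (fine (x i) <= fine (x j) + e / 2)%R.
    move=> i1 i2 j1 j2; have := hK2 _ _ i2 j2.
    by rewrite -{1}(fineK (fin _ i1)) -(fineK (fin _ j1)) -EFinD lee_fin.
  have := h _ _ k1 k2 l1 l2; have := h _ _ l1 l2 k1 k2.
  have : (e / 2 < e)%R by rewrite ltr_pdivrMr// ltr_pMr// ltr1n.
  by move=> ? ? ?; apply/andP; split; lra.
apply/cvg_ex; exists (limn (fun k => fine (x k)))%:E.
apply: cvg_EFin => //.
by exists K1 => // k /= Kk; exact: fin.
Qed.

Lemma cvge_sqr (x : nat -> \bar R) (l : \bar R) :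
  x @ \oo --> l -> (fun k => x k * x k) @ \oo --> l * l.
Proof.
move=> xl; apply: cvgeM => //.
rewrite /mule_def; case: l {xl} => [r| |] //=.
Qed.

Lemma cvge_sum_ge0 I (r : seq I) (P : pred I) (x : I -> nat -> \bar R) (l : I -> \bar R) :
  (forall i k, 0 <= x i k) -> (forall i, x i @ \oo --> l i) ->
  (fun k => \sum_(i <- r | P i) x i k) @ \oo --> \sum_(i <- r | P i) l i.
Proof.
move=> x0 xl.
have l0 i : 0 <= l i.
  by rewrite -(cvg_lim _ (xl i))//; apply: lime_ge; [exact: cvgP (xl i)|exact: nearW].
rewrite -big_filter; under eq_fun do rewrite -big_filter.
elim: (seq.filter P r) => [|i s IH].
  by rewrite big_nil; under eq_fun do rewrite big_nil; exact: cvg_cst.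
rewrite big_cons (_ : (fun k => _) = fun k => x i k + \sum_(j <- s) x j k); last first.
  by apply/funext => k; rewrite big_cons.
apply: cvgeD => //; apply: ge0_adde_def; rewrite inE//.
by apply: sume_ge0.
Qed.

End ExtendedLimits.

(** * Equivalence of norms for abstract edge spaces *)

Section EdgeSpaces.
Context {R : realType} {E : lmodType R[i]}.
Local Notation C := R[i].
Context {H : set E} {ip : E -> E -> C} (hH : hilbert H ip).
Context {kap : R -> E -> E} (ga : group_action H ip kap) {p : nat}.
Local Notation wf := (wfourier (H := H) (ip := ip) (kap := kap)).
Implicit Types (f g : 'rV[R]_p -> E) (eta : 'rV[R]_p).

Lemma Wnorm_l2 sig f : Wnorm H ip kap sig f = l2norm (fun eta => jap eta ^+ sig * wf f eta).
Proof.
rewrite /Wnorm /l2norm; congr (esqrt (iint _)); apply/funext => eta.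
by rewrite exprMn -exprM mulnC.
Qed.

Lemma borel_Wnorm sig f : tame H ip f -> borel_rV (fun eta => jap eta ^+ sig * wf f eta).
Proof.
move=> tf; apply: borel_rVM; last exact: (borel_wfourier hH ga).
by apply: borel_rVX; apply: borel_continuous; exact: continuous_jap.
Qed.

(** The norms of a Cauchy sequence form a Cauchy sequence, by Minkowski's
    inequality. Hence [Wlim] is a limit and not a default value. *)
Lemma Wspace_cvg sig (v : nat -> 'rV[R]_p -> E) : Wspace H ip kap sig v ->
  (fun k => Wnorm H ip kap sig (v k)) @ \oo --> Wlim H ip kap sig v.
Proof.
move=> [Sv Cv]; suff : cvgn (fun k => Wnorm H ip kap sig (v k)) by [].
have tv k := schwartz_tame hH (Sv k).
apply: ereal_cauchy_cvg => [k|e e0]; first exact: esqrt_ge0.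
have [K hK] := Cv e e0; exists K => k l kK lK.
apply: (@le_trans _ _ (Wnorm H ip kap sig (v l) + Wnorm H ip kap sig (fun y => v k y - v l y)%R)%E).
  have j0 eta : 0 <= jap eta ^+ sig by rewrite exprn_ge0// ltW// jap_gt0.
  rewrite !Wnorm_l2; apply: l2norm_triangle.
  - exact: borel_Wnorm.
  - exact: borel_Wnorm.
  - by apply: borel_Wnorm; exact: (tameB hH).
  - move=> eta; rewrite mulr_ge0 ?wfourier_ge0//= -mulrDr ler_wpM2l//.
    exact: (wfourier_sub hH ga).
  - by move=> eta; rewrite mulr_ge0 ?wfourier_ge0.
  - by move=> eta; rewrite mulr_ge0 ?wfourier_ge0.
by rewrite leeD2l// ltW// hK.
Qed.

End EdgeSpaces.

Section EdgeNormEquivalence.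
Context {R : realType} {E : lmodType R[i]}.
Local Notation C := R[i].
Context {H : set E} {ip : E -> E -> C} (hH : hilbert H ip).
Context {kap : R -> E -> E} (ga : group_action H ip kap) {p s : nat}.
Context {I : finType} {H' : I -> set E} {ip' : I -> E -> E -> C}.
Hypothesis hH' : forall i, hilbert (H' i) (ip' i).
Hypothesis ga' : forall i, group_action (H' i) (ip' i) kap.
Context {T : I -> E -> E}.
Hypothesis hT : forall i, bounded_op H ip (H' i) (ip' i) (T i).
Hypothesis Tkap : forall i d u, 0 < d -> H u ->
  heq (ip := ip' i) (T i (kap d u)) (kap d (T i u)).
Context {B : finType} {k : nat} {b : B -> {ffun 'I_p -> 'I_k}} {c1 c2 d1 d2 : R}.
Hypothesis hc : forall u, H u ->
  c1 ^+ 2 * hnorm ip u ^+ 2 <= \sum_i hnorm (ip' i) (T i u) ^+ 2 <= c2 ^+ 2 * hnorm ip u ^+ 2.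
Hypothesis hd : forall eta : 'rV[R]_p,
  d1 ^+ 2 * (jap eta ^+ s) ^+ 2 <= \sum_j monomial (b j) eta ^+ 2 <= d2 ^+ 2 * (jap eta ^+ s) ^+ 2.
Implicit Types (f g : 'rV[R]_p -> E) (eta : 'rV[R]_p) (i : I) (j : B).

Local Notation wt := (wtransform (H := H) (ip := ip) (kap := kap)).
Local Notation wt' i := (wtransform (H := H' i) (ip := ip' i) (kap := kap)).
Local Notation wf := (wfourier (H := H) (ip := ip) (kap := kap)).
Local Notation wf' i := (wfourier (H := H' i) (ip := ip' i) (kap := kap)).

(** The derivative in the edge variables is taken after the operator acting in
    the fibre. *)
Definition edge_derivative i j f : 'rV[R]_p -> E := vD (H' i) (ip' i) (b j) (T i \o f).
Local Notation G := edge_derivative.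

Lemma schwartz_edge i j f : schwartz H ip f -> schwartz (H' i) (ip' i) (G i j f).
Proof. by move=> Sf; apply: (vD_schwartz (hH' i)); exact: (schwartz_op hH (hH' i) (hT i) Sf). Qed.

(** In the normalized transform the group action has disappeared: derivatives
    become monomials and the operators act fibrewise. *)
Lemma wtransform_edge i j f eta : schwartz H ip f ->
  heq (ip := ip' i) (wt' i (G i j f) eta) (((monomial (b j) eta)%:C)%C *: T i (wt f eta)).
Proof.
move=> Sf; have STf := schwartz_op hH (hH' i) (hT i) Sf.
have tf := schwartz_tame hH Sf; have tTf := schwartz_tame (hH' i) STf.
have tG := schwartz_tame (hH' i) (schwartz_edge i j Sf).
have M1 := wtransform_mem (hH' i) (ga' i) eta tG.
have M2 := wtransform_mem (hH' i) (ga' i) eta tTf.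
have M3 := op_mem (hT i) (wtransform_mem hH ga eta tf).
apply: (heq_trans (hH' i) (v := ((monomial (b j) eta)%:C)%C *: wt' i (T i \o f) eta)) => //.
- exact: (hilbZ (hH' i)).
- exact: (hilbZ (hH' i)).
- exact: (wtransform_vD (hH' i) (ga' i)).
apply: (heqZ (hH' i)) => //.
exact: (wtransform_op hH (hH' i) (hT i) ga (ga' i) (@Tkap i)).
Qed.

Lemma wfourier_edge i j f eta : schwartz H ip f ->
  wf' i (G i j f) eta = `|monomial (b j) eta| * hnorm (ip' i) (T i (wt f eta)).
Proof.
move=> Sf; have tf := schwartz_tame hH Sf.
have tG := schwartz_tame (hH' i) (schwartz_edge i j Sf).
have M1 := wtransform_mem (hH' i) (ga' i) eta tG.
have M3 := op_mem (hT i) (wtransform_mem hH ga eta tf).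
rewrite /wfourier (heq_norm (hH' i) M1 (hilbZ (hH' i) _ M3) (wtransform_edge i j eta Sf)).
by rewrite (hnormZ (hH' i))// cabs_real.
Qed.

Lemma monomial_le j eta : `|monomial (b j) eta| <= `|d2| * jap eta ^+ s.
Proof.
have j0 : 0 <= jap eta ^+ s by rewrite exprn_ge0// ltW// jap_gt0.
rewrite -(ler_pXn2r (n := 2)) ?nnegrE ?mulr_ge0// exprMn !real_normK ?num_real//.
have /andP[_] := hd eta; apply: le_trans.
by rewrite (bigD1 j)//= lerDl sumr_ge0// => j' _; exact: sqr_ge0.
Qed.

Lemma op_le i u : H u -> hnorm (ip' i) (T i u) <= `|c2| * hnorm ip u.
Proof.
move=> Hu; rewrite -(ler_pXn2r (n := 2)) ?nnegrE ?mulr_ge0 ?hnorm_ge0// exprMn.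
rewrite real_normK ?num_real//; have /andP[_] := hc Hu; apply: le_trans.
by rewrite (bigD1 i)//= lerDl sumr_ge0// => j' _; exact: sqr_ge0.
Qed.

(** Only the transforms of the two sides are compared, so that the difference
    of two derivatives need not be recognised as a derivative. *)
Lemma wfourier_edgeB i j f g eta : schwartz H ip f -> schwartz H ip g ->
  wf' i (fun y => G i j f y - G i j g y) eta <=
  `|c2| * `|d2| * (jap eta ^+ s * wf (fun y => f y - g y) eta).
Proof.
move=> Sf Sg; have tf := schwartz_tame hH Sf; have tg := schwartz_tame hH Sg.
have tGf := schwartz_tame (hH' i) (schwartz_edge i j Sf).
have tGg := schwartz_tame (hH' i) (schwartz_edge i j Sg).
set m := ((monomial (b j) eta)%:C)%C.
have Mf := wtransform_mem hH ga eta tf; have Mg := wtransform_mem hH ga eta tg.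
have Mfg := wtransform_mem hH ga eta (tameB hH tf tg).
have M1 := wtransform_mem (hH' i) (ga' i) eta tGf.
have M2 := wtransform_mem (hH' i) (ga' i) eta tGg.
have M12 := wtransform_mem (hH' i) (ga' i) eta (tameB (hH' i) tGf tGg).
have Tf := op_mem (hT i) Mf; have Tg := op_mem (hT i) Mg.
have Tfg := op_mem (hT i) Mfg.
have Tfg' := op_mem (hT i) (hilbB hH Mf Mg).
have e : heq (ip := ip' i) (wt' i (fun y => G i j f y - G i j g y) eta)
    (m *: T i (wt (fun y => f y - g y) eta)).
  apply: (heq_trans (hH' i) (v := wt' i (G i j f) eta - wt' i (G i j g) eta)) => //.
  - exact: (hilbB (hH' i)).
  - exact: (hilbZ (hH' i)).
  - exact: (wtransformB (hH' i) (ga' i)).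
  apply: (heq_trans (hH' i) (v := m *: T i (wt f eta) - m *: T i (wt g eta))) => //.
  - exact: (hilbB (hH' i)).
  - by apply: (hilbB (hH' i)); exact: (hilbZ (hH' i)).
  - exact: (hilbZ (hH' i)).
  - apply: (heqB (hH' i)) => //; try exact: (hilbZ (hH' i)); exact: wtransform_edge.
  rewrite -scalerBr; apply: (heqZ (hH' i)) => //; first exact: (hilbB (hH' i)).
  apply: (heq_trans (hH' i) (v := T i (wt f eta - wt g eta))) => //.
  - exact: (hilbB (hH' i)).
  - apply: (heq_sym (hH' i)) => //; first exact: (hilbB (hH' i)).
    exact: (opB (hT i)).
  apply: (op_heq hH (hH' i) (hT i)) => //; first exact: (hilbB hH).
  by apply: (heq_sym hH) => //; [exact: (hilbB hH)|exact: (wtransformB hH ga)].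
rewrite {1}/wfourier (heq_norm (hH' i) M12 (hilbZ (hH' i) _ Tfg) e) (hnormZ (hH' i))//.
rewrite cabs_real (mulrC `|c2|) mulrACA ler_pM ?hnorm_ge0 ?monomial_le//.
exact: op_le.
Qed.

Lemma Wspace_edge i j (v : nat -> 'rV[R]_p -> E) : Wspace H ip kap s v ->
  Wspace (H' i) (ip' i) kap 0 (fun l => G i j (v l)).
Proof.
move=> [Sv Cv]; split=> [l|e e0]; first exact: schwartz_edge.
have c0 : 0 < `|c2| * `|d2| + 1 by rewrite ltr_wpDl ?mulr_ge0.
have [K hK] := Cv _ (divr_gt0 e0 c0); exists K => l l' lK lK'.
have tv l0 := schwartz_tame hH (Sv l0).
have tG l0 := schwartz_tame (hH' i) (schwartz_edge i j (Sv l0)).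
have h := hK l l' lK lK'.
apply: (@le_lt_trans _ _ ((`|c2| * `|d2| + 1)%:E *
    Wnorm H ip kap s (fun y => v l y - v l' y)%R)%E); last first.
  by move: h; rewrite mulrC EFinM -lte_pdivlMl.
rewrite !Wnorm_l2; apply: l2norm_le; [|exact: (borel_Wnorm hH ga _ (tameB hH (tv l) (tv l')))|exact: ltW|].
  exact: (borel_Wnorm (hH' i) (ga' i) _ (tameB (hH' i) (tG l) (tG l'))).
move=> eta; rewrite expr0 mul1r wfourier_ge0/=.
rewrite (le_trans (wfourier_edgeB i j eta (Sv l) (Sv l')))// ler_wpM2r ?lerDl//.
by rewrite mulr_ge0 ?wfourier_ge0// exprn_ge0// ltW// jap_gt0.
Qed.

(** The square norms on the right add up to the integral of the product of the
    two sums estimated in [hc] and [hd]; the estimates are multiplied under the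
    integral sign, and they survive the limit along a Cauchy sequence. *)
Lemma edge_norm_equivalence (v : nat -> 'rV[R]_p -> E) (W : \bar R) (W' : I -> B -> \bar R) :
  Wspace H ip kap s v -> W = Wlim H ip kap s v ->
  (forall i j, W' i j = Wlim (H' i) (ip' i) kap 0 (fun l => G i j (v l))) ->
  (((c1 * d1) ^+ 2)%R%:E * (W * W) <= \sum_i \sum_j W' i j * W' i j)%E /\
  (\sum_i \sum_j W' i j * W' i j <= ((c2 * d2) ^+ 2)%R%:E * (W * W))%E.
Proof.
move=> Wv WE WE'; have [Sv _] := Wv.
pose x l := Wnorm H ip kap s (v l).
pose x' (t : I * B) l := Wnorm (H' t.1) (ip' t.1) kap 0 (G t.1 t.2 (v l)).
have xW : x @ \oo --> W by rewrite WE; exact: (Wspace_cvg hH ga).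
have xW' t : x' t @ \oo --> W' t.1 t.2.
  by rewrite WE'; exact: (Wspace_cvg (hH' t.1) (ga' t.1) (Wspace_edge t.1 t.2 Wv)).
have step l : (((c1 * d1) ^+ 2)%R%:E * (x l * x l) <= \sum_t x' t l * x' t l)%E /\
    (\sum_t x' t l * x' t l <= ((c2 * d2) ^+ 2)%R%:E * (x l * x l))%E.
  have tv := schwartz_tame hH (Sv l).
  rewrite /x /x' Wnorm_l2; under eq_bigr do rewrite Wnorm_l2.
  apply: (l2norm_equiv (G := fun (t : I * B) eta => jap eta ^+ 0 * wf' t.1 (G t.1 t.2 (v l)) eta)).
  - exact: (borel_Wnorm hH ga).
  - move=> t; apply: (borel_Wnorm (hH' t.1) (ga' t.1)).
    exact: (schwartz_tame (hH' t.1) (schwartz_edge _ _ (Sv l))).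
  move=> eta; have /andP[hc1 hc2] := hc (wtransform_mem hH ga eta tv).
  have /andP[hd1 hd2] := hd eta.
  have -> : \sum_t (jap eta ^+ 0 * wf' t.1 (G t.1 t.2 (v l)) eta) ^+ 2 =
      (\sum_i hnorm (ip' i) (T i (wt (v l) eta)) ^+ 2) * (\sum_j monomial (b j) eta ^+ 2).
    rewrite mulr_suml -(pair_bigA _ (fun i j => (jap eta ^+ 0 * wf' i (G i j (v l)) eta) ^+ 2)).
    apply: eq_bigr => i _; rewrite mulr_sumr; apply: eq_bigr => j _.
    by rewrite expr0 mul1r wfourier_edge// exprMn real_normK ?num_real// mulrC.
  have e (c d : R) : (c * d) ^+ 2 * (jap eta ^+ s * wf (v l) eta) ^+ 2 =
      (c ^+ 2 * wf (v l) eta ^+ 2) * (d ^+ 2 * (jap eta ^+ s) ^+ 2) by ring.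
  by rewrite !e; apply/andP; split; apply: ler_pM => //;
    first [exact: mulr_ge0 (sqr_ge0 _) (sqr_ge0 _)|by apply: sumr_ge0 => ? _; exact: sqr_ge0].
rewrite pair_bigA /=.
have lims : (fun l => \sum_t x' t l * x' t l)%E @ \oo --> (\sum_t W' t.1 t.2 * W' t.1 t.2)%E.
  apply: cvge_sum_ge0 => [t l|t]; last exact: cvge_sqr.
  by apply: mule_ge0; exact: esqrt_ge0.
have limx (c : R) : (fun l => c%:E * (x l * x l))%E @ \oo --> (c%:E * (W * W))%E.
  by apply: cvgeZl => //; exact: cvge_sqr.
split.
  by apply: (lee_cvg_to (limx _) lims); apply: nearW => l; have [] := step l.
by apply: (lee_cvg_to lims (limx _)); apply: nearW => l; have [] := step l.
Qed.

End EdgeNormEquivalence.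

(** * The pairing on the open cylinder *)

Section Pairing.
Context {R : realType} {n : nat} (X : closed_manifold R n).
Local Notation C := R[i].
Local Notation J := 'I_(mJ X).
Local Notation cylfun := (cylfun X).
Local Notation coord := Defs.coord.
Implicit Types (u v psi : cylfun) (j : J) (z : 'rV[R]_(1 + n)).

Lemma continuous_rsubmx : continuous (fun z : 'rV[R]_(1 + n) => rsubmx z : 'rV[R]_n).
Proof.
have h : forall y y' : 'rV[R]_(1 + n), `|rsubmx y - rsubmx y'| <= `|y - y'|.
  move=> y y'; rewrite [leLHS]/Num.norm/= mx_normrE; apply/bigmax_leP.
  split=> // -[i k] _ /=; rewrite ord1.
  have -> : (rsubmx y - rsubmx y') 0 k = (y - y') 0 (rshift 1 k) by rewrite !mxE.
  exact: row_entry_le.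
move=> y; apply/(@cvgrPdist_lt _ _ _ (nbhs y) (nbhs_filter y)) => e e0.
apply/nbhs_ballP; exists e => //= y'; rewrite -ball_normE /= => yy.
by rewrite (le_lt_trans (h _ _)).
Qed.

Lemma open_cyl j : open (cyl halfline j).
Proof.
have -> : cyl halfline j = (fun z : 'rV[R]_(1 + n) => z 0 0) @^-1` [set r | 0 < r] `&`
    (fun z : 'rV[R]_(1 + n) => rsubmx z : 'rV[R]_n) @^-1` mcod j by [].
apply: openI.
  by apply: open_comp; [move=> z _; exact: coord_continuous|exact: open_gt].
by apply: open_comp; [move=> z _; exact: continuous_rsubmx|exact: (mcod_open (c := X))].
Qed.

Lemma continuous_pou j z : cyl halfline j z ->
  {for z, continuous (fun z : 'rV[R]_(1 + n) => pou j (minv j (rsubmx z)))}.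
Proof.
move=> [_ cz]; have [c _] := @pou_smooth R n X j j [::] _ cz.
apply: (continuous_comp (f := fun z : 'rV[R]_(1 + n) => rsubmx z : 'rV[R]_n)
  (g := fun y => pou j (minv j y))); last exact: c.
exact: continuous_rsubmx.
Qed.

Lemma pou_le1 j (x : X) : pou j x <= 1.
Proof.
rewrite -(pou_sum (c := X) x) (bigD1 j)//= lerDl.
by apply: sumr_ge0 => i _; exact: pou_ge0.
Qed.

Lemma borel_if (m : nat) (A : set 'rV[R]_m) (f : 'rV[R]_m -> R) :
  measurable (row_of_tuple @^-1` A : set (m.-tuple (measurableTypeR R))) ->
  borel_rV f -> borel_rV (fun y : 'rV[R]_m => if y \in A then f y else 0).
Proof.
move=> mA bf.
have bI : borel_rV (fun y : 'rV[R]_m => \1_A y : R).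
  rewrite borel_rVE.
  rewrite (_ : _ \o _ = \1_(row_of_tuple @^-1` A : set (m.-tuple (measurableTypeR R)))).
    exact: measurable_indic.
  by apply/funext => t; rewrite /= !indicE; congr (_%:R); congr nat_of_bool;
     apply/idP/idP; rewrite !inE.
rewrite (_ : (fun y => _) = fun y : 'rV[R]_m => \1_A y * f y); first exact: borel_rVM.
by apply/funext => y; rewrite indicE; case: ifP; rewrite ?mul1r ?mul0r.
Qed.

Definition pair_fun j u psi z : C :=
  if z \in cyl halfline j
  then (pou j (minv j (rsubmx z)))%:C%C * coord j u z * coord j psi z else 0.

Lemma pairingE u psi : pairing u psi = \sum_(j : J) cint (pair_fun j u psi).
Proof. by []. Qed.

Lemma pair_funC j u psi z : pair_fun j u psi z = pair_fun j psi u z.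
Proof. by rewrite /pair_fun; case: ifP => // _; rewrite mulrAC. Qed.

Lemma pair_fun_lin j (a : C) u v psi z :
  pair_fun j (a *: u + v) psi z = a * pair_fun j u psi z + pair_fun j v psi z.
Proof.
rewrite /pair_fun /coord; case: ifP => _; last by rewrite mulr0 addr0.
rewrite -[(a *: u + v) _]/(a * u _ + v _).
by ring.
Qed.

Definition borel_cyl u := forall j,
  cborel_rV (fun z => if z \in cyl halfline j then coord j u z else 0).

Lemma borel_smooth psi : smooth_cyl halfline psi -> borel_cyl psi.
Proof.
move=> Spsi j; have [S1 S2] := Spsi j; have oj := open_cyl (j := j).
split.
  rewrite (_ : (fun z => _) = fun z => if z \in cyl halfline j then complex.Re (coord j psi z) else 0).
    by apply: borel_continuous_on => // z /(S1 [::])[].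
  by apply/funext => z; case: ifP.
rewrite (_ : (fun z => _) = fun z => if z \in cyl halfline j then complex.Im (coord j psi z) else 0).
  by apply: borel_continuous_on => // z /(S2 [::])[].
by apply/funext => z; case: ifP.
Qed.

Lemma borel_pou j :
  borel_rV (fun z : 'rV[R]_(1 + n) => if z \in cyl halfline j then pou j (minv j (rsubmx z)) else 0).
Proof. by apply: borel_continuous_on; [exact: open_cyl|exact: continuous_pou]. Qed.

Lemma borel_pair_fun j u psi : borel_cyl u -> borel_cyl psi -> cborel_rV (pair_fun j u psi).
Proof.
move=> bu bp.
rewrite (_ : pair_fun j u psi = fun z =>
  ((if z \in cyl halfline j then pou j (minv j (rsubmx z)) else 0)%:C)%C *
  ((if z \in cyl halfline j then coord j u z else 0) *
  (if z \in cyl halfline j then coord j psi z else 0))); last first.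
  by apply/funext => z; rewrite /pair_fun; case: ifP => _; rewrite ?mulr0 ?mulrA.
apply: cborelM; last exact: cborelM.
by split; [exact: borel_pou|exact: borel_rV_cst].
Qed.

Definition sq_fun (I : set R) j u z : R :=
  if z \in cyl I j then pou j (minv j (rsubmx z)) * cabs2 (coord j u z) else 0.

Lemma cabs2_ge0 (a : C) : 0 <= cabs2 a.
Proof. by rewrite addr_ge0// sqr_ge0. Qed.

Lemma sq_fun_ge0 I j u z : 0 <= sq_fun I j u z.
Proof. by rewrite /sq_fun; case: ifP => // _; rewrite mulr_ge0 ?pou_ge0 ?cabs2_ge0. Qed.

Lemma borel_sq_fun (a b : R) j u : 0 < a -> borel_cyl u -> borel_rV (sq_fun `[a, b]%classic j u).
Proof.
move=> a0 bu; have [b1 b2] := bu j.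
pose A : set 'rV[R]_(1 + n) := [set z | a <= z 0 0 <= b].
have mA : measurable (row_of_tuple @^-1` A : set ((1 + n).-tuple (measurableTypeR R))).
  rewrite (_ : _ @^-1` _ = (@tnth (1 + n) R ^~ 0) @^-1` `[a, b]%classic).
    rewrite -[X in measurable X]setTI.
    by apply: measurable_tnth => //; exact: measurable_itv.
  by apply/seteqP; split=> t /=; rewrite /A /= in_itv/= mxE.
rewrite (_ : sq_fun _ j u = fun z => if z \in A then
  (if z \in cyl halfline j then pou j (minv j (rsubmx z)) else 0) *
  ((complex.Re (if z \in cyl halfline j then coord j u z else 0)) ^+ 2 +
   (complex.Im (if z \in cyl halfline j then coord j u z else 0)) ^+ 2) else 0).
  apply: borel_if => //; apply: borel_rVM; first exact: borel_pou.
  by apply: borel_rVD; exact: borel_rVX.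
apply/funext => z; rewrite /sq_fun; case: ifP => [/set_mem|].
  move=> [/=]; rewrite in_itv/= => zab cz.
  rewrite mem_set//= mem_set//; split => //=; rewrite /halfline/=.
  by case/andP: zab => az _; exact: lt_le_trans az.
move=> zc; case: ifP => // /set_mem zA; case: ifP; rewrite ?mul0r// => /set_mem[_ cz].
by exfalso; move/negP: zc; apply; apply/mem_set; split => //=; rewrite in_itv.
Qed.

Lemma L2loc_borel u : L2loc halfline u -> borel_cyl u.
Proof. by case. Qed.

Lemma L2loc_fin u (a b : R) j : 0 < a -> L2loc halfline u ->
  (iint (fun z => (sq_fun `[a, b]%classic j u z)%:E) < +oo)%E.
Proof.
move=> a0 Lu; have bu := L2loc_borel Lu; case: Lu => _ /(_ a b) h.
have {h} : (L2cyl_sq `[a, b]%classic u < +oo)%E.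
  apply: h => r /=; rewrite in_itv/= => /andP[ar _].
  exact: lt_le_trans ar.
apply: le_lt_trans; rewrite /L2cyl_sq (bigD1 j isT).
rewrite leeDl// sume_ge0// => i _; apply: iint_ge0; first exact: sq_fun_ge0.
exact: borel_sq_fun.
Qed.

(** The manifold is compact and the supports of the partition of unity are
    closed. On such a set the local expressions of a test function are
    bounded. *)
Lemma pou_compact (a b : R) j : 0 < a -> exists K : set 'rV[R]_(1 + n),
  [/\ compact K, K `<=` cyl halfline j &
    forall z, cyl `[a, b]%classic j z -> pou j (minv j (rsubmx z)) != 0 -> K z].
Proof.
move=> a0; pose Q : set X := closure [set x | pou j x != 0].
have cQ : compact Q.
  by apply: (subclosed_compact _ (mcompact (c := X))) => //; exact: closed_closure.
have Qdom : Q `<=` mdom j := pou_supp (c := X) (j := j).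
pose S : set 'rV[R]_n := mchart j @` Q.
have cS : compact S.
  apply: continuous_compact => //; apply: continuous_in_subspaceT => x /set_mem Qx.
  exact: (mchart_cont (Qdom _ Qx)).
have clS : closed S by apply: compact_closed => //; exact: norm_hausdorff.
pose K : set 'rV[R]_(1 + n) := [set z : 'rV[R]_(1 + n) | a <= z 0 0 <= b /\ S (rsubmx z)].
exists K; split.
- have [M [_ hM]] := compact_bounded cS.
  apply: bounded_closed_compact.
    exists (Num.max (Num.max `|a| `|b|) (M + 1)); split; first exact: num_real.
    move=> r hr z [/andP[az zb] Sz] /=; apply: le_trans (ltW hr).
    rewrite [leLHS]/Num.norm/= mx_normrE; apply/bigmax_leP; split=> [|[i k] _ /=].
      by rewrite !le_max normr_ge0.
    rewrite (ord1 i); case: (@splitP 1 n k) => l kl.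
      have -> : k = 0 by apply/val_inj; rewrite /= [LHS]kl ord1.
      rewrite !le_max; apply/orP; left.
      have z0 : 0 <= z 0 0 by rewrite (le_trans (ltW a0)).
      by rewrite (ger0_norm z0) (le_trans zb (ler_norm b)) orbT.
    have -> : z 0 k = (rsubmx z) 0 l by rewrite mxE; congr (z _ _); exact/val_inj.
    rewrite le_max; apply/orP; right; rewrite (le_trans (row_entry_le _ _))//.
    by apply: (hM (M + 1)) => //; rewrite ltrDl.
  have -> : K = (fun z : 'rV[R]_(1 + n) => z 0 0) @^-1` [set r | r >= a] `&`
     (fun z : 'rV[R]_(1 + n) => z 0 0) @^-1` [set r | r <= b] `&`
     (fun z : 'rV[R]_(1 + n) => rsubmx z : 'rV[R]_n) @^-1` S.
    apply/seteqP; split => z /=; first by move=> [/andP[]].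
    by move=> [[az zb] ?]; rewrite /K /= az zb.
  apply: closedI; [apply: closedI|]; apply: closed_comp => //.
  + by move=> z _; exact: coord_continuous.
  + by move=> z _; exact: coord_continuous.
  + by move=> z _; exact: continuous_rsubmx.
- move=> z [/andP[az _] [x Qx xz]]; split; first exact: lt_le_trans az.
  by exists x => //; exact: Qdom.
move=> z [/=]; rewrite in_itv/= => zab [x dx xz] pz; split => //.
exists x => //; apply: subset_closure => /=.
by rewrite -(mchartK dx) xz.
Qed.

End Pairing.

Section TestFunctions.
Context {R : realType} {n : nat} {X : closed_manifold R n}.
Local Notation C := R[i].
Local Notation J := 'I_(mJ X).
Local Notation cylfun := (cylfun X).
Local Notation coord := Defs.coord.
Implicit Types (u v psi phi : cylfun) (j : J) (z : 'rV[R]_(1 + n)).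

Lemma continuous_cabs2_coord j psi z : smooth_cyl halfline psi -> cyl halfline j z ->
  {for z, continuous (fun z => cabs2 (coord j psi z))}.
Proof.
move=> Sp cz; have [S1 S2] := Sp j.
have [c1 _] := S1 [::] _ cz; have [c2 _] := S2 [::] _ cz.
have -> : (fun z => cabs2 (coord j psi z)) =
  (fun z => complex.Re (coord j psi z) * complex.Re (coord j psi z) +
            complex.Im (coord j psi z) * complex.Im (coord j psi z)).
  by apply/funext => y; rewrite /cabs2 !expr2.
by apply: continuousD; apply: continuousM.
Qed.

Lemma compact_ub (m : nat) (K : set 'rV[R]_m) (f : 'rV[R]_m -> R) : compact K ->
  (forall y, K y -> {for y, continuous f}) -> exists2 M : R, 0 <= M & forall y, K y -> f y <= M.
Proof.
move=> cK cf; have [[y0 Ky0]|K0] := pselect (K !=set0); last first.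
  by exists 0 => // y Ky; exfalso; apply: K0; exists y.
have [c _ hc] := EVT_max_rV (ex_intro _ _ Ky0) cK
  (continuous_in_subspaceT (fun y Ky => cf y (set_mem Ky))).
exists `|f c| => // y Ky; rewrite (le_trans _ (ler_norm _))// hc//.
exact/mem_set.
Qed.

(** In a chart the density is bounded and vanishes off a compact set, hence it is
    dominated by a multiple of a negative power of <z>. *)
Lemma testf_fin psi (a b : R) j : 0 < a -> testf psi ->
  L1 (sq_fun `[a, b]%classic j psi).
Proof.
move=> a0 [Sp _]; have [K [cK Kcyl hK]] := pou_compact b j a0.
have [M M0 hM] : exists2 M : R, 0 <= M & forall y, K y -> cabs2 (coord j psi y) <= M.
  by apply: compact_ub => // y Ky; apply: continuous_cabs2_coord => //; exact: Kcyl.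
have [B B0 hB] : exists2 B : R, 0 <= B & forall y, K y -> jap y ^+ (2 * (1 + n)) <= B.
  apply: compact_ub => // y _.
  apply: (continuous_comp (f := @jap R (1 + n)) (g := fun r => r ^+ (2 * (1 + n)))).
    exact: continuous_jap.
  exact: exprn_continuous.
apply: (L1_dom (g := fun y => (M * B) * (jap y)^-1 ^+ (2 * (1 + n)))).
- by apply: borel_sq_fun => //; exact: borel_smooth.
- exact: L1_japV.
move=> y; rewrite ger0_norm ?sq_fun_ge0// /sq_fun.
have R0 : 0 <= M * B * (jap y)^-1 ^+ (2 * (1 + n)).
  by rewrite mulr_ge0 ?mulr_ge0// exprn_ge0// invr_ge0 ltW// jap_gt0.
case: ifP => [/set_mem cy|//].
have [->|p0] := eqVneq (pou j (minv j (rsubmx y))) 0; first by rewrite mul0r.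
have Ky := hK _ cy p0.
apply: (le_trans (y := M)).
  rewrite -[leRHS]mul1r ler_pM ?pou_ge0 ?pou_le1 ?cabs2_ge0//; exact: hM.
rewrite -mulrA ler_peMr// exprVn ler_pdivlMr ?exprn_gt0 ?jap_gt0// mul1r.
exact: hB.
Qed.

Lemma testf_borel psi : testf psi -> borel_cyl psi.
Proof. by move=> [Sp _]; exact: borel_smooth. Qed.

Lemma L1_of_fin (m : nat) (f : 'rV[R]_m -> R) : borel_rV f -> (forall y, 0 <= f y) ->
  (iint (fun y => (f y)%:E) < +oo)%E -> L1 f.
Proof. by move=> bf f0 fi; split => //; under eq_fun do rewrite ger0_norm//. Qed.

(** A common generalization of [L2loc] and [testf], sufficient for the pairing
    with test functions to converge and to be bilinear. *)
Definition locally_L2 u := borel_cyl u /\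
  forall (a b : R) j, 0 < a -> L1 (sq_fun `[a, b]%classic j u).

Lemma L2loc_locally u : L2loc halfline u -> locally_L2 u.
Proof.
move=> Lu; have bu := L2loc_borel Lu; split => // a b j a0.
apply: L1_of_fin; [exact: borel_sq_fun|exact: sq_fun_ge0|exact: L2loc_fin].
Qed.

Lemma testf_locally psi : testf psi -> locally_L2 psi.
Proof. by move=> tp; split => [|a b j a0]; [exact: testf_borel|exact: testf_fin]. Qed.

Lemma cL1_pair_fun j u psi : locally_L2 u -> testf psi -> cL1 (pair_fun j u psi).
Proof.
move=> [bu Lu] tp; have [_ [a [b [a0 pab]]]] := tp.
apply: (cL1_dom (g := fun z => sq_fun `[a, b]%classic j u z + sq_fun `[a, b]%classic j psi z)).
- by apply: borel_pair_fun => //; exact: testf_borel.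
- by apply: L1D; [exact: Lu|exact: testf_fin].
move=> z; rewrite /pair_fun /sq_fun.
have [zh|zh] := boolP (z \in cyl halfline j); last first.
  rewrite /cabs /cabs2 /= expr0n addr0 sqrtr0.
  by case: ifP => _; rewrite addr_ge0// mulr_ge0 ?pou_ge0 ?cabs2_ge0.
have [zab|zab] := pselect (a <= z 0 0 <= b); last first.
  rewrite {2}/Defs.coord pab// mulr0 /cabs /cabs2 /= expr0n addr0 sqrtr0.
  by case: ifP => _; rewrite addr_ge0// mulr_ge0 ?pou_ge0 ?cabs2_ge0.
rewrite mem_set; last by split; [rewrite /= in_itv|case/set_mem: zh].
rewrite -mulrDr !cabsM cabs_real ger0_norm ?pou_ge0// -mulrA ler_wpM2l ?pou_ge0//.
move: (coord j u z) (coord j psi z) => p q.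
have sp (c : C) : cabs c ^+ 2 = cabs2 c by rewrite sqr_sqrtr// cabs2_ge0.
rewrite -!sp; have := sqr_ge0 (cabs p - cabs q); have := sqr_ge0 (cabs p + cabs q); nra.
Qed.

Lemma pairing_lin (a : C) u v psi : locally_L2 u -> locally_L2 v -> testf psi ->
  pairing (a *: u + v) psi = a * pairing u psi + pairing v psi.
Proof.
move=> Lu Lv tp; rewrite !pairingE mulr_sumr -big_split /=; apply: eq_bigr => j _.
rewrite -cint_lin; [|exact: cL1_pair_fun|exact: cL1_pair_fun].
by congr cint; apply/funext => z; rewrite pair_fun_lin.
Qed.

Lemma pairing0 psi : pairing (0 : cylfun) psi = 0.
Proof.
rewrite pairingE big1// => j _.
rewrite (_ : pair_fun j 0 psi = fun _ => 0) ?cint0//.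
by apply/funext => z; rewrite /pair_fun; case: ifP => // _; rewrite mulr0 mul0r.
Qed.

(** [smooth_on] is a condition on all iterated derivatives at once; a class of
    functions that is closed under partial derivatives makes the induction
    go through. *)
Lemma smooth_class (m : nat) (A : set 'rV[R]_m) (S : set ('rV[R]_m -> R)) : open A ->
  (forall h, S h -> forall x, A x -> {for x, continuous h} /\
     forall i, derivable h x (delta_mx 0 i : 'rV[R]_m)) ->
  (forall h i, S h -> exists2 h', S h' & forall x, A x -> 'D_(delta_mx 0 i : 'rV[R]_m) h x = h' x) ->
  forall h, S h -> smooth_on A h.
Proof.
move=> oA S1 S2 h Sh.
have key l : exists2 h', S h' & forall x, A x -> pd l h x = h' x.
  elim: l => [|i l [h1 Sh1 hE]]; first by exists h.
  have [h2 Sh2 h2E] := S2 h1 i Sh1; exists h2 => // x Ax.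
  rewrite /= -h2E//; apply: near_eq_derive.
  by near=> y; apply: hE; near: y; exact: open_nbhs_nbhs.
move=> l x Ax; have [h' Sh' hE] := key l.
have [c d] := S1 _ Sh' _ Ax.
have e : \near x, h' x = pd l h x.
  by near=> y; apply/esym/hE; near: y; exact: open_nbhs_nbhs.
split=> [|i]; last by have := d i; exact: (@near_eq_derivable _ _ _ _ _ _ _ e).
rewrite /prop_for/continuous_at hE//; apply: cvg_trans c.
exact: near_eq_cvg e.
Unshelve. all: by end_near. Qed.

End TestFunctions.

(** * Stability of smooth functions *)

Section SmoothAlgebra.
Context {R : realType} {m : nat}.
Implicit Types (A : set 'rV[R]_m) (f g h : 'rV[R]_m -> R).
Local Notation De i := (delta_mx 0 i : 'rV[R]_m).

(** Inductive, so that the sum and product rules are proved by induction on how a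
    function is built. *)
Inductive algebra (G : set ('rV[R]_m -> R)) : set ('rV[R]_m -> R) :=
| AlgGen h : G h -> algebra G h
| AlgAdd h1 h2 : algebra G h1 -> algebra G h2 -> algebra G (fun x => h1 x + h2 x)
| AlgMul h1 h2 : algebra G h1 -> algebra G h2 -> algebra G (fun x => h1 x * h2 x).

(** The sum and product rules keep derivatives inside the algebra. *)
Lemma smooth_algebra A (G : set ('rV[R]_m -> R)) : open A ->
  (forall h, G h -> forall x, A x -> {for x, continuous h} /\
     forall i, derivable h x (De i)) ->
  (forall h i, G h -> exists2 h', algebra G h' & forall x, A x -> 'D_(De i) h x = h' x) ->
  forall h, algebra G h -> smooth_on A h.
Proof.
move=> oA G1 G2.
have key h : algebra G h -> forall x, A x -> {for x, continuous h} /\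
     forall i, derivable h x (De i).
  elim=> [f Gf x Ax|f g _ If _ Ig x Ax|f g _ If _ Ig x Ax]; first exact: G1.
    have [cf df] := If x Ax; have [cg dg] := Ig x Ax.
    by split=> [|i]; [exact: continuousD|exact: derivableD].
  have [cf df] := If x Ax; have [cg dg] := Ig x Ax.
  by split=> [|i]; [exact: continuousM|exact: derivableM].
apply: smooth_class => //.
move=> h i; elim=> [f Gf|f g Af [f' Af' f'E] Ag [g' Ag' g'E]|f g Af [f' Af' f'E] Ag [g' Ag' g'E]].
- exact: G2.
- exists (fun x => f' x + g' x); first exact: AlgAdd.
  move=> x Ax; rewrite -f'E// -g'E// deriveD//.
    by have [_ /(_ i)] := key _ Af _ Ax.
  by have [_ /(_ i)] := key _ Ag _ Ax.
exists (fun x => f x * g' x + g x * f' x); first by apply: AlgAdd; exact: AlgMul.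
move=> x Ax; rewrite -f'E// -g'E// deriveM//.
  by have [_ /(_ i)] := key _ Af _ Ax.
by have [_ /(_ i)] := key _ Ag _ Ax.
Qed.

Lemma smooth_pd_algebra A (F : set ('rV[R]_m -> R)) : open A ->
  (forall f, F f -> smooth_on A f) ->
  forall h, algebra [set h | exists2 f, F f & exists l, h = pd l f] h -> smooth_on A h.
Proof.
move=> oA SF; apply: smooth_algebra => //.
  by move=> _ [f Ff [l ->]] x Ax; exact: (SF _ Ff l x Ax).
move=> _ i [f Ff [l ->]]; exists (pd (i :: l) f) => //.
by apply: AlgGen; exists f => //; exists (i :: l).
Qed.

Lemma smooth_onD A f g : open A -> smooth_on A f -> smooth_on A g ->
  smooth_on A (fun x => f x + g x).
Proof.
move=> oA Sf Sg; apply: (smooth_pd_algebra (F := [set h | h = f \/ h = g]) oA).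
  by move=> h [->|->].
apply: AlgAdd; apply: AlgGen; [exists f|exists g]; rewrite /=; auto; by exists [::].
Qed.

Lemma smooth_onM A f g : open A -> smooth_on A f -> smooth_on A g ->
  smooth_on A (fun x => f x * g x).
Proof.
move=> oA Sf Sg; apply: (smooth_pd_algebra (F := [set h | h = f \/ h = g]) oA).
  by move=> h [->|->].
apply: AlgMul; apply: AlgGen; [exists f|exists g]; rewrite /=; auto; by exists [::].
Qed.

Lemma smooth_on_cst A (c : R) : open A -> smooth_on A (fun=> c).
Proof.
move=> oA; apply: (smooth_class oA (S := [set h | exists c : R, h = fun=> c])).
- by move=> _ [d ->] x Ax; split=> [|i]; [exact: cst_continuous|exact: derivable_cst].
- by move=> _ i [d ->]; exists (fun=> 0); [exists 0|move=> x _; rewrite derive_cst].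
by exists c.
Qed.

Lemma smooth_on_comb A f g h (a b : R) : open A -> smooth_on A f -> smooth_on A g ->
  smooth_on A h -> smooth_on A (fun x => (a * f x + b * g x) + h x).
Proof.
move=> oA Sf Sg Sh; apply: (smooth_onD oA _ Sh).
apply: (smooth_onD oA); first exact: (smooth_onM oA (smooth_on_cst _ oA) Sf).
exact: (smooth_onM oA (smooth_on_cst _ oA) Sg).
Qed.

Lemma smooth_onN A f : open A -> smooth_on A f -> smooth_on A (fun x => - f x).
Proof.
move=> oA Sf; rewrite (_ : (fun x => _) = fun x => (-1) * f x).
  by apply: smooth_onM => //; exact: smooth_on_cst.
by apply/funext => x; rewrite mulN1r.
Qed.

End SmoothAlgebra.

Section JapPower.
Context {R : realType} {n : nat}.
Local Notation V := 'rV[R]_(1 + n).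

Lemma is_derive_first (F : R -> R) (F' : R) (z v : V) : is_derive (z 0 0) 1 F F' ->
  is_derive z v (fun z : V => F (z 0 0)) (v 0 0 * F').
Proof.
move=> dF.
have dc : differentiable (fun z : V => z 0 0 : R) z by exact: differentiable_coord.
have d1 : differentiable F (z 0 0) by apply/derivable1_diffP; case: dF.
apply: DeriveDef; first by apply/diff_derivable/(differentiable_comp dc d1).
rewrite deriveE; last exact: (differentiable_comp dc d1).
rewrite (diff_comp dc d1) /= diff1E//.
have lc : linear (fun z : V => z 0 0 : R) by move=> a x y; rewrite !mxE.
pose cc : {linear V -> R} := HB.pack (fun z : V => z 0 0 : R) (GRing.isLinear.Build _ _ _ _ _ lc).
have -> : 'd (fun z : V => z 0 0 : R) z v = v 0 0.
  rewrite (_ : (fun z : V => z 0 0 : R) = cc)// diff_lin//.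
  exact: coord_continuous.
by rewrite derive1E derive_val.
Qed.

(** The algebra generated by the constants, the first coordinate and all powers
    of this form is stable under derivatives. *)
Lemma smooth_first_powR (a : R) :
  smooth_on setT (fun z : V => (1 + z 0 0 ^+ 2) `^ a).
Proof.
pose G : set (V -> R) := [set h | (exists c : R, h = fun=> c) \/
  h = (fun z : V => z 0 0) \/ exists b : R, h = fun z : V => (1 + z 0 0 ^+ 2) `^ b].
have p0 (r : R) : 0 < 1 + r ^+ 2 by rewrite ltr_pwDl// sqr_ge0.
have dp (b r : R) : is_derive r 1 (fun r => (1 + r ^+ 2) `^ b) ((2 * b) * r * (1 + r ^+ 2) `^ (b - 1)).
  have h1 : is_derive r 1 (fun r : R => 1 + r ^+ 2) (2 * r).
    by apply: is_derive_eq; rewrite /GRing.scale /=; ring.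
  have h2 := is_derive1_powR b (p0 r).
  have := @is_derive1_comp _ (fun x => x `^ b) (fun r : R => 1 + r ^+ 2) r _ _ h2 h1.
  by move=> h; apply: is_derive_eq; rewrite /GRing.scale /=; ring.
apply: (smooth_algebra (G := G)); first exact: openT.
- move=> h Gh x _.
  suff : differentiable h x.
    by move=> d; split; [exact: differentiable_continuous|move=> i; exact: diff_derivable].
  case: Gh => [[c ->]|[->|[b ->]]]; first exact: differentiable_cst.
    exact: differentiable_coord.
  apply: (differentiable_comp (f := fun z : V => z 0 0 : R) (g := fun r => (1 + r ^+ 2) `^ b)).
    exact: differentiable_coord.
  by apply/derivable1_diffP; case: (dp b (x 0 0)).
- move=> h i [[c ->]|[->|[b ->]]].
  + exists (fun=> 0); first by apply: AlgGen; left; exists 0.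
    by move=> x _; rewrite derive_cst.
  + exists (fun=> (delta_mx 0 i : V) 0 0); first by apply: AlgGen; left; eexists.
    move=> x _; have := is_derive_first (delta_mx 0 i : V) (is_derive_id (x 0 0 : R) 1).
    by move=> d; rewrite derive_val mulr1.
  + exists (fun x => (((delta_mx 0 i : V) 0 0 * (2 * b)) * x 0 0) * (1 + x 0 0 ^+ 2) `^ (b - 1)).
      apply: AlgMul; last by apply: AlgGen; right; right; eexists.
      apply: AlgMul; last by apply: AlgGen; right; left.
      by apply: AlgGen; left; eexists.
    move=> x _; have d := is_derive_first (delta_mx 0 i : V) (dp b (x 0 0)).
    by rewrite derive_val; ring.
by apply: AlgGen; right; right; exists a.
Qed.

Lemma jap1_powR (e r : R) : jap1 r `^ e = (1 + r ^+ 2) `^ (e / 2).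
Proof. by rewrite /jap1 -powR12_sqrt ?addr_ge0 ?sqr_ge0// -powRrM mulrC. Qed.

Lemma smooth_jap1 (e : R) : smooth_on setT (fun z : V => jap1 (z 0 0) `^ e).
Proof. by under eq_fun do rewrite jap1_powR; exact: smooth_first_powR. Qed.

End JapPower.

(** * Integrals of nonnegative functions *)

Section NonnegativeIntegrals.
Context {R : realType} {m : nat}.
Implicit Types (f g : 'rV[R]_m -> R).

Lemma rint_ge0E f : L1 f -> (forall x, 0 <= f x) ->
  (rint f)%:E = iint (fun x => (f x)%:E).
Proof.
move=> Lf f0; have [bf fi] := Lf; rewrite rintE// /Rintegral -ge0_iintE// fineK//.
rewrite ge0_fin_numE ?iint_ge0//; apply: le_lt_trans fi.
by under [X in (_ <= iint X)%E]eq_fun do rewrite ger0_norm//.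
Qed.

Lemma rint_ge0 f : L1 f -> (forall x, 0 <= f x) -> 0 <= rint f.
Proof. by move=> Lf f0; rewrite -lee_fin rint_ge0E// iint_ge0//; case: Lf. Qed.

Lemma rint_eq0 f g : L1 f -> L1 g -> (forall x, 0 <= g x) ->
  (forall x, g x = 0 -> f x = 0) -> rint g = 0 -> rint f = 0.
Proof.
move=> Lf Lg g0 gf Ig.
have Ln : L1 (fun x => `|f x|).
  by split; [case: Lf => bf _; exact: borel_rV_norm|case: Lf => _; under eq_fun do rewrite -normr_id].
have In : rint (fun x => `|f x|) = 0.
  apply: EFin_inj; rewrite rint_ge0E//.
  apply: (iint_eq0 (f := g)) => //; [by case: Lg|by case: Ln|..].
    by move=> x /gf ->; rewrite normr0.
  by rewrite -rint_ge0E// Ig.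
by apply/normr0_eq0/le_anti; rewrite normr_ge0 andbT -In; exact: rint_norm.
Qed.

End NonnegativeIntegrals.

(** * Weak action of differential operators *)

Section WeakAction.
Context {R : realType} {n : nat} {X : closed_manifold R n}.
Local Notation C := R[i].
Local Notation J := 'I_(mJ X).
Local Notation cylfun := (cylfun X).
Local Notation coord := Defs.coord.
Implicit Types (u v g psi phi : cylfun) (j : J) (z : 'rV[R]_(1 + n)) (P : cylfun -> cylfun).

Definition conjf psi : cylfun := fun rx => conjc (psi rx).

Lemma testf_conj psi : testf psi -> testf (conjf psi).
Proof.
move=> [Sp [a [b [a0 pab]]]]; split; last first.
  by exists a, b; split => // r x rab; rewrite /conjf pab// /= oppr0.
move=> j; have [S1 S2] := Sp j; split.
  by rewrite (_ : (fun x => _) = fun x => complex.Re (coord j psi x))//;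
     apply/funext => x; rewrite /Defs.coord /conjf; case: (psi _).
rewrite (_ : (fun x => _) = fun x => - complex.Im (coord j psi x)).
  by apply: smooth_onN => //; exact: open_cyl.
by apply/funext => x; rewrite /Defs.coord /conjf; case: (psi _).
Qed.

Lemma testf_lin (c : C) phi psi : testf phi -> testf psi -> testf (c *: phi + psi).
Proof.
move=> [Sf [a [b [a0 fab]]]] [Sg [a' [b' [a'0 gab]]]]; split.
  move=> j; have [F1 F2] := Sf j; have [G1 G2] := Sg j; have oj := open_cyl (j := j).
  split.
    rewrite (_ : (fun x => _) = fun x =>
      (complex.Re c * complex.Re (coord j phi x) + (- complex.Im c) * complex.Im (coord j phi x))
       + complex.Re (coord j psi x)); first exact: smooth_on_comb oj F1 F2 G1.
    apply/funext => x; rewrite /Defs.coord -[(c *: phi + psi) _]/(c * phi _ + psi _).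
    by rewrite mulNr; case: (c) (phi _) (psi _) => [? ?] [? ?] [? ?].
  rewrite (_ : (fun x => _) = fun x =>
      (complex.Re c * complex.Im (coord j phi x) + complex.Im c * complex.Re (coord j phi x))
       + complex.Im (coord j psi x)); first exact: smooth_on_comb oj F2 F1 G2.
  apply/funext => x; rewrite /Defs.coord -[(c *: phi + psi) _]/(c * phi _ + psi _).
  by case: (c) (phi _) (psi _) => [? ?] [? ?] [? ?].
exists (Num.min a a'), (Num.max b b'); split; first by rewrite lt_min a0.
move=> r x rab; rewrite -[(c *: phi + psi) _]/(c * phi _ + psi _).
rewrite fab ?gab ?mulr0 ?addr0//; apply: contra_not rab => /andP[r1 r2].
  by rewrite ge_min le_max r1 r2 !orbT.
by rewrite ge_min le_max r1 r2.
Qed.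

Lemma testf_mulr_pow (e : R) psi : testf psi -> testf (mulr_pow e psi).
Proof.
move=> [Sp [a [b [a0 pab]]]]; split; last first.
  by exists a, b; split => // r x rab; rewrite /mulr_pow pab// mulr0.
move=> j; have [S1 S2] := Sp j; have oj := open_cyl (j := j).
have SJ : smooth_on (cyl halfline j) (fun z : 'rV[R]_(1 + n) => jap1 (z 0 0) `^ e).
  by move=> l x _; exact: smooth_jap1.
split.
  rewrite (_ : (fun x => _) = fun x : 'rV[R]_(1 + n) => jap1 (x 0 0) `^ e * complex.Re (coord j psi x)).
    exact: smooth_onM.
  apply/funext => x; rewrite /Defs.coord /mulr_pow /=; case: (psi _) => a1 a2 /=.
  by rewrite mul0r subr0.
rewrite (_ : (fun x => _) = fun x : 'rV[R]_(1 + n) => jap1 (x 0 0) `^ e * complex.Im (coord j psi x)).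
  exact: smooth_onM.
apply/funext => x; rewrite /Defs.coord /mulr_pow /=; case: (psi _) => a1 a2 /=.
by rewrite mul0r addr0.
Qed.

Lemma pairing_mulr_pow (e : R) u psi :
  pairing (mulr_pow e u) psi = pairing u (mulr_pow e psi).
Proof.
rewrite !pairingE; apply: eq_bigr => j _; congr cint; apply/funext => z.
by rewrite /pair_fun /Defs.coord /mulr_pow; case: ifP => // _ /=; ring.
Qed.

Lemma Re_mul_conjc (c : C) : complex.Re (c * conjc c) = cabs2 c.
Proof. by case: c => a b; rewrite /cabs2 /=; ring. Qed.

(** The conjugate of [d] is itself an admissible test function, so that the
    pairing controls the integral of the square of [d]. *)
Lemma pairing_conj_eq0 d u : testf d -> pairing (conjf d) d = 0 -> locally_L2 u ->
  pairing u d = 0.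
Proof.
move=> td d0 Lu; have tc := testf_conj td.
have cL j := cL1_pair_fun j (testf_locally tc) td.
have sq j z : complex.Re (pair_fun j (conjf d) d z) =
    if z \in cyl halfline j then pou j (minv j (rsubmx z)) * cabs2 (coord j d z) else 0.
  rewrite /pair_fun; case: ifP => // _; rewrite /conjf /Defs.coord -mulrA.
  rewrite [_ * d _]mulrC -Re_mul_conjc.
  by case: (d _ * _) => a b /=; rewrite mul0r subr0.
have sq0 j z : 0 <= complex.Re (pair_fun j (conjf d) d z).
  by rewrite sq; case: ifP => // _; rewrite mulr_ge0 ?pou_ge0 ?cabs2_ge0.
have fE j : rint (fun z => complex.Re (pair_fun j (conjf d) d z)) = 0.
  have s0 : \sum_(j : J) rint (fun z => complex.Re (pair_fun j (conjf d) d z)) = 0.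
    have := congr1 (@complex.Re R) d0; rewrite pairingE raddf_sum /= => h.
    by rewrite -[RHS]h.
  have ge j' : 0 <= rint (fun z => complex.Re (pair_fun j' (conjf d) d z)).
    by apply: rint_ge0 => //; case: (cL j').
  apply/eqP; move/eqP: s0; rewrite psumr_eq0//= => /allP/(_ j).
  by rewrite mem_index_enum => /(_ isT).
rewrite pairingE big1// => j _; have [cR cI] := cL1_pair_fun j Lu td.
have part (F : 'rV[R]_(1 + n) -> R) : L1 F ->
    (forall z, pair_fun j u d z = 0 -> F z = 0) -> rint F = 0.
  move=> LF F0; apply: (rint_eq0 LF (cL j).1) => // z.
  rewrite sq; case: ifP => [zc /eqP|zc _]; last by apply: F0; rewrite /pair_fun zc.
  rewrite mulf_eq0 => /orP[] /eqP h; apply: F0; rewrite /pair_fun zc.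
    by rewrite h !mul0r.
  by rewrite (@cabs_eq0 R (coord j d z)) ?mulr0// /cabs h sqrtr0.
by rewrite /cint !part// => z ->.
Qed.

End WeakAction.

Section WeakDerivatives.
Context {R : realType} {n : nat} {X : closed_manifold R n}.
Local Notation C := R[i].
Local Notation J := 'I_(mJ X).
Local Notation cylfun := (cylfun X).
Implicit Types (u v g psi phi : cylfun) (j : J) (P : cylfun -> cylfun).

(** The difference of [a] and [b] and its conjugate are test functions, so that
    the difference is orthogonal to itself. *)
Lemma pairing_testf_ext a b u : testf a -> testf b ->
  (forall phi, testf phi -> pairing phi a = pairing phi b) ->
  locally_L2 u -> pairing u a = pairing u b.
Proof.
move=> ta tb ab Lu; pose d : cylfun := (-1) *: b + a.
have td : testf d by exact: testf_lin.
have dE v : locally_L2 v -> testf v \/ v = u -> pairing v d = - pairing v b + pairing v a.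
  move=> Lv tv; rewrite !pairingE -sumrN -big_split; apply: eq_bigr => j _ /=.
  have := @cint_lin R (1 + n) (-1) _ _ (cL1_pair_fun j Lv tb) (cL1_pair_fun j Lv ta).
  rewrite mulN1r => <-; congr cint; apply/funext => z.
  by rewrite pair_funC /d pair_fun_lin pair_funC [pair_fun j a v z]pair_funC.
have tc := testf_conj td.
have d0 : pairing (conjf d) d = 0.
  rewrite dE ?ab ?addNr//; first exact: testf_locally.
  by left.
have := pairing_conj_eq0 td d0 Lu; rewrite dE//; last by right.
by move/eqP; rewrite addrC subr_eq0 => /eqP.
Qed.

(** Each hypothesis brings its own transpose of [P]; they need not be equal, but
    they have the same pairings with test functions, hence by
    [pairing_testf_ext] with locally square integrable functions. *)
Lemma weakly_lin P (c : C) u1 u2 g1 g2 g3 psi :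
  weakly P u1 g1 -> weakly P u2 g2 -> weakly P (c *: u1 + u2) g3 -> testf psi ->
  pairing g3 psi = c * pairing g1 psi + pairing g2 psi.
Proof.
move=> [/L2loc_locally L1 _ [Q1 [t1 tr1 w1]]] [/L2loc_locally L2 _ [Q2 [t2 tr2 w2]]].
move=> [_ _ [Q3 [t3 tr3 w3]]] tp.
rewrite -(w3 _ tp) pairing_lin//; last exact: t3.
rewrite -(w1 _ tp) -(w2 _ tp).
rewrite (pairing_testf_ext (b := Q3 psi) (t1 _ tp))//; [|exact: t3|].
  rewrite (pairing_testf_ext (a := Q2 psi) (b := Q3 psi) (t2 _ tp))//; first exact: t3.
  by move=> phi tf; rewrite -tr2// -tr3.
by move=> phi tf; rewrite -tr1// -tr3.
Qed.

Lemma weakly_uniq P u g g' psi : weakly P u g -> weakly P u g' -> testf psi ->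
  pairing g psi = pairing g' psi.
Proof.
move=> [/L2loc_locally L1 _ [Q1 [t1 tr1 w1]]] [_ _ [Q2 [t2 tr2 w2]]] tp.
rewrite -w1// -w2//; apply: pairing_testf_ext => //; [exact: t1|exact: t2|].
by move=> phi tf; rewrite -tr1// -tr2.
Qed.

Lemma cabs2M (a b : C) : cabs2 (a * b) = cabs2 a * cabs2 b.
Proof. by case: a b => ? ? [? ?]; rewrite /cabs2 /=; ring. Qed.

Lemma L2loc_scale (c : C) u : L2loc halfline u -> L2loc halfline (c *: u).
Proof.
move=> Lu; have bu := L2loc_borel Lu.
have sqZ (I : set R) j z : sq_fun I j (c *: u) z = cabs2 c * sq_fun I j u z.
  rewrite /sq_fun; case: ifP => _; last by rewrite mulr0.
  by rewrite /Defs.coord -[(c *: u) _]/(c * u _) cabs2M mulrCA.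
split.
  move=> j; have [b1 b2] := bu j; rewrite (_ : (fun z => _) = fun z =>
    c * (if z \in cyl halfline j then Defs.coord j u z else 0)).
    by apply: cborelM => //; split; exact: borel_rV_cst.
  by apply/funext => z; case: ifP; rewrite ?mulr0.
move=> a b ab; have [ab0|ba] := leP a b; last first.
  rewrite /L2cyl_sq big1 ?ltry// => j _.
  rewrite (_ : (fun z => _) = fun=> 0%E) ?iint0//.
  apply/funext => z; case: ifP => // /set_mem[] /=; rewrite in_itv/= => /andP[h1 h2] _.
  by have := lt_le_trans ba (le_trans h1 h2); rewrite ltxx.
have a0 : 0 < a by apply: (ab a); rewrite /= in_itv/= lexx ab0.
rewrite /L2cyl_sq; apply: lte_sum_pinfty => j _.
rewrite -[X in iint X]/(fun z => (sq_fun `[a, b]%classic j (c *: u) z)%:E).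
under eq_fun do rewrite sqZ.
rewrite iintZ ?cabs2_ge0//; [|exact: sq_fun_ge0|exact: borel_sq_fun].
rewrite lte_mul_pinfty ?lee_fin ?cabs2_ge0//.
exact: L2loc_fin.
Qed.

Lemma weakly_scale P (c : C) u g : weakly P u g -> weakly P (c *: u) (c *: g).
Proof.
move=> [Lu Lg [Q [tQ trQ wQ]]]; split; [exact: L2loc_scale|exact: L2loc_scale|].
have p0 v psi : locally_L2 v -> testf psi -> pairing (c *: v) psi = c * pairing v psi.
  move=> Lv tp; rewrite !pairingE mulr_sumr; apply: eq_bigr => j _.
  have c0 : cL1 (fun _ : 'rV[R]_(1 + n) => 0 : C) by exact: cL1_0.
  have := cint_lin c (cL1_pair_fun j Lv tp) c0.
  rewrite cint0 addr0 => <-; congr cint; apply/funext => z; rewrite addr0.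
  rewrite /pair_fun /Defs.coord -[(c *: v) _]/(c * v _); case: ifP => _; ring.
exists Q; split => // psi tp; rewrite p0 ?wQ ?p0//; first exact: L2loc_locally.
  exact: L2loc_locally.
exact: tQ.
Qed.

Lemma weakly_kappa P u g (d : R) :
  (forall lam u g, 0 < lam -> weakly P u g -> weakly P (dilate lam u) (dilate lam g)) ->
  0 < d -> weakly P u g -> weakly P (kappa d u) (kappa d g).
Proof. by move=> Pd d0 /(Pd d _ _ d0); exact: weakly_scale. Qed.

End WeakDerivatives.

(** * The spaces K^{s,gamma;e} *)

Section Weights.
Context {R : realType} {n : nat} {X : closed_manifold R n}.
Local Notation C := R[i].
Local Notation cylfun := (cylfun X).
Implicit Types (u v : cylfun) (e : R).

Lemma jap1_gt0 (r : R) : 0 < jap1 r.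
Proof. by rewrite sqrtr_gt0 ltr_pwDl// sqr_ge0. Qed.

Lemma mulr_powK e u : mulr_pow e (mulr_pow (- e) u) = u.
Proof.
apply/funext => rx; rewrite /mulr_pow mulrA.
rewrite -[((_%:C)%C * (_%:C)%C)]rmorphM /= -powRD; last by rewrite [X in _ ==> ~~ X]gt_eqF ?jap1_gt0 ?implybT.
by rewrite subrr powRr0 mul1r.
Qed.

Lemma mulr_pow0 u : mulr_pow 0 u = u.
Proof. by apply/funext => rx; rewrite /mulr_pow powRr0 mul1r. Qed.

Lemma mulr_pow_lin e (c : C) u v :
  mulr_pow e (c *: u + v) = c *: mulr_pow e u + mulr_pow e v.
Proof.
apply/funext => rx; rewrite /mulr_pow.
rewrite -[(c *: u + v) _]/(c * u _ + v _) -[RHS]/(c * (_ * u _) + _ * v _).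
by ring.
Qed.

Lemma mulr_powB e u v : mulr_pow e (u - v) = mulr_pow e u - mulr_pow e v.
Proof.
apply/funext => rx; rewrite /mulr_pow.
rewrite -[(u - v) _]/(u _ - v _) -[RHS]/(_ * u _ - _ * v _).
by ring.
Qed.

Lemma mulr_pow00 e : mulr_pow e (0 : cylfun) = 0.
Proof. by apply/funext => rx; rewrite /mulr_pow mulr0. Qed.

End Weights.

Section ConeHilbertSpaces.
Context {R : realType} {n : nat} {X : closed_manifold R n}.
Local Notation C := R[i].
Local Notation E := (cylfun X).
Context {Rs : nat -> R -> (X -> C) -> X -> C} {w : R -> R}.
Context {ip : nat -> R -> E -> E -> C}.
Hypothesis hip : forall s gam, K_structure Rs w s gam (ip s gam).

Lemma Ksge0 s gam : Ksge Rs w s gam 0 = Ksg Rs w s gam.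
Proof. by apply/funext => u; rewrite /Ksge mulr_pow0. Qed.

Lemma ipe0 s gam : ipe (ip s gam) 0 = ip s gam.
Proof. by apply/funext => u; apply/funext => v; rewrite /ipe !mulr_pow0. Qed.

(** Multiplication by <r>^e is a bijection, and the structure is transported
    along it. *)
Lemma hilbert_Ksge s gam e : hilbert (Ksge Rs w s gam e) (ipe (ip s gam) e).
Proof.
have [[h0 hL hlin hherm hge0 hcomp] _ _] := hip s gam.
split; rewrite /Ksge /ipe.
- by rewrite mulr_pow00.
- by move=> a u v Hu Hv; rewrite mulr_pow_lin; exact: hL.
- by move=> a u v z Hu Hv Hz; rewrite mulr_pow_lin hlin.
- by move=> u v Hu Hv; exact: hherm.
- by move=> u Hu; exact: hge0.
move=> uk Huk uc; have [|v Hv vl] := hcomp _ Huk.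
  move=> e' e'0; have [K hK] := uc e' e'0; exists K => k l kK lK.
  by have := hK k l kK lK; rewrite /hnorm mulr_powB.
exists (mulr_pow (- e) v); first by rewrite mulr_powK.
rewrite (_ : (fun k => _) = fun k => hnorm (ip s gam) (mulr_pow e (uk k) - v))//.
by apply/funext => k; rewrite /hnorm mulr_powB mulr_powK.
Qed.

(** The weight moves to the test function, so that equality of distributions is
    the same relation for all weights. *)
Lemma heq_Ksge s gam e u v : Ksge Rs w s gam e u -> Ksge Rs w s gam e v ->
  (forall psi, testf psi -> pairing u psi = pairing v psi) ->
  heq (ip := ipe (ip s gam) e) u v.
Proof.
move=> Hu Hv uv; have [hH hd hc] := hip s gam.
rewrite /heq -[hnorm _ _]/(hnorm (ip s gam) (mulr_pow e (u - v))).
have := hilbB (hilbert_Ksge s gam e) Hu Hv; rewrite /Ksge => Huv.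
apply/(hd _ Huv) => psi tp; rewrite mulr_powB pairing0.
have loc y : Ksge Rs w s gam e y -> locally_L2 (mulr_pow e y) by case=> /L2loc_locally.
have -> : mulr_pow e u - mulr_pow e v = (-1) *: mulr_pow e v + mulr_pow e u.
  by rewrite scaleN1r addrC.
rewrite pairing_lin//; [|exact: loc|exact: loc].
by rewrite !pairing_mulr_pow uv ?mulN1r ?addNr//; exact: testf_mulr_pow.
Qed.

Context {s N : nat} {D : 'I_N -> {ffun 'I_(1 + n) -> 'I_s.+1} -> E -> E}.
Hypothesis hD : cone_system Rs w ip D.
Hypothesis hkappa : forall s gam e,
  group_action (Ksge Rs w s gam e) (ipe (ip s gam) e) (@kappa R n X).

(** [act] chooses a representative; it exists by the characterization of
    K^{s,gamma}. *)
Lemma act_spec gam u j al : (mlen al <= s)%N -> Ksg Rs w s gam u ->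
  let g := act (Ksge Rs w 0 gam (- s%:R)) (D j al) u in
  Ksge Rs w 0 gam (- s%:R) g /\ weakly (D j al) u g.
Proof.
move=> als Hu; have [_ /(_ j al als)[g Hg wg]] := (cs_mem hD gam u).1 Hu.
rewrite /act /=; case: xgetP => [g' _ [] //|/(_ g) []].
by split.
Qed.

Lemma ler_sqr_sum (I : finType) (P : pred I) (F : I -> R) i : P i ->
  F i ^+ 2 <= \sum_(i' | P i') F i' ^+ 2.
Proof.
by move=> Pi; rewrite (bigD1 i)//= lerDl sumr_ge0// => i' _; exact: sqr_ge0.
Qed.

(** Boundedness is one half of the equivalence of norms; linearity holds modulo
    null elements because the weak action determines its value as a
    distribution. *)
Lemma bounded_act gam j al : mlen al = s ->
  bounded_op (Ksg Rs w s gam) (ip s gam) (Ksge Rs w 0 gam (- s%:R))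
    (ipe (ip 0%N gam) (- s%:R)) (act (Ksge Rs w 0 gam (- s%:R)) (D j al)).
Proof.
move=> als; have les : (mlen al <= s)%N by rewrite als.
have [hH _ _] := hip s gam; have hH' := hilbert_Ksge 0 gam (- s%:R).
split.
- by move=> u Hu; have [] := act_spec j les Hu.
- move=> a u v Hu Hv.
  have [Tu wu] := act_spec j les Hu; have [Tv wv] := act_spec j les Hv.
  have [Tw ww] := act_spec j les (hilbL hH a Hu Hv).
  apply: heq_Ksge => //; first exact: (hilbL hH').
  move=> psi tp; rewrite (weakly_lin wu wv ww)// pairing_lin//.
    by case: wu => _ /L2loc_locally.
  by case: wv => _ /L2loc_locally.
have [c1 [c2 [c10 [c20 hc]]]] := cs_norm2 hD gam.
exists c2; first exact: ltW.
move=> u Hu; have [_] := hc u Hu; rewrite -EFinM lee_fin /Knorm (ipe0 s) => hc2; apply: le_trans hc2.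
apply: (le_trans (y := Num.sqrt (hnorm (ipe (ip 0%N gam) (- s%:R)) (act (Ksge Rs w 0 gam (- s%:R)) (D j al) u) ^+ 2))).
  by rewrite sqrtr_sqr ger0_norm// hnorm_ge0.
rewrite ler_wsqrtr//; apply: ler_wpDl; first exact: sqr_ge0.
rewrite (bigD1 al) ?als//=; apply: ler_wpDr.
  by apply: sumr_ge0 => al' _; apply: sumr_ge0 => j' _; exact: sqr_ge0.
exact: (ler_sqr_sum (fun j => hnorm (ipe (ip 0%N gam) (- s%:R)) (act _ (D j al) u))).
Qed.

Lemma bounded_incl gam :
  bounded_op (Ksg Rs w s gam) (ip s gam) (Ksge Rs w 0 gam 0) (ipe (ip 0%N gam) 0) id.
Proof.
have [hH _ _] := hip s gam.
have sub u : Ksg Rs w s gam u -> Ksge Rs w 0 gam 0 u.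
  by rewrite Ksge0 => /(cs_mem hD gam u).1[].
split=> //; first by move=> a u v Hu Hv; exact: (heq_refl (hilbert_Ksge 0 gam 0)).
have [c1 [c2 [c10 [c20 hc]]]] := cs_norm2 hD gam.
exists c2; first exact: ltW.
move=> u Hu; have [_] := hc u Hu; rewrite -EFinM lee_fin /Knorm !ipe0 => hc2; apply: le_trans hc2.
apply: (le_trans (y := Num.sqrt (hnorm (ip 0%N gam) u ^+ 2))).
  by rewrite sqrtr_sqr ger0_norm// hnorm_ge0.
rewrite ler_wsqrtr// lerDl.
by apply: sumr_ge0 => al' _; apply: sumr_ge0 => j' _; exact: sqr_ge0.
Qed.

(** Both sides represent the weak action on the dilated function, since the
    operators are dilation invariant. *)
Lemma act_kappa gam j al d u : mlen al = s -> 0 < d -> Ksg Rs w s gam u ->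
  heq (ip := ipe (ip 0%N gam) (- s%:R))
    (act (Ksge Rs w 0 gam (- s%:R)) (D j al) (kappa d u))
    (kappa d (act (Ksge Rs w 0 gam (- s%:R)) (D j al) u)).
Proof.
move=> als d0 Hu; have les : (mlen al <= s)%N by rewrite als.
have [Tu wu] := act_spec j les Hu.
have Hk : Ksg Rs w s gam (kappa d u).
  by have := ga_stable (hkappa s gam 0) d0; rewrite Ksge0; apply.
have [Tk wk] := act_spec j les Hk.
apply: heq_Ksge => //; first exact: (ga_stable (hkappa 0 gam _) d0).
move=> psi tp; apply: (weakly_uniq wk) => //.
by apply: weakly_kappa => // lam u' g' l0; exact: (cs_dilate hD).
Qed.

End ConeHilbertSpaces.

(** * Sums over optional indices *)

Section OptionSums.
Context {V : Type} {idx : V} {op : Monoid.com_law idx}.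

Lemma big_option (T : finType) (F : option T -> V) :
  \big[op/idx]_o F o = op (F None) (\big[op/idx]_t F (Some t)).
Proof.
rewrite (bigD1 None)//=; congr (op _ _).
rewrite (reindex_omap Some id) /=; last by case.
by apply: eq_bigl => t; rewrite eqxx.
Qed.

Lemma big_sig_cond (T : finType) (P : pred T) (F : T -> V) :
  \big[op/idx]_(x : {x | P x}) F (val x) = \big[op/idx]_(x | P x) F x.
Proof. by rewrite (big_sub P). Qed.

(** The four groups of terms in the norm are the four cases of one double sum, in
    which each of the two kinds of operators may be absent. *)
Lemma big_option2 (A B J : finType) (P : pred A) (Q : pred B) (F0 : V)
    (F1 : B -> V) (F2 : A -> J -> V) (F3 : A -> J -> B -> V) :
  \big[op/idx]_(i : option ({a | P a} * J)) \big[op/idx]_(o : option {b | Q b})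
    match i, o with
    | None, None => F0 | None, Some b => F1 (val b)
    | Some t, None => F2 (val t.1) t.2 | Some t, Some b => F3 (val t.1) t.2 (val b)
    end =
  op (op (op F0 (\big[op/idx]_(b | Q b) F1 b))
     (\big[op/idx]_(a | P a) \big[op/idx]_j F2 a j))
     (\big[op/idx]_(a | P a) \big[op/idx]_j \big[op/idx]_(b | Q b) F3 a j b).
Proof.
rewrite big_option big_option -!Monoid.mulmA big_sig_cond; congr (op _ (op _ _)).
transitivity (op (\big[op/idx]_(t : {a | P a} * J) F2 (val t.1) t.2)
    (\big[op/idx]_(t : {a | P a} * J) \big[op/idx]_(b : {b | Q b}) F3 (val t.1) t.2 (val b))).
  by rewrite -big_split; apply: eq_bigr => t _; rewrite big_option.
congr (op _ _); first by rewrite -[RHS]big_sig_cond [RHS]pair_bigA.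
rewrite -[RHS]big_sig_cond [RHS]pair_bigA; apply: eq_bigr => t _ /=.
by rewrite -[RHS]big_sig_cond.
Qed.

End OptionSums.

(** * Top order monomials *)

Section Monomials.
Context {R : realType} {q s : nat}.
Local Notation p := (1 + q)%N.
Local Notation multi := {b : {ffun 'I_p -> 'I_s.+1} | mlen b == s}.
Implicit Types eta : 'rV[R]_p.

Lemma monomial0 eta : monomial [ffun=> ord0 : 'I_s.+1] eta = 1 :> R.
Proof. by rewrite /monomial big1// => i _; rewrite ffunE expr0. Qed.

Lemma entry_le_jap eta i : `|eta 0 i| <= jap eta.
Proof.
rewrite -(ler_pXn2r (n := 2)) ?nnegrE//; last exact: ltW (jap_gt0 _).
rewrite real_normK ?num_real// jap_sqr /dotp (bigD1 i)//= -expr2 addrCA lerDl.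
by rewrite addr_ge0// sumr_ge0// => j _; rewrite -expr2 sqr_ge0.
Qed.

Lemma monomial_sqr_le (b : {ffun 'I_p -> 'I_s.+1}) eta : mlen b = s ->
  monomial b eta ^+ 2 <= (jap eta ^+ s) ^+ 2.
Proof.
move=> bs; rewrite -real_normK ?num_real// ler_pXn2r ?nnegrE//; last first.
  by rewrite exprn_ge0// ltW// jap_gt0.
have -> : jap eta ^+ s = \prod_(i < p) jap eta ^+ b i by rewrite prodrXr -/(mlen b) bs.
rewrite /monomial normr_prod; apply: ler_prod => i _.
by rewrite normrX exprn_ge0//= lerXn2r ?nnegrE ?entry_le_jap// ltW// jap_gt0.
Qed.

(** A largest coordinate of [eta], raised to the power [s], is one of the
    monomials. *)
Lemma jap_pow_le eta : (jap eta ^+ s) ^+ 2 <=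
  (p%:R + 1) ^+ s * (1 + \sum_(t : multi) monomial (val t) eta ^+ 2).
Proof.
have [i0 _ hi0] := @arg_maxP _ _ _ (0 : 'I_p) xpredT (fun i => eta 0 i ^+ 2) isT.
pose M := Num.max 1 (eta 0 i0 ^+ 2).
have M1 : 1 <= M by rewrite le_max lexx.
have jM : jap eta ^+ 2 <= (p%:R + 1) * M.
  rewrite jap_sqr addrC mulrDl mul1r lerD// /dotp.
  apply: (@le_trans _ _ (\sum_(i < p) M)); last by rewrite sumr_const card_ord mulr_natl.
  apply: ler_sum => i _; rewrite -expr2 le_max; apply/orP; right; exact: (hi0 i isT).
rewrite -exprM mulnC exprM (le_trans (lerXn2r s _ _ jM)) ?nnegrE ?sqr_ge0//.
  by rewrite mulr_ge0 ?addr_ge0// (le_trans ler01).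
rewrite exprMn ler_wpM2l ?exprn_ge0 ?addr_ge0//.
have S0 : 0 <= \sum_(t : multi) monomial (val t) eta ^+ 2.
  by apply: sumr_ge0 => t _; exact: sqr_ge0.
rewrite /M; case: (leP 1 (eta 0 i0 ^+ 2)) => _; last by rewrite expr1n lerDl.
pose b : {ffun 'I_p -> 'I_s.+1} := [ffun i => if i == i0 then ord_max else ord0].
have bs : mlen b == s.
  rewrite /mlen (bigD1 i0)//= big1 => [|i /negbTE ii0]; rewrite ffunE ?eqxx ?ii0//.
  by rewrite addn0.
have bm : monomial b eta = eta 0 i0 ^+ s.
  rewrite /monomial (bigD1 i0)//= big1 => [|i /negbTE ii0]; rewrite ffunE ?eqxx ?ii0//.
  by rewrite mulr1.
rewrite (bigD1 (exist _ b bs : multi))//= bm -!exprM mulnC addrCA lerDl.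
by rewrite addr_ge0// sumr_ge0// => t _; exact: sqr_ge0.
Qed.

(** [None] is the zero multi-index, kept apart from the multi-indices of length
    [s] because the two coincide when [s = 0]. *)
Definition top_index (o : option multi) : {ffun 'I_p -> 'I_s.+1} :=
  if o is Some t then val t else [ffun=> ord0].

Lemma monomials_equiv : exists d1 d2 : R, [/\ 0 < d1, 0 < d2 & forall eta,
  d1 ^+ 2 * (jap eta ^+ s) ^+ 2 <= \sum_o monomial (top_index o) eta ^+ 2
    <= d2 ^+ 2 * (jap eta ^+ s) ^+ 2].
Proof.
(* the constants are the square roots of those in [jap_pow_le] and of one plus
   the number of multi-indices *)
have p0 : 0 < (p%:R + 1 : R) ^+ s by rewrite exprn_gt0// ltr_wpDl.
exists (Num.sqrt ((p%:R + 1) ^+ s)^-1), (Num.sqrt (1 + #|{: multi}|%:R)).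
split=> [||eta]; rewrite ?sqrtr_gt0 ?invr_gt0// ?ltr_pwDl//.
rewrite sqr_sqrtr ?invr_ge0; last exact: ltW.
rewrite sqr_sqrtr ?addr_ge0// big_option /= monomial0 expr1n.
rewrite ler_pdivrMl// jap_pow_le /= mulrDl mul1r lerD//.
  by rewrite -exprM exprn_ege1// jap_ge1.
rewrite mulr_natl -sumr_const; apply: ler_sum => t _.
by apply: monomial_sqr_le; apply/eqP; exact: (svalP t).
Qed.

End Monomials.

(** * Edge spaces with fibre K^{s,gamma} *)

Section ConeEdgeSpaces.
Context {R : realType} {n q : nat} {X : closed_manifold R n}.
Local Notation C := R[i].
Local Notation E := (cylfun X).
Local Notation p := (1 + q)%N.
Context {Rs : nat -> R -> (X -> C) -> X -> C} {w : R -> R}.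
Context {ip : nat -> R -> E -> E -> C}.
Hypothesis hip : forall s gam, K_structure Rs w s gam (ip s gam).
Hypothesis hkappa : forall s gam e,
  group_action (Ksge Rs w s gam e) (ipe (ip s gam) e) (@kappa R n X).
Context {s N : nat} {D : 'I_N -> {ffun 'I_(1 + n) -> 'I_s.+1} -> E -> E}.
Hypothesis hD : cone_system Rs w ip D.
Context {gam : R}.

Local Notation opI := (option ({al : {ffun 'I_(1 + n) -> 'I_s.+1} | mlen al == s} * 'I_N)).
(** [None] stands for the identity, so that the zero order term of the norm and
    the terms of top order form one family. *)
Definition op_weight (i : opI) : R := if i is Some _ then - s%:R else 0.
Definition op_of (i : opI) : E -> E :=
  if i is Some t then act (Ksge Rs w 0 gam (- s%:R)) (D t.2 (val t.1)) else id.

Local Notation Hs := (Ksge Rs w s gam 0).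
Local Notation ips := (ipe (ip s gam) 0).
Local Notation Hi i := (Ksge Rs w 0 gam (op_weight i)).
Local Notation ipi i := (ipe (ip 0%N gam) (op_weight i)).

Lemma bounded_op_of i : bounded_op Hs ips (Hi i) (ipi i) (op_of i).
Proof.
rewrite Ksge0 ipe0; case: i => [[al j]|]; last exact: (bounded_incl hip hD).
by apply: (bounded_act hip hD); apply/eqP; exact: (svalP al).
Qed.

Lemma op_of_kappa i d u : 0 < d -> Hs u ->
  heq (ip := ipi i) (op_of i (kappa d u)) (kappa d (op_of i u)).
Proof.
move=> d0 Hu; case: i => [[al j]|]; last first.
  exact: (heq_refl (hilbert_Ksge hip 0 gam 0)).
apply: (act_kappa hip hD hkappa) => //; first by apply/eqP; exact: (svalP al).
by rewrite -Ksge0.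
Qed.

Lemma op_of_equiv : exists c1 c2 : R, [/\ 0 < c1, 0 < c2 & forall u, Hs u ->
  c1 ^+ 2 * hnorm ips u ^+ 2 <= \sum_i hnorm (ipi i) (op_of i u) ^+ 2
    <= c2 ^+ 2 * hnorm ips u ^+ 2].
Proof.
have [c1 [c2 [c10 [c20 hc]]]] := cs_norm2 hD gam.
exists c1, c2; split=> // u; rewrite Ksge0 => /hc[].
rewrite -!EFinM !lee_fin.
set S := (_ + _); have -> : \sum_i hnorm (ipi i) (op_of i u) ^+ 2 = S.
  rewrite /S big_option; congr (_ + _).
  rewrite -[RHS]big_sig_cond [RHS]pair_bigA.
  by apply: eq_bigr => -[al j] _.
have S0 : 0 <= S.
  rewrite addr_ge0 ?sqr_ge0// sumr_ge0// => al _; rewrite sumr_ge0// => j _; exact: sqr_ge0.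
rewrite -[Knorm _ _ _ _ _]/(hnorm ips u) => h1 h2.
rewrite -!exprMn -(sqr_sqrtr S0) !ler_pXn2r ?h1 ?h2// nnegrE ?sqrtr_ge0//.
  by rewrite mulr_ge0 ?hnorm_ge0// ltW.
by rewrite mulr_ge0 ?hnorm_ge0// ltW.
Qed.

Lemma vD0 (H : set E) (ipH : E -> E -> C) (f : 'rV[R]_p -> E) :
  vD H ipH ([ffun=> ord0] : {ffun 'I_p -> 'I_s.+1}) f = f.
Proof.
apply/funext => y; rewrite /vD.
have -> : mlen ([ffun=> ord0] : {ffun 'I_p -> 'I_s.+1}) = 0%N.
  by rewrite /mlen big1// => i _; rewrite ffunE.
have -> : mseq ([ffun=> ord0] : {ffun 'I_p -> 'I_s.+1}) = [::].
  rewrite /mseq; elim: (enum _) => //= i l ->.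
  by rewrite ffunE.
by rewrite expr0 scale1r.
Qed.

Local Notation multi := {b : {ffun 'I_p -> 'I_s.+1} | mlen b == s}.

(** The function under each of the norms on the right-hand side, by the case of
    the two optional operators. *)
Definition cone_edge (i : opI) (o : option multi) (f : 'rV[R]_p -> E) : 'rV[R]_p -> E :=
  match i, o with
  | None, None => f
  | None, Some b => KD Rs w ip 0 gam 0 (val b) f
  | Some t, None => Kact Rs w 0 gam (- s%:R) (D t.2 (val t.1)) f
  | Some t, Some b => KD Rs w ip 0 gam (- s%:R) (val b)
                        (Kact Rs w 0 gam (- s%:R) (D t.2 (val t.1)) f)
  end.

Lemma cone_edgeE i o f : cone_edge i o f =
  edge_derivative (H' := fun i => Hi i) (ip' := fun i => ipi i) (T := op_of) (b := top_index)
    i o f.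
Proof. by case: i => [t|]; case: o => [b|] //; rewrite /edge_derivative /= vD0. Qed.

Lemma cone_edge_mem i o f : WK Rs w ip s s gam 0 f ->
  WK Rs w ip 0 0 gam (op_weight i) (fun k => cone_edge i o (f k)).
Proof.
move=> Wf; have [c1 [c2 [_ _ hc]]] := op_of_equiv.
have [d1 [d2 [_ _ hd]]] := @monomials_equiv R q s.
rewrite (_ : (fun k => _) = fun k => edge_derivative (H' := fun i => Hi i)
  (ip' := fun i => ipi i) (T := op_of) (b := top_index) i o (f k)); last first.
  by apply/funext => k; exact: cone_edgeE.
exact: (Wspace_edge (hilbert_Ksge hip s gam 0) (hkappa s gam 0)
  (fun i => hilbert_Ksge hip 0 gam (op_weight i)) (fun i => hkappa 0 gam (op_weight i))
  bounded_op_of op_of_kappa hc hd).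
Qed.

Lemma cone_edge_norm_equivalence : exists c1 c2 : R, [/\ 0 < c1, 0 < c2 &
  forall f, WK Rs w ip s s gam 0 f ->
  let W := WKnorm Rs w ip s s gam 0 f in
  let N00 := WKnorm Rs w ip (p := p) 0 0 gam 0 in
  let N0s := WKnorm Rs w ip (p := p) 0 0 gam (- s%:R) in
  let S := (N00 f ^+ 2
    + \sum_(b : {ffun 'I_p -> 'I_s.+1} | mlen b == s)
        N00 (fun k => KD Rs w ip 0 gam 0 b (f k)) ^+ 2
    + \sum_(al | mlen al == s) \sum_(j < N)
        N0s (fun k => Kact Rs w 0 gam (- s%:R) (D j al) (f k)) ^+ 2
    + \sum_(al | mlen al == s) \sum_(j < N) \sum_(b : {ffun 'I_p -> 'I_s.+1} | mlen b == s)
        N0s (fun k => KD Rs w ip 0 gam (- s%:R) b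
          (Kact Rs w 0 gam (- s%:R) (D j al) (f k))) ^+ 2)%E in
  ((c1 ^+ 2)%R%:E * (W * W) <= S)%E /\ (S <= (c2 ^+ 2)%R%:E * (W * W))%E].
Proof.
have [c1 [c2 [c10 c20 hc]]] := op_of_equiv.
have [d1 [d2 [d10 d20 hd]]] := @monomials_equiv R q s.
exists (c1 * d1), (c2 * d2); split; [exact: mulr_gt0|exact: mulr_gt0|].
move=> f Wf W N00 N0s S.
pose W' (i : opI) (o : option multi) : \bar R :=
  WKnorm Rs w ip 0 0 gam (op_weight i) (fun k => cone_edge i o (f k)).
have -> : S = (\sum_i \sum_o W' i o * W' i o)%E.
  rewrite /S -[LHS]big_option2; apply: eq_bigr => i _; apply: eq_bigr => o _.
  by case: i => [t|]; case: o => [b|].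
have hW' i o : W' i o = Wlim (Hi i) (ipi i) (@kappa R n X) 0
    (fun k => edge_derivative (H' := fun i => Hi i) (ip' := fun i => ipi i) (T := op_of)
       (b := top_index) i o (f k)).
  rewrite /W' /WKnorm; congr (Wlim _ _ _ _ _); apply/funext => k; exact: cone_edgeE.
have hW : W = Wlim Hs ips (@kappa R n X) s f by [].
have := @edge_norm_equivalence R E Hs ips (hilbert_Ksge hip s gam 0) (@kappa R n X)
  (hkappa s gam 0) p s _ (fun i : opI => Hi i) (fun i => ipi i)
  (fun i => hilbert_Ksge hip 0 gam (op_weight i)) (fun i => hkappa 0 gam (op_weight i))
  op_of bounded_op_of op_of_kappa _ _ top_index c1 c2 d1 d2 hc hd f W W' Wf hW hW'.
exact.
Qed.

Lemma WKnorm_ge0 f : WK Rs w ip (p := p) s s gam 0 f -> (0 <= WKnorm Rs w ip s s gam 0 f)%E.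
Proof.
move=> Wf; have xl := Wspace_cvg (hilbert_Ksge hip s gam 0) (hkappa s gam 0) Wf.
rewrite /WKnorm -(cvg_lim _ xl)//; apply: lime_ge; first exact: cvgP xl.
by apply: nearW => k; exact: esqrt_ge0.
Qed.

End ConeEdgeSpaces.

Lemma esqrt_sandwich (R : realType) (c d : R) (x S : \bar R) :
  0 <= c -> 0 <= d -> (0 <= x)%E ->
  ((c ^+ 2)%R%:E * (x * x) <= S)%E -> (S <= (d ^+ 2)%R%:E * (x * x))%E ->
  (c%:E * x <= esqrt S)%E /\ (esqrt S <= d%:E * x)%E.
Proof.
move=> c0 d0 x0 h1 h2.
have l0 : (0 <= (c ^+ 2)%R%:E * (x * x))%E by rewrite !mule_ge0// lee_fin sqr_ge0.
rewrite -(esqrtM_sqr c0 x0) -(esqrtM_sqr d0 x0).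
by split; apply: le_esqrt => //; exact: le_trans h1.
Qed.

Lemma v_of_delta (R : realType) (n q : nat) (X : closed_manifold R n) (br : R -> R)
    (f : 'rV[R]_(1 + q) -> cylfun X) : (forall t, 0 < br t) ->
  (fun (z : 'rV[R]_(1 + q)) (rx : R * X) =>
     delta br f (z 0 0) (rx.1 * (br (z 0 0))^-1) rx.2 ((br (z 0 0))^-1 *: rsubmx z)) = f.
Proof.
move=> br0; apply/funext => z; apply/funext => -[r x]; rewrite /delta /=.
have bz : br (z 0 0) != 0 by rewrite gt_eqF.
rewrite scalerA divff// scale1r mulrCA divff// mulr1; congr (f _ _).
rewrite -[RHS](hsubmxK z); congr row_mx; apply/rowP => i.
by rewrite (ord1 i) !mxE; congr (z _ _); exact/val_inj.
Qed.

(** Both substitutions undo [delta], as [br] is positive; [delta_inv] and the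
    function [v] differ only by the order of a product. *)
Lemma delta_invK (R : realType) (n q : nat) (X : closed_manifold R n) (br : R -> R)
    (f : 'rV[R]_(1 + q) -> cylfun X) : (forall t, 0 < br t) ->
  delta_inv br (delta br f) = f.
Proof.
move=> br0; rewrite -[RHS](v_of_delta f br0).
by apply/funext => z; apply/funext => rx; rewrite /delta_inv mulrC.
Qed.

Theorem proposition2p9 (R : realType) (n q : nat) (X : closed_manifold R n)
    (Rs : nat -> R -> (X -> R[i]) -> X -> R[i])
    (hRs : forall s : nat, order_reducing s%:R (Rs s))
    (w : R -> R) (hw : cutoff w) (br : R -> R) (hbr : bracket br)
    (ip : nat -> R -> cylfun X -> cylfun X -> R[i])
    (hip : forall s gam, K_structure Rs w s gam (ip s gam))
    (hkappa : forall s gam e,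
       group_action (Ksge Rs w s gam e) (ipe (ip s gam) e) (@kappa R n X))
    (s N : nat) (D : 'I_N -> {ffun 'I_(1 + n) -> 'I_s.+1} -> cylfun X -> cylfun X)
    (hD : cone_system Rs w ip D) (gam1 : R) :
  let W00 := WK Rs w ip (p := 1 + q) 0 0 gam1 0 in
  let W0s := WK Rs w ip (p := 1 + q) 0 0 gam1 (- s%:R) in
  let N00 := WKnorm Rs w ip (p := 1 + q) 0 0 gam1 0 in
  let N0s := WKnorm Rs w ip (p := 1 + q) 0 0 gam1 (- s%:R) in
  let Db (b : {ffun 'I_(1 + q) -> 'I_s.+1}) v := fun k => KD Rs w ip 0 gam1 0 b (v k) in
  let Da j al v := fun k => Kact Rs w 0 gam1 (- s%:R) (D j al) (v k) in
  let DbDa (b : {ffun 'I_(1 + q) -> 'I_s.+1}) j al v :=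
    fun k => KD Rs w ip 0 gam1 (- s%:R) b (Da j al v k) in
  let v_of (u : nat -> R -> R -> X -> 'rV[R]_q -> R[i]) :=
    fun k (z : 'rV[R]_(1 + q)) (rx : R * X) =>
      let: t := z 0 0 in let: y := rsubmx z in
      u k t (rx.1 * (br t)^-1) rx.2 ((br t)^-1 *: y) in
  (forall u, Wcone Rs w ip br s gam1 u ->
     [/\ W00 (v_of u),
         forall b, mlen b = s -> W00 (Db b (v_of u)),
         forall j al, mlen al = s -> W0s (Da j al (v_of u))
       & forall b j al, mlen b = s -> mlen al = s -> W0s (DbDa b j al (v_of u))]) /\
  norm_equivalent (Wcone Rs w ip br s gam1)
    (Wcone_norm Rs w ip br s gam1)
    (fun u => esqrt (
       N00 (v_of u) ^+ 2
       + \sum_(b | mlen b == s) N00 (Db b (v_of u)) ^+ 2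
       + \sum_(al | mlen al == s) \sum_(j < N) N0s (Da j al (v_of u)) ^+ 2
       + \sum_(al | mlen al == s) \sum_(j < N) \sum_(b | mlen b == s)
           N0s (DbDa b j al (v_of u)) ^+ 2))%E.
Proof.
move=> W00 W0s N00 N0s Db Da DbDa v_of.
have br0 t : 0 < br t by case: hbr.
have v_ofE f : v_of (fun k => delta br (f k)) = f.
  by apply/funext => k; exact: v_of_delta.
have [c1 [c2 [c10 c20 hc]]] := cone_edge_norm_equivalence hip hkappa hD (q := q) (gam := gam1).
split=> [_ [f Wf ->]|].
  rewrite v_ofE; split.
  - exact: (cone_edge_mem hip hkappa hD None None Wf).
  - by move=> b /eqP bs; exact: (cone_edge_mem hip hkappa hD None (Some (exist _ b bs)) Wf).
  - move=> j al /eqP als; exact: (cone_edge_mem hip hkappa hD (Some (exist _ al als, j)) None Wf).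
  move=> b j al /eqP bs /eqP als.
  exact: (cone_edge_mem hip hkappa hD (Some (exist _ al als, j)) (Some (exist _ b bs)) Wf).
exists c1, c2; split=> //; split=> // _ [f Wf ->]; rewrite v_ofE.
have -> : Wcone_norm Rs w ip br s gam1 (fun k => delta br (f k)) = WKnorm Rs w ip s s gam1 0 f.
  rewrite /Wcone_norm; congr (WKnorm _ _ _ _ _ _ _ _); apply/funext => k.
  exact: delta_invK.
have [] := hc f Wf.
by apply: esqrt_sandwich; [exact: ltW|exact: ltW|exact: WKnorm_ge0].
Qed.
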